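(* For any $C^*$-algebra $A$ the following are equivalent: (i) Every left centralizer of $K(A)$ is locally bounded. (ii) $A$ has no infinite dimensional elementary direct summand.
   Context: $K(A)$ denotes the Pedersen ideal of $A$, i.e. the smallest dense two-sided ideal of $A$. A left centralizer of an algebra $B$ is a linear transformation $T:B\to B$ (not assumed bounded) such that $T(xb)=(Tx)b$ for all $x,b\in B$. A left centralizer $T$ of $K(A)$ is locally bounded if there is a family $\{I_j\}$ of closed two-sided ideals of $A$ such that $A$ is the norm closure of $\sum_j I_j$ and $T_{|K(A)\cap I_j}$ is bounded for each $j$. An elementary $C^*$-algebra is one isomorphic to the algebra $\mathcal K(H)$ of compact operators on a Hilbert space $H$. Condition (ii) says that $A$ is not of the form $A_0\oplus A_1$ for closed two-sided ideals $A_0,A_1$ with $A_1$ elementary and infinite dimensional. *)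

(* Defs.v *)
From HB Require Import structures.
From mathcomp Require Import all_boot all_order all_algebra.
From mathcomp Require Import complex.
From mathcomp Require Import all_classical all_reals all_analysis.

Set Implicit Arguments.
Unset Strict Implicit.
Unset Printing Implicit Defensive.

Import Order.TTheory GRing.Theory Num.Theory.
Import numFieldNormedType.Exports.

Local Open Scope classical_set_scope.
Local Open Scope ring_scope.
Local Open Scope complex_scope.

(* The scalar field is R[i], the complex numbers over the real field R. Norms
   of complex normed modules take their values in R[i]; its order is the
   partial one, where x <= y means that y - x is a nonnegative real. *)

(* C*-algebras need not be unital, and the zero algebra is allowed. *)
HB.mixin Record isCStarAlgebra (R : realType) (A : Type)
    of CompleteNormedModule R[i] A := {
  cmul : A -> A -> A;
  cstar : A -> A;
  cmulA : associative cmul;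
  cmulDl : forall x y z : A, cmul (x + y) z = cmul x z + cmul y z;
  cmulDr : forall x y z : A, cmul x (y + z) = cmul x y + cmul x z;
  cmulZl : forall (a : R[i]) (x y : A), cmul (a *: x) y = a *: cmul x y;
  cmulZr : forall (a : R[i]) (x y : A), cmul x (a *: y) = a *: cmul x y;
  cstarK : involutive cstar;
  cstarD : forall x y : A, cstar (x + y) = cstar x + cstar y;
  cstarZ : forall (a : R[i]) (x : A),
    cstar (a *: x) = (Num.conj a : R[i]) *: cstar x;
  cstarM : forall x y : A, cstar (cmul x y) = cmul (cstar y) (cstar x);
  cnormM : forall x y : A, `|cmul x y| <= `|x| * `|y|;
  cnorm_starM : forall x : A, `|cmul (cstar x) x| = `|x| ^+ 2
}.

#[short(type="cstarAlgType")]
HB.structure Definition CStarAlgebra (R : realType) :=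
  {A of isCStarAlgebra R A & CompleteNormedModule R[i] A}.

HB.mixin Record isHilbert (R : realType) (H : Type)
    of CompleteNormedModule R[i] H := {
  inner : {dot H for Num.conj};
  inner_norm : forall u : H, inner u u = `|u| ^+ 2
}.

#[short(type="hilbertType")]
HB.structure Definition Hilbert (R : realType) :=
  {H of isHilbert R H & CompleteNormedModule R[i] H}.

Section Ideals.
Variables (R : realType) (A : cstarAlgType R).
Implicit Types (I J K : set A) (T : A -> A).

Definition two_sided_ideal I : Prop :=
  [/\ I 0,
      forall (a : R[i]) (x y : A), I x -> I y -> I (a *: x + y),
      forall x y : A, I y -> I (cmul x y)
    & forall x y : A, I x -> I (cmul x y)].

Definition closed_ideal I : Prop := two_sided_ideal I /\ closed I.

Definition dense_ideal I : Prop := two_sided_ideal I /\ dense I.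

(* A smallest dense two-sided ideal is necessarily the intersection of all
   of them (see smallest_dense_idealE); that this intersection is dense is
   Pedersen's theorem. *)
Definition pedersen_ideal : set A := \bigcap_(I in dense_ideal) I.

Lemma smallest_dense_idealE K :
  dense_ideal K -> (forall I, dense_ideal I -> K `<=` I) -> pedersen_ideal = K.
Proof.
by move=> dK minK; apply/seteqP; split=> [x|x Kx I dI]; [exact | exact: minK].
Qed.

(* A map B -> B on a subset B of A is encoded by a map on A, whose values
   outside B are irrelevant in the next two definitions. *)
Definition left_centralizer (B : set A) T : Prop :=
  [/\ forall x, B x -> B (T x),
      forall (a : R[i]) (x y : A), B x -> B y -> T (a *: x + y) = a *: T x + T y
    & forall x b : A, B x -> B b -> T (cmul x b) = cmul (T x) b].

Definition bounded_on (B : set A) T : Prop :=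
  exists M : R, forall x, B x -> `|T x| <= M%:C * `|x|.

(* The algebraic sum: finite sums of elements of the I j. *)
Definition ideal_sum (J : Type) (I : J -> set A) : set A :=
  [set x | exists (s : seq J) (y : J -> A),
     (forall j, I j (y j)) /\ x = \sum_(j <- s) y j].

Definition locally_bounded T : Prop :=
  exists (J : Type) (I : J -> set A),
    [/\ forall j, closed_ideal (I j),
        closure (ideal_sum I) = [set: A]
      & forall j, bounded_on (pedersen_ideal `&` I j) T].

Definition finite_dimensional I : Prop :=
  exists (n : nat) (e : 'I_n -> A), (forall i, I (e i)) /\
    forall x, I x -> exists c : 'I_n -> R[i], x = \sum_(i < n) c i *: e i.

Definition direct_summand I : Prop :=
  closed_ideal I /\ exists I0 : set A,
    [/\ closed_ideal I0, I0 `&` I = [set 0]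
      & forall x, exists x0 x1 : A, [/\ I0 x0, I x1 & x = x0 + x1]].

End Ideals.

Definition compact_operator (R : realType) (H : hilbertType R)
    (T : H -> H) : Prop :=
  linear T /\ precompact (T @` [set u | `|u| <= 1]).

(* phi restricts to a *-isomorphism from I onto the compact operators on H. *)
Definition elementary (R : realType) (A : cstarAlgType R) (I : set A) : Prop :=
  exists (H : hilbertType R) (phi : A -> H -> H),
    [/\ set_bij I [set T | compact_operator T] phi,
        forall (a : R[i]) (x y : A), I x -> I y ->
          forall u, phi (a *: x + y) u = a *: phi x u + phi y u,
        forall x y : A, I x -> I y -> forall u, phi (cmul x y) u = phi x (phi y u)
      & forall x : A, I x ->
          forall u v, inner (phi x u) v = inner u (phi (cstar x) v)].

(* Main.v *)
(** If A = A0 + A1 with A1 the compact operators on an infinite-dimensional H,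
    then K(A) lies in A0 plus the finite-rank operators, and composing the
    latter with an unbounded rank-one linear map of H gives a centralizer
    which is bounded on no ideal meeting A1.

    Conversely let T be a centralizer and b = b^* = b b' a local unit in K(A).
    All x with x b = x lie in K(A), so they form a Banach space L on which T
    acts, commuting with right multiplication by the corner B = {y | y b = y =
    b y}.  If T is unbounded on L, let N be the ideal of the y in B for which
    x |-> T(x) y is bounded.  By uniform boundedness the annihilator D of N in
    B is nonzero, and a gliding hump shows that D contains no infinite
    orthogonal sequence; hence D contains a minimal projection q of A, and T
    is unbounded on A q.  The closed ideal J generated by q is the algebra of
    compact operators on the Hilbert space A q, infinite-dimensional since T
    is unbounded there.  By the same gliding hump every local unit of K(A) has
    finite rank on A q, so A acts on A q by compact operators and J is a
    direct summand.  Otherwise T is bounded on each L, hence on the ideals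
    generated by them, whose sum is dense.

    The continuous functional calculus is replaced by square roots, computed by
    the iteration y' = (x + y^2) / 2 in the real algebra generated by one
    self-adjoint element; positive parts and cut-offs are obtained from them. *)

(* A centralizer is defined only on [K(A)], which need not be complete, so category arguments have
   to run in closed subspaces of A lying inside [K(A)]; the spaces [Aq b] provide them.

   The recurring tool is [nrm_le_of_action]: the norm of y can be read off its action on a set X
   stable under [y^# ** y], provided that every self-adjoint v in [Zr (y^# ** y)] killing X
   satisfies [y ** v = 0]. With X = N and D = 0 it recovers the norm of T x from the products T x n,
   which is what uniform boundedness needs. With X = L it carries a bound on T from L to the closed
   ideal generated by L. With X = [Aq q] it says that the norm of J is the operator norm on the
   Hilbert space.

   D feeds the gliding hump because a nonzero self-adjoint d in D never has [d ** d] in N: D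
   annihilates N, so that would give d^3 = 0. The same hump bounds ranks: if b fixed an infinite
   orthonormal sequence v_n of A q, the projections v_n v_n^# would be orthogonal elements of the
   corner of b, and T would be unbounded along each of them. *)
Require Import Defs.
From HB Require Import structures.
From mathcomp Require Import all_boot all_order all_algebra.
From mathcomp Require Import complex.
From mathcomp Require Import all_classical all_reals all_analysis.
From mathcomp Require Import ring lra.

Set Implicit Arguments.
Unset Strict Implicit.
Unset Printing Implicit Defensive.

Import Order.TTheory GRing.Theory Num.Theory.
Import numFieldNormedType.Exports.

Local Open Scope classical_set_scope.
Local Open Scope ring_scope.
Local Open Scope complex_scope.

(** * Real-valued norms *)

Section RealNorm.
Variables (R : realType) (V : normedModType R[i]).
Implicit Types (x y : V) (c : R[i]).

(** Norms are complex numbers under a partial order; their real parts make [lra] and [nra]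
    available. *)
Definition nrm x : R := complex.Re `|x|.
Definition cabs c : R := complex.Re `|c|.

Lemma nrmE x : `|x| = (nrm x)%:C.
Proof. by rewrite /nrm RRe_real ?ger0_real. Qed.

Lemma cabsE c : `|c| = (cabs c)%:C.
Proof. by rewrite /cabs RRe_real ?ger0_real. Qed.

Lemma nrm_le x (r : R) : (`|x| <= r%:C) = (nrm x <= r).
Proof. by rewrite nrmE lecR. Qed.

Lemma nrm_lt x (r : R) : (`|x| < r%:C) = (nrm x < r).
Proof. by rewrite nrmE ltcR. Qed.

Lemma nrm_ge0 x : 0 <= nrm x.
Proof. by rewrite -ler0c -nrmE. Qed.

Lemma cabs_ge0 c : 0 <= cabs c.
Proof. by rewrite -ler0c -cabsE. Qed.

Lemma nrm0 : nrm 0 = 0.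
Proof. by rewrite /nrm normr0. Qed.

Lemma nrm0_eq0 x : nrm x = 0 -> x = 0.
Proof. by move=> h; apply/normr0_eq0; rewrite nrmE h. Qed.

Lemma nrm_le0 x : nrm x <= 0 -> x = 0.
Proof. by move=> h; apply: nrm0_eq0; apply/le_anti; rewrite h nrm_ge0. Qed.

Lemma nrm_gt0 x : x <> 0 -> 0 < nrm x.
Proof.
by move=> x0; rewrite lt_neqAle nrm_ge0 andbT eq_sym; apply/eqP => /nrm0_eq0.
Qed.

Lemma nrmD x y : nrm (x + y) <= nrm x + nrm y.
Proof. by rewrite -lecR rmorphD /= -!nrmE ler_normD. Qed.

Lemma nrmN x : nrm (- x) = nrm x.
Proof. by rewrite /nrm normrN. Qed.

Lemma nrmB x y : nrm (x - y) = nrm (y - x).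
Proof. by rewrite -nrmN opprB. Qed.

Lemma nrm_tri z x y : nrm (x - y) <= nrm (x - z) + nrm (z - y).
Proof. by have := nrmD (x - z) (z - y); rewrite addrA subrK. Qed.

Lemma nrmBD x y : nrm (x - y) <= nrm x + nrm y.
Proof. by rewrite -(nrmN y) nrmD. Qed.

Lemma nrmDr x y : nrm x <= nrm (x + y) + nrm y.
Proof. by have := nrmBD (x + y) y; rewrite addrK. Qed.

Lemma nrmZ c x : nrm (c *: x) = cabs c * nrm x.
Proof. by apply: complexI; rewrite -nrmE normrZ rmorphM /= -nrmE -cabsE. Qed.

Lemma nrmZr (r : R) x : nrm (r%:C *: x) = `|r| * nrm x.
Proof.
by rewrite nrmZ /cabs normc_def /= expr0n addr0 sqrtr_sqr.
Qed.

Lemma nrmZp (r : R) x : 0 <= r -> nrm (r%:C *: x) = r * nrm x.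
Proof. by move=> r0; rewrite nrmZr ger0_norm. Qed.

Lemma nrm_small x y : (forall e : R, 0 < e -> nrm (x - y) <= e) -> x = y.
Proof.
move=> h; apply/subr0_eq/nrm_le0/ler_addgt0Pr => e e0.
by rewrite add0r h.
Qed.

Lemma nrm_ball x (e : R) y : ball x e%:C y <-> nrm (x - y) < e.
Proof. by rewrite -ball_normE /ball_ /= nrm_lt. Qed.

Lemma pos_complexP c : 0 < c -> exists2 r : R, 0 < r & c = r%:C.
Proof.
case: c => a b; rewrite ltcE /= => /andP[/eqP -> a0].
by exists a.
Qed.

Lemma closureP (M : set V) x :
  closure M x <-> forall e : R, 0 < e -> exists y, M y /\ nrm (x - y) < e.
Proof.
split=> [h e e0|h B].
  have [|y [My /nrm_ball yb]] := h (ball x e%:C); last by exists y.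
  by apply: nbhsx_ballx; rewrite ltcR.
move=> /nbhs_ballP[c /= /pos_complexP[e e0 ->] eB].
have [y [My xy]] := h e e0.
by exists y; split => //; apply: eB; apply/nrm_ball.
Qed.

Lemma closedP (M : set V) : closed M <->
  forall x, (forall e : R, 0 < e -> exists y, M y /\ nrm (x - y) < e) -> M x.
Proof.
split=> h x; first by move=> /closureP; exact: h.
by move=> /closureP; exact: h.
Qed.

Lemma denseP (M : set V) : dense M <->
  forall x (e : R), 0 < e -> exists y, M y /\ nrm (x - y) < e.
Proof.
split=> [h x e e0|h O [x Ox] oO].
  have [||y [/= xy My]] := h (ball x e%:C).
  - by exists x; apply: ballxx; rewrite ltcR.
  - exact: ball_open.
  - by exists y; split => //; apply/nrm_ball.
have /nbhs_ballP[c /= /pos_complexP[e e0 ->] eO] : nbhs x O.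
  exact: open_nbhs_nbhs.
have [y [My xy]] := h x e e0.
by exists y; split => //; apply: eO; apply/nrm_ball.
Qed.

End RealNorm.

(** * Completeness and geometric convergence *)

Section Complete.
Variables (R : realType) (V : completeNormedModType R[i]).

Lemma nrm_complete (u : nat -> V) :
  (forall e : R, 0 < e ->
    exists N, forall m n, (N <= m)%N -> (N <= n)%N -> nrm (u m - u n) < e) ->
  exists l, forall e : R, 0 < e ->
    exists N, forall n, (N <= n)%N -> nrm (l - u n) < e.
Proof.
move=> h; have /cauchy_cvgP cu : cauchy (u @ \oo).
  apply/cauchy_ballP => c /pos_complexP[e e0 ->].
  have [N hN] := h e e0.
  exists (u @` [set n | (N <= n)%N], u @` [set n | (N <= n)%N]) => /=.
    by split; exists N => // n /= Nn; exists n.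
  by move=> [x y] /= [[m Nm <-] [n Nn <-]]; apply/nrm_ball/hN.
exists (lim (u @ \oo)) => e e0.
have /cvg_ballP/(_ e%:C) := cu.
rewrite ltcR => /(_ e0) [N _ hN].
by exists N => n Nn; apply/nrm_ball/hN.
Qed.

Lemma geometric_small (e C : R) : 0 < e ->
  exists N, forall n, (N <= n)%N -> C * 2^-1 ^+ n < e.
Proof.
move=> e0.
have [N] : exists N : nat, `|C| / e < N%:R.
  by exists (Num.trunc (`|C| / e)).+1; rewrite truncnS_gt.
rewrite ltr_pdivrMr // => hN; exists N => n Nn.
rewrite exprVn ltr_pdivrMr ?exprn_gt0 //.
apply: le_lt_trans (ler_norm _) (lt_le_trans hN _).
rewrite mulrC ler_pM2l // -natrX ler_nat.
exact: leq_trans Nn (ltnW (ltn_expl n (isT : 1 < 2)%N)).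
Qed.

Lemma geometric_complete (u : nat -> V) (C : R) :
  (forall n, nrm (u n.+1 - u n) <= C * 2^-1 ^+ n) ->
  exists l, forall n, nrm (l - u n) <= 2 * C * 2^-1 ^+ n.
Proof.
move=> h.
(* The bound is the exact geometric sum from n to n + k - 1, written as a difference of tails so
   that the induction on k closes. *)
have hk n k : nrm (u (n + k)%N - u n) <= 2 * C * 2^-1 ^+ n - 2 * C * 2^-1 ^+ (n + k).
  elim: k => [|k IH]; first by rewrite addn0 !subrr nrm0.
  rewrite addnS; apply: le_trans (nrm_tri (u (n + k)%N) _ _) _.
  by have := h (n + k)%N; rewrite exprS => h'; lra.
have C0 : 0 <= C.
  by have := h 0%N; rewrite expr0 mulr1; apply: le_trans; exact: nrm_ge0.
have p0 k : 0 <= 2 * C * 2^-1 ^+ k.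
  by rewrite mulr_ge0 ?mulr_ge0 // exprn_ge0 // invr_ge0.
have hn n m : (n <= m)%N -> nrm (u m - u n) <= 2 * C * 2^-1 ^+ n.
  move=> nm; have := hk n (m - n)%N; rewrite subnKC // => h'.
  by apply: le_trans h' _; rewrite gerBl.
have [e e0|l hl] := nrm_complete (u := u).
  have [N hN] := geometric_small (4 * C) e0.
  exists N => m n Nm Nn; apply: le_lt_trans (nrm_tri (u N) _ _) _.
  have := hn _ _ Nm; have := hn _ _ Nn; have := hN N (leqnn _).
  rewrite (nrmB (u N)); lra.
exists l => n; apply/ler_addgt0Pr => e e0.
have [N hN] := hl e e0.
have := hN (maxn N n) (leq_maxl _ _); have := hn n (maxn N n) (leq_maxr _ _).
have := nrm_tri (u (maxn N n)) l (u n); lra.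
Qed.

End Complete.

(** * Algebra in a C*-algebra *)

Section RealComplete.
Variable R : realType.

Lemma real_complete (u : nat -> R) :
  (forall e : R, 0 < e ->
    exists N, forall m n, (N <= m)%N -> (N <= n)%N -> `|u m - u n| < e) ->
  exists l, forall e : R, 0 < e ->
    exists N, forall n, (N <= n)%N -> `|l - u n| < e.
Proof.
move=> h; have /cauchy_cvgP cu : cauchy (u @ \oo).
  apply/cauchy_ballP => e e0.
  have [N hN] := h e e0.
  exists (u @` [set n | (N <= n)%N], u @` [set n | (N <= n)%N]) => /=.
    by split; exists N => // n /= Nn; exists n.
  by move=> [x y] /= [[m Nm <-] [n Nn <-]]; apply: hN.
exists (lim (u @ \oo)) => e e0.
have /cvg_ballP/(_ e e0)[N _ hN] := cu.
by exists N => n Nn; apply: hN.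
Qed.

End RealComplete.

Notation "x ** y" := (cmul x y) (at level 40, left associativity) : ring_scope.
Notation "x ^#" := (cstar x) : ring_scope.

Section CStarBasics.
Variables (R : realType) (A : cstarAlgType R).
Implicit Types (x y z : A) (a : R[i]) (r : R).

Lemma cmul0x x : 0 ** x = 0 :> A.
Proof. by apply: (addrI (0 ** x)); rewrite -cmulDl !addr0. Qed.

Lemma cmulx0 x : x ** 0 = 0 :> A.
Proof. by apply: (addrI (x ** 0)); rewrite -cmulDr !addr0. Qed.

Lemma cmulNx x y : (- x) ** y = - (x ** y).
Proof. by apply: (addrI (x ** y)); rewrite -cmulDl !subrr cmul0x. Qed.

Lemma cmulxN x y : x ** (- y) = - (x ** y).
Proof. by apply: (addrI (x ** y)); rewrite -cmulDr !subrr cmulx0. Qed.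

Lemma cmulBl x y z : (x - y) ** z = x ** z - y ** z.
Proof. by rewrite cmulDl cmulNx. Qed.

Lemma cmulBr x y z : x ** (y - z) = x ** y - x ** z.
Proof. by rewrite cmulDr cmulxN. Qed.

Lemma cmul_suml (I : Type) (s : seq I) (f : I -> A) x :
  (\sum_(i <- s) f i) ** x = \sum_(i <- s) f i ** x.
Proof.
elim: s => [|i s IH]; first by rewrite !big_nil cmul0x.
by rewrite !big_cons cmulDl IH.
Qed.

Lemma cmul_sumr (I : Type) (s : seq I) (f : I -> A) x :
  x ** (\sum_(i <- s) f i) = \sum_(i <- s) x ** f i.
Proof.
elim: s => [|i s IH]; first by rewrite !big_nil cmulx0.
by rewrite !big_cons cmulDr IH.
Qed.

Lemma cstar0 : (0 : A)^# = 0.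
Proof. by apply: (addrI (0^#)); rewrite -cstarD !addr0. Qed.

Lemma cstarN x : (- x)^# = - x^#.
Proof. by apply: (addrI (x^#)); rewrite -cstarD !subrr cstar0. Qed.

Lemma cstarB x y : (x - y)^# = x^# - y^#.
Proof. by rewrite cstarD cstarN. Qed.

Lemma cstar_sum (I : Type) (s : seq I) (f : I -> A) :
  (\sum_(i <- s) f i)^# = \sum_(i <- s) (f i)^#.
Proof.
elim: s => [|i s IH]; first by rewrite !big_nil cstar0.
by rewrite !big_cons cstarD IH.
Qed.

Lemma conjR r : Num.conj (r%:C : R[i]) = r%:C.
Proof. by apply: CrealP; rewrite complex_real. Qed.

Lemma cstarZr r x : (r%:C *: x)^# = r%:C *: x^#.
Proof. by rewrite cstarZ conjR. Qed.

Lemma nrmM x y : nrm (x ** y) <= nrm x * nrm y.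
Proof. by rewrite -lecR rmorphM /= -!nrmE cnormM. Qed.

Lemma nrm_starM x : nrm (x^# ** x) = nrm x ^+ 2.
Proof. by apply: complexI; rewrite rmorphXn /= -!nrmE cnorm_starM. Qed.

Lemma nrm_star x : nrm x^# = nrm x.
Proof.
have h y : nrm y <= nrm y^#.
  have [->|/eqP/nrm_gt0 y0] := eqVneq y 0; first by rewrite nrm0 nrm_ge0.
  by rewrite -(ler_pM2r y0) -expr2 -nrm_starM nrmM.
by apply/le_anti; rewrite h -{2}(cstarK x) h.
Qed.

Lemma nrm_Mstar x : nrm (x ** x^#) = nrm x ^+ 2.
Proof. by have := nrm_starM x^#; rewrite cstarK nrm_star. Qed.

Lemma starM_eq0 x : x^# ** x = 0 -> x = 0.
Proof.
move=> h; apply: nrm0_eq0; apply/eqP; rewrite -sqrf_eq0 -nrm_starM h.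
by rewrite nrm0.
Qed.

Lemma Mstar_eq0 x : x ** x^# = 0 -> x = 0.
Proof.
move=> h; rewrite -(cstarK x); apply/eqP; rewrite -cstar0; apply/eqP.
by congr cstar; apply: starM_eq0; rewrite cstarK.
Qed.

Lemma sa_sqr_eq0 x : x^# = x -> x ** x = 0 -> x = 0.
Proof. by move=> sx; rewrite -{1}sx; exact: starM_eq0. Qed.

Lemma sa_cube_eq0 x : x^# = x -> x ** x ** x = 0 -> x = 0.
Proof.
move=> sx h; apply: sa_sqr_eq0 => //; apply: sa_sqr_eq0.
  by rewrite cstarM sx.
by rewrite cmulA h cmul0x.
Qed.

Lemma nrm_sa_sqr x : x^# = x -> nrm (x ** x) = nrm x ^+ 2.
Proof. by move=> sx; rewrite -{1}sx nrm_starM. Qed.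

Lemma nrm_le_act z r : 0 <= r ->
  (forall b, nrm (z ** b) <= r * nrm b) -> nrm z <= r.
Proof.
move=> r0 h; have [->|/eqP/nrm_gt0 z0] := eqVneq z 0; first by rewrite nrm0.
by have := h z^#; rewrite nrm_Mstar nrm_star expr2 ler_pM2r.
Qed.

Lemma cmul_near x y e : 0 < e -> exists2 d, 0 < d &
  forall x' y', nrm (x - x') < d -> nrm (y - y') < d ->
    nrm (x ** y - x' ** y') < e.
Proof.
move=> e0; pose M := nrm x + nrm y + 1.
have x0 := nrm_ge0 x; have y0 := nrm_ge0 y.
have M0 : 0 < M by rewrite /M; lra.
exists (Num.min 1 (e / M)); first by rewrite lt_min ltr01 divr_gt0.
move=> x' y'; rewrite !lt_min => /andP[x1 xe] /andP[y1 ye].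
move: xe ye; rewrite !ltr_pdivlMr // => xe ye.
have -> : x ** y - x' ** y' = (x - x') ** y + x' ** (y - y').
  by rewrite cmulBl cmulBr addrA subrK.
apply: le_lt_trans (nrmD _ _) _.
have h1 := nrmM (x - x') y; have h2 := nrmM x' (y - y').
have x'x : nrm x' <= nrm x + 1.
  by have := nrmBD x (x - x'); rewrite opprB addrC subrK; lra.
have : nrm x' * nrm (y - y') <= (nrm x + 1) * nrm (y - y').
  by rewrite ler_wpM2r ?nrm_ge0.
have := nrm_ge0 (x - x'); have := nrm_ge0 (y - y').
have [xx' yy'|/negP h _ dx] := leP (nrm (y - y')) (nrm (x - x')).
  have : nrm (y - y') * (nrm x + 1) <= nrm (x - x') * (nrm x + 1).
    by rewrite ler_wpM2r //; lra.
  by rewrite /M in xe; lra.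
have : nrm (x - x') * nrm y <= nrm (y - y') * nrm y.
  by rewrite ler_wpM2r //; lra.
by rewrite /M in ye; lra.
Qed.

Definition real_subalgebra (M : set A) : Prop :=
  [/\ M 0, forall r x y, M x -> M y -> M (r%:C *: x + y),
      forall x y, M x -> M y -> M (x ** y) & closed M].

(** The closed non-unital real algebra generated by x. As an intersection it allows proofs by
    exhibiting one closed subalgebra that contains x; scalars are real so that self-adjointness
    survives ([Zr_sa]). *)
Definition Zr x : set A :=
  [set z | forall M, real_subalgebra M -> M x -> M z].

Lemma Zr_self x : Zr x x.
Proof. by move=> M. Qed.

Lemma Zr_subalgebra x : real_subalgebra (Zr x).
Proof.
split=> [M []//|r y z Zy Zz M sM Mx|y z Zy Zz M sM Mx|].
- by case: (sM) => _ MD _ _; apply: MD; [exact: Zy | exact: Zz].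
- by case: (sM) => _ _ MM _; apply: MM; [exact: Zy | exact: Zz].
apply/closedP => y h M sM Mx; case: (sM) => _ _ _ /closedP; apply.
by move=> e e0; have [z [Zz yz]] := h e e0; exists z; split => //; exact: Zz.
Qed.

Section SubalgebraTheory.
Variable M : set A.
Hypothesis sM : real_subalgebra M.

Lemma rsub0 : M 0. Proof. by case: sM. Qed.
Lemma rsubD x y : M x -> M y -> M (x + y).
Proof. by case: sM => _ h _ _ Mx My; have := h 1 x y Mx My; rewrite scale1r. Qed.
Lemma rsubZ r x : M x -> M (r%:C *: x).
Proof. by case: sM => M0 h _ _ Mx; have := h r x 0 Mx M0; rewrite addr0. Qed.
Lemma rsubN x : M x -> M (- x).
Proof. by move=> Mx; rewrite -scaleN1r -(rmorphN1 (real_complex R)); exact: rsubZ. Qed.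
Lemma rsubB x y : M x -> M y -> M (x - y).
Proof. by move=> Mx My; apply: rsubD => //; exact: rsubN. Qed.
Lemma rsubM x y : M x -> M y -> M (x ** y). Proof. by case: sM => _ _ h _; exact: h. Qed.
Lemma rsub_lim x : (forall e : R, 0 < e -> exists y, M y /\ nrm (x - y) < e) -> M x.
Proof. by case: sM => _ _ _ /closedP h; exact: h. Qed.
Lemma rsub_Zr x z : M x -> Zr x z -> M z.
Proof. by move=> Mx; exact. Qed.
End SubalgebraTheory.

Lemma real_subalgebra_commutant y : real_subalgebra [set z | z ** y = y ** z].
Proof.
split=> [/=|r x z /= xy zy|x z /= xy zy|].
- by rewrite cmul0x cmulx0.
- by rewrite cmulDl cmulDr cmulZl cmulZr xy zy.
- by rewrite -cmulA zy cmulA xy cmulA.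
apply/closedP => x h /=; apply: nrm_small => e e0.
have [d1 d10 h1] := cmul_near x y (divr_gt0 e0 (ltr0Sn _ 1)).
have [d2 d20 h2] := cmul_near y x (divr_gt0 e0 (ltr0Sn _ 1)).
have [|z /= [zy xz]] := h (Num.min d1 d2); first by rewrite lt_min d10.
move: xz; rewrite lt_min => /andP[xz1 xz2].
apply: le_trans (nrm_tri (z ** y) _ _) _.
have := h1 z y xz1; have := h2 y z; rewrite !subrr !nrm0 => /(_ d20 xz2).
by rewrite zy (nrmB (y ** z)) => + /(_ d10); lra.
Qed.

(** The commutant is used twice: z commutes with x, so x lies in the commutant of z, which then
    contains y. *)
Lemma Zr_comm x y z : Zr x y -> Zr x z -> y ** z = z ** y.
Proof.
move=> Zy Zz; apply: (Zy _ (real_subalgebra_commutant z)).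
by apply/esym; apply: (Zz _ (real_subalgebra_commutant x)).
Qed.

Lemma Zr_sa x y : x^# = x -> Zr x y -> y^# = y.
Proof.
move=> sx Zy; have sZ := Zr_subalgebra x.
(* Self-adjoint elements are stable under products only when they commute, hence the intersection
   with [Zr x]. *)
suff [] : (Zr x `&` [set z | z^# = z]) y by [].
apply: Zy; last by split=> //; exact: Zr_self.
split=> [|r u v [Zu su] [Zv sv]|u v [Zu su] [Zv sv]|].
- by split; [exact: (rsub0 sZ) | exact: cstar0].
- by split; [apply: (rsubD sZ) => //; exact: (rsubZ sZ) | rewrite /= cstarD cstarZr su sv].
- by split; [exact: (rsubM sZ) | rewrite /= cstarM su sv (Zr_comm Zu Zv)].
apply/closedP => u h; split.
  by apply: (rsub_lim sZ) => e /h[v [[Zv _] uv]]; exists v.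
apply: nrm_small => e e0.
have [|v [[_ /= sv] uv]] := h (e / 2); first by rewrite divr_gt0.
apply: le_trans (nrm_tri v _ _) _.
by rewrite -{1}sv -cstarB nrm_star (nrmB v); lra.
Qed.

Lemma Zr_sub x y z : Zr x y -> Zr y z -> Zr x z.
Proof. by move=> Zy; apply; [exact: Zr_subalgebra | ]. Qed.

End CStarBasics.

Arguments Zr_self {R A} x.

(** * The commutative algebra generated by one element *)

(* The commutative unital real algebra R + Zr x: the pair (r, z) acts on A as
   b |-> r b + z b. *)
Record ext (R : realType) (A : cstarAlgType R) (x : A) :=
  Ext { sc : R; el : A; elP : Zr x el }.

Section ExtRing.
Variables (R : realType) (A : cstarAlgType R) (x : A).
Local Notation U := (ext x).
Let sZ := Zr_subalgebra x.

Lemma ext_eq (p q : U) : sc p = sc q -> el p = el q -> p = q.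
Proof.
by case: p q => [r y Zy] [s z Zz] /= -> yz; move: Zy; rewrite yz => Zy;
  congr Ext; exact: Prop_irrelevance.
Qed.

HB.instance Definition _ := gen_eqMixin U.
HB.instance Definition _ := gen_choiceMixin U.

Definition ext0 : U := Ext 0 (rsub0 sZ).
Definition ext1 : U := Ext 1 (rsub0 sZ).
Definition ext_opp (p : U) : U := Ext (- sc p) (rsubN sZ (elP p)).
Definition ext_add (p q : U) : U := Ext (sc p + sc q) (rsubD sZ (elP p) (elP q)).

Lemma ext_mulP (p q : U) :
  Zr x ((sc p)%:C *: el q + ((sc q)%:C *: el p + el p ** el q)).
Proof.
have [Zp Zq] := (elP p, elP q); apply: (rsubD sZ); first exact: (rsubZ sZ).
by apply: (rsubD sZ); [exact: (rsubZ sZ) | exact: (rsubM sZ)].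
Qed.
Definition ext_mul (p q : U) : U := Ext (sc p * sc q) (ext_mulP p q).

Fact ext_addA : associative ext_add.
Proof. by move=> p q r; apply: ext_eq; rewrite /= addrA. Qed.
Fact ext_addC : commutative ext_add.
Proof. by move=> p q; apply: ext_eq; rewrite /= addrC. Qed.
Fact ext_add0 : left_id ext0 ext_add.
Proof. by move=> p; apply: ext_eq; rewrite /= add0r. Qed.
Fact ext_addN : left_inverse ext0 ext_opp ext_add.
Proof. by move=> p; apply: ext_eq; rewrite /= addNr. Qed.

HB.instance Definition _ := GRing.isZmodule.Build U ext_addA ext_addC ext_add0 ext_addN.

Fact ext_mulC : commutative ext_mul.
Proof.
move=> p q; apply: ext_eq; rewrite /= 1?mulrC //.
by rewrite (Zr_comm (elP p) (elP q)) addrCA.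
Qed.

Fact ext_mulA : associative ext_mul.
Proof.
move=> p q r; apply: ext_eq; rewrite /= 1?mulrA //.
rewrite !(cmulDl, cmulDr, cmulZl, cmulZr, scalerDr, cmulA, scalerA, rmorphM) /=.
rewrite ![(sc r)%:C * _]mulrC -!addrA; do 2 congr (_ + _).
rewrite [LHS]addrCA; congr (_ + _).
by rewrite [X in _ + X = _]addrCA [LHS]addrCA.
Qed.

Fact ext_mul1 : left_id ext1 ext_mul.
Proof.
move=> p; apply: ext_eq; rewrite /= ?mul1r //.
by rewrite cmul0x scaler0 !addr0 scale1r.
Qed.

Fact ext_mulDl : left_distributive ext_mul ext_add.
Proof.
move=> p q r; apply: ext_eq; rewrite /= ?mulrDl //.
rewrite !(cmulDl, scalerDr, scalerDl, rmorphD) /=.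
rewrite -!addrA; congr (_ + _); rewrite [LHS]addrCA; congr (_ + _).
by rewrite [X in _ + X = _]addrCA [LHS]addrCA.
Qed.

Fact ext_1neq0 : ext1 != 0.
Proof. by apply/eqP => /(congr1 (@sc _ _ _)) /= /eqP; rewrite oner_eq0. Qed.

HB.instance Definition _ := GRing.Zmodule_isComNzRing.Build U
  ext_mulA ext_mulC ext_mul1 ext_mulDl ext_1neq0.

Definition cst (r : R) : U := Ext r (rsub0 sZ).
Definition inj (z : A) (Zz : Zr x z) : U := Ext 0 Zz.

Lemma scD (p q : U) : sc (p + q) = sc p + sc q. Proof. by []. Qed.
Lemma scN (p : U) : sc (- p) = - sc p. Proof. by []. Qed.
Lemma scM (p q : U) : sc (p * q) = sc p * sc q. Proof. by []. Qed.
Lemma elD (p q : U) : el (p + q) = el p + el q. Proof. by []. Qed.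
Lemma elN (p : U) : el (- p) = - el p. Proof. by []. Qed.
Lemma elM (p q : U) :
  el (p * q) = (sc p)%:C *: el q + ((sc q)%:C *: el p + el p ** el q).
Proof. by []. Qed.

Lemma cst_is_additive : zmod_morphism cst.
Proof. by move=> r s; apply: ext_eq; rewrite /= ?subr0. Qed.
Lemma cst_is_multiplicative : monoid_morphism cst.
Proof. by split=> // r s; apply: ext_eq; rewrite //= !scaler0 cmul0x !addr0. Qed.
HB.instance Definition _ := GRing.isZmodMorphism.Build R U cst cst_is_additive.
HB.instance Definition _ := GRing.isMonoidMorphism.Build R U cst cst_is_multiplicative.

Definition act (p : U) (b : A) : A := (sc p)%:C *: b + el p ** b.

Lemma actD p q b : act (p + q) b = act p b + act q b.
Proof. by rewrite /act scD elD rmorphD scalerDl cmulDl addrACA. Qed.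
Lemma actN p b : act (- p) b = - act p b.
Proof. by rewrite /act scN elN rmorphN scaleNr cmulNx opprD. Qed.
Lemma actB p q b : act (p - q) b = act p b - act q b.
Proof. by rewrite actD actN. Qed.
Lemma actM p q b : act (p * q) b = act p (act q b).
Proof.
rewrite /act scM elM !(cmulDl, cmulDr, scalerDr, cmulZl, cmulZr, scalerA, rmorphM) /=.
by rewrite cmulA -!addrA.
Qed.
Lemma act_cst r b : act (cst r) b = r%:C *: b.
Proof. by rewrite /act /= cmul0x addr0. Qed.
Lemma act_inj z (Zz : Zr x z) b : act (inj Zz) b = z ** b.
Proof. by rewrite /act /= scale0r add0r. Qed.
(* The action alone does not determine p when A has a unit, so the scalar part
   is bounded separately. *)
Definition bd (p : U) (r : R) : Prop :=
  `|sc p| <= r /\ forall b, nrm (act p b) <= r * nrm b.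

Lemma bd_ge0 p r : bd p r -> 0 <= r.
Proof. by case=> h _; exact: le_trans h. Qed.

Lemma bd_le p r s : r <= s -> bd p r -> bd p s.
Proof.
move=> rs [h k]; split=> [|b]; first exact: le_trans rs.
by apply: le_trans (k b) _; rewrite ler_wpM2r ?nrm_ge0.
Qed.

Lemma bdD p q r s : bd p r -> bd q s -> bd (p + q) (r + s).
Proof.
move=> [h k] [h' k']; split=> [|b].
  by rewrite scD (le_trans (ler_normD _ _)) // lerD.
by rewrite actD (le_trans (nrmD _ _)) // mulrDl lerD.
Qed.

Lemma bdN p r : bd p r -> bd (- p) r.
Proof. by move=> [h k]; split=> [|b]; rewrite ?scN ?normrN // actN nrmN. Qed.

Lemma bdB p q r s : bd p r -> bd q s -> bd (p - q) (r + s).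
Proof. by move=> h k; apply: bdD => //; apply: bdN. Qed.

Lemma bdM p q r s : bd p r -> bd q s -> bd (p * q) (r * s).
Proof.
move=> P Q; have r0 := bd_ge0 P; case: P Q => h k [h' k']; split=> [|b].
  by rewrite scM normrM ler_pM.
by rewrite actM (le_trans (k _)) // -mulrA ler_wpM2l.
Qed.

Lemma bd_cst r : bd (cst r) `|r|.
Proof. by split=> // b; rewrite act_cst nrmZr. Qed.

Lemma bd_cstp r : 0 <= r -> bd (cst r) r.
Proof. by move=> r0; have := bd_cst r; rewrite ger0_norm. Qed.

Lemma bd1 : bd 1 1.
Proof. exact: (bd_cstp ler01). Qed.

Lemma bd_inj z (Zz : Zr x z) r : nrm z <= r -> bd (inj Zz) r.
Proof.
move=> zr; split=> [|b]; first by rewrite normr0 (le_trans _ zr) ?nrm_ge0.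
by rewrite act_inj (le_trans (nrmM _ _)) // ler_wpM2r ?nrm_ge0.
Qed.

Lemma bd_ex p : exists2 r, 0 < r & bd p r.
Proof.
exists (`|sc p| + nrm (el p) + 1).
  by have := nrm_ge0 (el p); have := normr_ge0 (sc p); lra.
split=> [|b]; first by have := nrm_ge0 (el p); lra.
apply: le_trans (nrmD _ _) _; rewrite nrmZr !mulrDl mul1r -addrA lerD2l.
by rewrite (le_trans (nrmM _ _)) // lerDl nrm_ge0.
Qed.

Lemma bd_inj_nrm z (Zz : Zr x z) r : bd (inj Zz) r -> nrm z <= r.
Proof.
move=> B; apply: nrm_le_act; first exact: bd_ge0 B.
by move=> b; rewrite -(act_inj Zz); apply: B.2.
Qed.

Lemma bd_el p r : bd p r -> nrm (el p) <= 2 * r.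
Proof.
move=> [h k]; have r0 : 0 <= r by exact: le_trans h.
apply: nrm_le_act => [|b]; first by rewrite mulr_ge0.
have -> : el p ** b = act p b - (sc p)%:C *: b by rewrite /act addrC addKr.
apply: le_trans (nrmBD _ _) _; rewrite nrmZr.
have := k b; have : `|sc p| * nrm b <= r * nrm b by rewrite ler_wpM2r ?nrm_ge0.
lra.
Qed.

Lemma bd_eq0 p : bd p 0 -> p = 0.
Proof.
move=> B; apply: ext_eq => /=; first by apply: normr0_eq0; apply/le_anti; rewrite B.1 /=.
by apply: nrm_le0; rewrite -(mulr0 2) bd_el.
Qed.

Lemma bd_lim p r : (forall e, 0 < e -> bd p (r + e)) -> bd p r.
Proof.
move=> h; split=> [|b]; first by apply/ler_addgt0Pr => e /h[].
have n0 : 0 < nrm b + 1 by have := nrm_ge0 b; lra.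
apply/ler_addgt0Pr => e e0; have [_ /(_ b)] := h (e / (nrm b + 1)) (divr_gt0 e0 n0).
move/le_trans; apply; rewrite mulrDl lerD2l -mulrA ler_piMr ?(ltW e0) //.
by rewrite mulrC ler_pdivrMr // mul1r; lra.
Qed.

(** The method of majorants: the increments of y are dominated by those of a real sequence t tending
    to 1, so the distance to the limit is dominated by 1 - t n. *)
Lemma ext_complete (y : nat -> U) (t : nat -> R) :
  (forall n, bd (y n.+1 - y n) (t n.+1 - t n)) ->
  (forall n, t n <= 1) -> (forall e, 0 < e -> exists n, 1 - t n < e) ->
  exists l, forall n, bd (l - y n) (1 - t n).
Proof.
move=> h t1 te.
have bmn n k : bd (y (n + k)%N - y n) (t (n + k)%N - t n).
  elim: k => [|k IH].
    by rewrite addn0 !subrr; have := bd_cst 0; rewrite normr0 rmorph0.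
  rewrite addnS; have := bdD (h (n + k)%N) IH.
  by rewrite addrA subrK addrA subrK.
have bnm n m : (n <= m)%N -> bd (y m - y n) (1 - t n).
  move=> nm; have := bmn n (m - n)%N; rewrite subnKC // => B.
  by apply: bd_le B; rewrite lerD2r.
(* Stated for a seminorm f so that the scalar part and the algebra part are handled by one argument;
   2 is the constant of [bd_el]. *)
have cau (f : U -> R) : (forall p q, f (p - q) = f (q - p)) ->
    (forall p q, f (p + q) <= f p + f q) -> (forall p r, bd p r -> f p <= 2 * r) ->
    forall e : R, 0 < e -> exists N, forall m n, (N <= m)%N -> (N <= n)%N ->
      f (y m - y n) < e.
  move=> fN fD fb e e0; have [|N hN] := te (e / 8); first by rewrite divr_gt0.
  exists N => m n Nm Nn; have := fb _ _ (bnm _ _ Nm); have := fb _ _ (bnm _ _ Nn).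
  have := fD (y m - y N) (y N - y n); rewrite addrA subrK (fN (y N)).
  lra.
have [|ls hls] := real_complete (u := fun n => sc (y n)).
  apply: (cau (fun p => `|sc p|)) => [p q|p q|p r B].
  - by rewrite !scD !scN distrC.
  - by rewrite scD ler_normD.
  - by have := B.1; have := bd_ge0 B; lra.
have [|le hle] := nrm_complete (u := fun n => el (y n)).
  apply: (cau (fun p => nrm (el p))) => [p q|p q|p r B].
  - by rewrite !elD !elN nrmB.
  - exact: nrmD.
  - exact: bd_el.
have Zl : Zr x le.
  apply: (rsub_lim sZ) => e e0; have [N hN] := hle e e0.
  by exists (el (y N)); split; [exact: elP | exact: hN].
exists (Ext ls Zl) => n; apply: bd_lim => e e0.
have e20 : 0 < e / 2 by rewrite divr_gt0.
have [N1 h1] := hls _ e20; have [N2 h2] := hle _ e20.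
pose m := maxn n (maxn N1 N2).
have -> : Ext ls Zl - y n = (Ext ls Zl - y m) + (y m - y n) by rewrite addrA subrK.
rewrite addrC; apply: bdD; first by apply: bnm; rewrite leq_maxl.
have hm1 := h1 m; have hm2 := h2 m; split=> [|b].
  rewrite scD scN /= ltW // (lt_le_trans (hm1 _)) //; last by lra.
  by rewrite /m !leq_max leqnn !orbT.
apply: le_trans (nrmD _ _) _; rewrite nrmZr scD scN elD elN /=.
have := nrmM (le - el (y m)) b.
have : `|ls - sc (y m)| * nrm b <= e / 2 * nrm b.
  rewrite ler_wpM2r ?nrm_ge0 // ltW // hm1 //.
  by rewrite /m !leq_max leqnn !orbT.
have : nrm (le - el (y m)) * nrm b <= e / 2 * nrm b.
  rewrite ler_wpM2r ?nrm_ge0 // ltW // hm2 //.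
  by rewrite /m !leq_max leqnn !orbT.
lra.
Qed.

End ExtRing.

(** * Square roots and positivity *)

Section RealSqrtIteration.
Variable R : realType.

(* Majorant of the iteration [y' = (x + y^2) / 2] when [|x| <= 1]. *)
Fixpoint sqrt_maj (n : nat) : R :=
  if n is n'.+1 then 2^-1 * (1 + sqrt_maj n' * sqrt_maj n') else 0.

Lemma sqrt_maj01 n : 0 <= sqrt_maj n <= 1.
Proof.
elim: n => [|n /andP[IH0 IH1]]; first by rewrite /= lexx ler01.
by apply/andP; split; rewrite /=; nra.
Qed.

(** In terms of s = 1 - t the iteration reads s |-> s - s^2 / 2, which decays like 2 / n. *)
Lemma sqrt_maj_rate n : (1 - sqrt_maj n) * n.+2%:R <= 2.
Proof.
elim: n => [|n IH]; first by rewrite /= subr0 mul1r.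
have /andP[t0 t1] := sqrt_maj01 n.
have n0 : (0 : R) <= n%:R by [].
have e3 : n.+3%:R = n%:R + 3 :> R by rewrite -natrD addn3.
have e2 : n.+2%:R = n%:R + 2 :> R by rewrite -natrD addn2.
rewrite e2 in IH; rewrite e3 [sqrt_maj _]/=.
set t := sqrt_maj n in IH t0 t1 *; set k : R := n%:R in IH n0 *.
have -> : 1 - 2^-1 * (1 + t * t) = (1 - t) - 2^-1 * ((1 - t) * (1 - t)) by field.
set s := 1 - t in IH *.
have s0 : 0 <= s by rewrite subr_ge0.
have s1 : s <= 1 by rewrite /s lerBlDr lerDl.
have [sk|sk] := leP (s * (k + 3)) 2; first by nra.
nra.
Qed.

Lemma sqrt_maj_lim (e : R) : 0 < e -> exists n, 1 - sqrt_maj n < e.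
Proof.
move=> e0; exists (Num.trunc (2 / e)).
have h := sqrt_maj_rate (Num.trunc (2 / e)).
have : 2 / e < (Num.trunc (2 / e)).+2%:R.
  by apply: lt_trans (truncnS_gt _) _; rewrite ltr_nat.
rewrite ltr_pdivrMr // => h'.
have := le_lt_trans h h'; rewrite mulrC ltr_pM2l //.
Qed.

End RealSqrtIteration.

(** * Order and functional calculus from square roots *)

Section ExtCalculus.
Variables (R : realType) (A : cstarAlgType R) (x : A).
Hypothesis sx : x^# = x.
Local Notation U := (ext x).
Implicit Types (p q u v : U) (r k c : R).

Lemma el_sa p : (el p)^# = el p.
Proof. exact: Zr_sa sx (elP p). Qed.

Lemma act_adj p (b d : A) : (act p b)^# ** d = b^# ** act p d.
Proof.
by rewrite /act cstarD cstarZr cstarM el_sa cmulDl cmulDr cmulZl cmulZr cmulA.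
Qed.

(** Here s is i or -i. Since u and v commute and are self-adjoint, the cross terms cancel and the
    square of the norm of (u + s v) b is the norm of b^# (u^2 + v^2) b. *)
Lemma bd_sumsq_act u v r (s : R[i]) b : 0 <= r -> bd (u * u + v * v) (r ^+ 2) ->
  Num.conj s = - s -> s * s = -1 -> nrm (act u b + s *: act v b) <= r * nrm b.
Proof.
move=> r0 [_ /(_ b) B] sN ss; have b0 := nrm_ge0 b.
rewrite -(@ler_pXn2r _ 2) ?nnegrE ?mulr_ge0 ?nrm_ge0 // -nrm_starM.
have -> : (act u b + s *: act v b)^# ** (act u b + s *: act v b)
    = b^# ** act (u * u + v * v) b.
  have e p : (act p b)^# ** act p b = b^# ** act p (act p b) by exact: act_adj.
  rewrite (actD (u * u)) [RHS]cmulDr !actM -!e.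
  have : (act u b)^# ** act v b = (act v b)^# ** act u b.
    by rewrite !act_adj -!actM mulrC.
  move: (act u b) (act v b) => p q pq.
  rewrite cstarD cstarZ sN cmulDl !cmulDr !cmulZl !cmulZr scalerA.
  by rewrite mulNr ss opprK scale1r scaleNr pq addrA addrK.
apply: le_trans (nrmM _ _) _; rewrite nrm_star exprMn.
by rewrite mulrC expr2 mulrA ler_wpM2r.
Qed.

(** u is the mean of u + i v and u - i v. This plays the role of monotonicity of the norm, u^2 <=
    u^2 + v^2, before any order exists. *)
Lemma bd_sumsq u v r : 0 <= r -> bd (u * u + v * v) (r ^+ 2) -> bd u r.
Proof.
move=> r0 B; split=> [|b].
  rewrite -(@ler_pXn2r _ 2) ?nnegrE // -normrX ger0_norm ?sqr_ge0 //.
  apply: le_trans (le_trans (ler_norm _) B.1); rewrite scD !scM expr2 lerDl.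
  by rewrite -expr2 sqr_ge0.
have i1 : Num.conj ('i : R[i]) = - 'i.
  by apply/eqP; rewrite eq_complex /= oppr0 !eqxx.
have i2 : 'i * 'i = -1 :> R[i] by rewrite -expr2 sqr_i.
have h1 := bd_sumsq_act b r0 B i1 i2.
have [] := (@bd_sumsq_act u v r (- 'i) b r0 B _ _, tt).
- by rewrite rmorphN /= i1.
- by rewrite mulrNN.
move=> h2 _; have := nrmD (act u b + 'i *: act v b) (act u b + - 'i *: act v b).
rewrite scaleNr addrACA subrr addr0 -mulr2n -scaler_nat.
rewrite (_ : 2%:R = (2 : R)%:C) ?nrmZp //; last by rewrite rmorph_nat.
rewrite scaleNr in h2; lra.
Qed.

Lemma ext_sqr_eq0 u : u * u = 0 -> u = 0.
Proof.
move=> h; apply/bd_eq0/(@bd_sumsq u 0) => //.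
by rewrite mulr0 addr0 h; have := bd_cst x 0; rewrite rmorph0 normr0 expr0n.
Qed.

Lemma ext_sumsq_eq0 u v : u * u + v * v = 0 -> u = 0.
Proof.
move=> h; apply/bd_eq0/(@bd_sumsq u v) => //.
by rewrite h; have := bd_cst x 0; rewrite rmorph0 normr0 expr0n.
Qed.

Let hf : U := cst x 2^-1.
Let hf2 : hf + hf = 1.
Proof. by rewrite -rmorphD /= (_ : 2^-1 + 2^-1 = 1) ?rmorph1 //; field. Qed.
Let bd_hf : bd hf 2^-1.
Proof. by apply: bd_cstp; rewrite invr_ge0. Qed.

(** With a = 1 - m the iteration l = (a + l^2) / 2 has as fixed point an l with (1 - l)^2 = 1 - a =
    m. *)
Lemma ext_sqrt_near1 m : bd (1 - m) 1 -> exists2 r : U, r * r = m & bd (1 - r) 1.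
Proof.
move=> B; set a := 1 - m in B.
pose y := fix y n : U := if n is n'.+1 then hf * (a + y n' * y n') else 0.
have yS n : y n.+1 = hf * (a + y n * y n) by [].
pose t := @sqrt_maj R.
have tS n : t n.+1 = 2^-1 * (1 + t n * t n) by [].
have yt n : bd (y n) (t n).
  elim: n => [|n IH]; first by have := bd_cst x 0; rewrite rmorph0 normr0.
  by apply: bdM => //; apply: bdD => //; apply: bdM.
have dt n : bd (y n.+1 - y n) (t n.+1 - t n).
  elim: n => [|n IH].
    rewrite /= !mulr0 !addr0 !subr0; exact: bdM.
  have -> : y n.+2 - y n.+1 = hf * ((y n.+1 + y n) * (y n.+1 - y n)).
    rewrite (yS n.+1) [in X in _ - X = _](yS n).
    move: (y n.+1) (y n) => p q; ring.
  have -> : t n.+2 - t n.+1 = 2^-1 * ((t n.+1 + t n) * (t n.+1 - t n)).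
    rewrite (tS n.+1) [in X in _ - X = _](tS n).
    by move: (t n.+1) (t n) => p q; ring.
  by apply: bdM => //; apply: bdM => //; apply: bdD.
have [|l hl] := ext_complete dt _ (@sqrt_maj_lim R).
  by move=> n; have /andP[] := sqrt_maj01 R n.
have l1 : bd l 1.
  by have := bdD (hl 0%N) (yt 0%N); rewrite subrK subrK.
have le : l = hf * (a + l * l).
  apply/subr0_eq/bd_eq0/bd_lim => e e0; rewrite add0r.
  have [n hn] := sqrt_maj_lim (divr_gt0 e0 (ltr0Sn R 1)).
  have -> : l - hf * (a + l * l)
      = (l - y n.+1) - hf * ((l + y n) * (l - y n)).
    by rewrite yS; move: (y n) => p; ring.
  have n01 := sqrt_maj01 R n; have n11 := sqrt_maj01 R n.+1.
  have := bdB (hl n.+1) (bdM bd_hf (bdM (bdD l1 (yt n)) (hl n))).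
  by apply: bd_le; rewrite /t /= in n11 *; nra.
exists (1 - l); last by rewrite opprB addrC subrK.
have -> : m = 1 - a by rewrite opprB addrC subrK.
have -> : a = l + l - l * l.
  by rewrite {1 2}le -mulrDl hf2 mul1r addrK.
ring.
Qed.

(** Let c be a square root of 1 - u^2. From c^2 + u^2 = 1, [bd_sumsq] gives |c| <= 1, hence |1 -
    u^2| = |c^2| <= 1. *)
Lemma bd_sqr_compl u : bd u 1 -> bd (1 - u * u) 1.
Proof.
move=> B; have [|c cc _] := @ext_sqrt_near1 (1 - u * u).
  by rewrite opprB addrC subrK -[X in bd _ X]mulr1; exact: bdM.
rewrite -cc -[X in bd _ X]mulr1.
have Bc : bd c 1.
  by apply: (@bd_sumsq c u) => //; rewrite cc subrK expr1n; exact: bd1.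
exact: bdM.
Qed.

(** The norm criterion for positivity: |M - p| <= M for some M, which confines the spectrum of p to
    [0, 2M]. *)
Definition pos p : Prop := exists M : R, bd (cst x M - p) M.

Lemma pos0 : pos 0.
Proof. by exists 0; rewrite subr0; apply: bd_cstp. Qed.

Lemma bd_sqr_complk u k : 0 <= k -> bd u k -> bd (cst x (k ^+ 2) - u * u) (k ^+ 2).
Proof.
rewrite le_eqVlt => /predU1P[<-{k} B|k0 B].
  by rewrite (bd_eq0 B) mulr0 subr0 expr0n; exact: bd_cstp.
have -> : cst x (k ^+ 2) - u * u
    = cst x (k ^+ 2) * (1 - (cst x k^-1 * u) * (cst x k^-1 * u)).
  have -> : cst x (k ^+ 2) * (1 - cst x k^-1 * u * (cst x k^-1 * u))
      = cst x (k ^+ 2) - cst x (k ^+ 2) * (cst x k^-1 * cst x k^-1) * (u * u) by ring.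
  rewrite -!(rmorphM (cst x)) /=.
  have -> : k ^+ 2 * (k^-1 * k^-1) = 1 by field; rewrite gt_eqF.
  by rewrite rmorph1 mul1r.
rewrite -[X in bd _ X]mulr1; apply: bdM; first by apply: bd_cstp; rewrite sqr_ge0.
apply: bd_sqr_compl; rewrite -(@mulVf _ k) ?gt_eqF //; apply: bdM => //.
by apply: bd_cstp; rewrite invr_ge0 ltW.
Qed.

Lemma pos_sqr u : pos (u * u).
Proof.
have [k k0 B] := bd_ex u; exists (k ^+ 2).
by apply: bd_sqr_complk => //; exact: ltW.
Qed.

Lemma pos_sqrt p : pos p -> exists2 r : U, r * r = p & pos r.
Proof.
move=> [M B].
have [M0|M0] := eqVneq M 0.
  exists 0; last exact: pos0.
  by rewrite M0 rmorph0 sub0r in B; rewrite mulr0 -(opprK p) (bd_eq0 B) oppr0.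
have {}M0 : 0 < M by rewrite lt_def M0 (bd_ge0 B).
have s0 : 0 < Num.sqrt M by rewrite sqrtr_gt0.
have [|r rr r1] := @ext_sqrt_near1 (cst x M^-1 * p).
  have -> : 1 - cst x M^-1 * p = cst x M^-1 * (cst x M - p).
    by rewrite mulrBr -rmorphM /= mulVf ?gt_eqF // rmorph1.
  rewrite -(@mulVf _ M) ?gt_eqF //; apply: bdM => //.
  by apply: bd_cstp; rewrite invr_ge0 ltW.
exists (cst x (Num.sqrt M) * r).
  rewrite mulrACA rr -rmorphM /= -expr2 sqr_sqrtr ?(ltW M0) //.
  by rewrite mulrA -rmorphM /= mulfV ?gt_eqF // rmorph1 mul1r.
exists (Num.sqrt M); rewrite -[X in X - _]mulr1 -mulrBr -[X in bd _ X]mulr1.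
by apply: bdM => //; apply: bd_cstp; exact: ltW.
Qed.

Lemma pos_bd p k : pos p -> bd p k -> bd (cst x k - p) k.
Proof.
move=> /pos_sqrt[r <- _] B; have k0 := bd_ge0 B.
rewrite -(sqr_sqrtr k0); apply: bd_sqr_complk; first exact: sqrtr_ge0.
by apply: (@bd_sumsq r 0); rewrite ?sqrtr_ge0 // mulr0 addr0 sqr_sqrtr.
Qed.

Lemma pos_antisym p : pos p -> pos (- p) -> p = 0.
Proof.
move=> /pos_sqrt[r <- _] /pos_sqrt[s ss _].
by rewrite (@ext_sumsq_eq0 r s) ?mulr0 // ss subrr.
Qed.

Lemma pos_sc p : pos p -> 0 <= sc p.
Proof. by move=> /pos_sqrt[r <- _]; rewrite scM -expr2 sqr_ge0. Qed.

(* [p p = p b] with [b >= 0] says that [p = b] wherever [p] does not vanish. *)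
Lemma pos_supp p b : pos b -> p * p = p * b -> pos p.
Proof.
move=> pb ppb; have [s ss ps] := pos_sqrt (pos_sqr p).
have [al aa _] := pos_sqrt ps; have [be bb _] := pos_sqrt pb.
(* [s] is the absolute value of p and [d] is twice its negative part. It will satisfy d s (s + b) =
   0; as s and b are both squares, d s must vanish, then d^2, so p = s. *)
pose d := s - p.
have dsp : d * s = - (d * p).
  by apply/subr0_eq; rewrite opprK -mulrDr /d mulrDr !mulrBl ss (mulrC p); ring.
have dsb : d * s * (s + b) = 0.
  rewrite mulrDr -mulrA ss ppb dsp mulrA.
  by rewrite mulNr -mulrA subrr.
have dsa : d * s * al = 0.
  apply: (@ext_sumsq_eq0 _ (d * s * be)); rewrite -[RHS](mulr0 (d * s)) -dsb -aa -bb.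
  ring.
have ds : d * s = 0.
  apply: ext_sqr_eq0; rewrite (_ : _ * _ = (d * s * al) * (d * al)); last by rewrite -aa; ring.
  by rewrite dsa mul0r.
have d0 : d = 0.
  apply: ext_sqr_eq0; rewrite {2}/d mulrBr ds sub0r -[RHS]oppr0; congr (- _).
  by rewrite -[LHS]opprK -dsp ds oppr0.
by rewrite -(subr0_eq d0).
Qed.

(** With m = |u|, the parts are (m + u) / 2 and (m - u) / 2. Each satisfies p^2 = p m, so [pos_supp]
    makes it positive. *)
Lemma pos_neg_parts u :
  exists a b : U, [/\ pos a, pos b, u = a - b & a * b = 0].
Proof.
have [m mm pm] := pos_sqrt (pos_sqr u).
have h4 : (m + u) * (m - u) = 0.
  have -> : (m + u) * (m - u) = m * m - u * u by ring.
  by rewrite mm subrr.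
exists (hf * (m + u)), (hf * (m - u)); split.
- apply: (@pos_supp _ m) => //.
  have -> : hf * (m + u) * (hf * (m + u)) = hf * hf * (m * m + u * u + (m * u + m * u)).
    by ring.
  rewrite -mm (_ : _ + _ = (1 + 1) * ((m + u) * m)); last by ring.
  by rewrite mulrA -(mulrA hf) mulrDr mulr1 hf2 mulr1 mulrA.
- apply: (@pos_supp _ m) => //.
  have -> : hf * (m - u) * (hf * (m - u)) = hf * hf * (m * m + u * u - (m * u + m * u)).
    by ring.
  rewrite -mm (_ : _ + _ - _ = (1 + 1) * ((m - u) * m)); last by ring.
  by rewrite mulrA -(mulrA hf) mulrDr mulr1 hf2 mulr1 mulrA.
- have -> : hf * (m + u) - hf * (m - u) = (hf + hf) * u by ring.
  by rewrite hf2 mul1r.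
- by rewrite mulrACA h4 mulr0.
Qed.

(** v is the positive part of h - c and w is min(h, c). The scalar part acts as the value at
    infinity: h vanishes there and c > 0, so v vanishes there too. *)
Lemma pos_cut h c : pos h -> sc h = 0 -> 0 < c ->
  exists v w : U, [/\ pos v, h = v + w, sc v = 0, bd w c & w * v = cst x c * v].
Proof.
move=> ph h0 c0; have [v [n [pv pn e vn]]] := pos_neg_parts (h - cst x c).
have eh : h = v - n + cst x c by rewrite -e subrK.
have [k kk _] := pos_sqrt ph; have [g gg _] := pos_sqrt pn.
exists v, (cst x c - n); split=> //.
- by rewrite eh addrA addrAC.
- have := congr1 (@sc _ _ _) vn; rewrite scM => /eqP; rewrite mulf_eq0.
  case/orP => /eqP // n0; have := congr1 (@sc _ _ _) eh; rewrite !(scD, scN) n0 h0 /=.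
  by have := pos_sc pv; lra.
- have -> : cst x c - n = cst x (c / 2) - (n - cst x (c / 2)).
    by rewrite opprB addrA -rmorphD /= -splitr.
  have c20 : 0 <= c / 2 by rewrite divr_ge0 // ltW.
  rewrite [X in bd _ X]splitr; apply: bdB; first exact: bd_cstp.
  (* Since n v = 0, n h = n (c - n), so (n - c/2)^2 + n h = (c/2)^2; and n h is the square of
     [g * k]. *)
  apply: (@bd_sumsq _ (g * k)) => //.
  have -> : (n - cst x (c / 2)) * (n - cst x (c / 2)) + g * k * (g * k)
      = cst x ((c / 2) ^+ 2).
    rewrite mulrACA gg kk eh expr2 [RHS]rmorphM [X in v - n + cst x X](splitr c) [in LHS]rmorphD /=.
    move: (cst x (c / 2)) => d.
    have -> : (n - d) * (n - d) + n * (v - n + (d + d)) = d * d + v * n by ring.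
    by rewrite vn addr0.
  by apply: bd_cstp; rewrite sqr_ge0.
by rewrite mulrBl (mulrC n) vn subr0.
Qed.

(** Split (1 + M) b as (b + v b) + (M - v) b; the last term has norm at most M |b|. *)
Lemma pos_expand v b : pos v -> nrm b <= nrm (b + act v b).
Proof.
move=> [M B]; have M0 := bd_ge0 B; have := B.2 b.
have := nrmD (b + act v b) (act (cst x M - v) b).
rewrite actB act_cst addrACA subrr addr0.
have -> : b + M%:C *: b = (1 + M)%:C *: b by rewrite rmorphD scalerDl scale1r.
rewrite nrmZp; lra.
Qed.

End ExtCalculus.

(** * Positive elements *)

Section Positive.
Variables (R : realType) (A : cstarAlgType R).
Implicit Types (x y z v w h b : A) (r k c : R).

(** The criterion of [pos] phrased by left multiplication on all of A, so that positive elements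
    from different algebras [Zr x] can be added. *)
Definition cpos z : Prop :=
  z^# = z /\ exists2 M : R, 0 <= M & forall b, nrm (M%:C *: b - z ** b) <= M * nrm b.

Lemma cpos_sa z : cpos z -> z^# = z. Proof. by case. Qed.

Lemma pos_inj x z (Zz : Zr x z) : x^# = x -> cpos z <-> pos (inj Zz).
Proof.
move=> sx; have sz := Zr_sa sx Zz; split=> [[_ [M M0 B]]|[M B]].
  exists M; split=> [|b]; first by rewrite scD scN /= subr0 ger0_norm.
  by rewrite actB act_cst act_inj.
split=> //; exists M => [|b]; first exact: bd_ge0 B.
by have := B.2 b; rewrite actB act_cst act_inj.
Qed.

Lemma inj_el x (p : ext x) : sc p = 0 -> p = inj (elP p).
Proof. by move=> p0; apply: ext_eq. Qed.

Lemma pos_el x (p : ext x) : x^# = x -> sc p = 0 -> pos p -> cpos (el p).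
Proof. by move=> sx p0 pp; apply/(pos_inj (elP p) sx); rewrite -inj_el. Qed.

Lemma cposD y z : cpos y -> cpos z -> cpos (y + z).
Proof.
move=> [sy [M M0 B]] [sz [N N0 C]]; split; first by rewrite cstarD sy sz.
exists (M + N) => [|b]; first exact: addr_ge0.
rewrite rmorphD scalerDl cmulDl opprD addrACA mulrDl.
by rewrite (le_trans (nrmD _ _)) // lerD.
Qed.

Lemma cposZ r z : 0 <= r -> cpos z -> cpos (r%:C *: z).
Proof.
move=> r0 [sz [M M0 B]]; split; first by rewrite cstarZr sz.
exists (r * M) => [|b]; first exact: mulr_ge0.
by rewrite rmorphM -scalerA cmulZl -scalerBr nrmZp // -mulrA ler_wpM2l.
Qed.

Lemma cpos_sqr z : z^# = z -> cpos (z ** z).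
Proof.
move=> sz; have Zz := Zr_self z; pose u : ext z := inj Zz.
have -> : z ** z = el (u * u) by rewrite elM /= !scale0r !add0r.
by apply: pos_el => //; [rewrite scM mulr0 | exact: pos_sqr].
Qed.

Lemma cpos_bd z k b : cpos z -> nrm z <= k -> nrm (k%:C *: b - z ** b) <= k * nrm b.
Proof.
move=> pz zk; have sz := cpos_sa pz; have Zz := Zr_self z.
have pp : pos (inj Zz) by apply/(pos_inj Zz sz).
by have [_ /(_ b)] := pos_bd sz pp (bd_inj Zz zk); rewrite actB act_cst act_inj.
Qed.

(** By [cpos_bd] all positive y within distance 1 of z share the constant [nrm z + 1], which
    therefore survives in the limit. *)
Lemma cpos_lim z :
  (forall e : R, 0 < e -> exists y, cpos y /\ nrm (z - y) < e) -> cpos z.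
Proof.
move=> h; split.
  apply: nrm_small => e e0; have [|y [[sy _] zy]] := h (e / 2).
    by rewrite divr_gt0.
  apply: le_trans (nrm_tri y _ _) _.
  by rewrite -{1}sy -cstarB nrm_star (nrmB y); lra.
have z0 := nrm_ge0 z; exists (nrm z + 1) => [|b]; first by rewrite addr_ge0.
have b0 := nrm_ge0 b; have b1 : 0 < nrm b + 1 by lra.
apply/ler_addgt0Pr => e e0.
have [|y [py]] := h (Num.min 1 (e / (nrm b + 1))).
  by rewrite lt_min ltr01 divr_gt0.
rewrite lt_min => /andP[zy1]; rewrite ltr_pdivlMr // => zye.
have yk : nrm y <= nrm z + 1 by have := nrmBD z (z - y); rewrite subKr; lra.
have := cpos_bd b py yk.
have -> : (nrm z + 1)%:C *: b - z ** b
    = ((nrm z + 1)%:C *: b - y ** b) - (z - y) ** b.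
  by rewrite cmulBl opprB addrA subrK.
have := nrmBD ((nrm z + 1)%:C *: b - y ** b) ((z - y) ** b).
have := nrmM (z - y) b; have := nrm_ge0 (z - y); nra.
Qed.

Lemma cpos_antisym z : cpos z -> cpos (- z) -> z = 0.
Proof.
move=> pz pn; have sz := cpos_sa pz; have Zz := Zr_self z.
have Zn : Zr z (- z) by apply: (rsubN (Zr_subalgebra z)).
have p1 : pos (inj Zz) by apply/(pos_inj Zz sz).
have p2 : pos (inj Zn) by apply/(pos_inj Zn sz).
have e : - inj Zz = inj Zn by apply: ext_eq; rewrite /= ?oppr0.
have := pos_antisym sz p1; rewrite e => /(_ p2).
by move=> /(congr1 (@el _ _ _)).
Qed.

Lemma cpos_parts z : z^# = z -> exists a b,
  [/\ Zr z a, Zr z b, cpos a & cpos b] /\ [/\ z = a - b, a ** b = 0 & b ** a = 0].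
Proof.
move=> sz; have [a [b [pa pb e ab]]] := pos_neg_parts sz (inj (Zr_self z)).
have e0 := congr1 (@sc _ _ _) e; have ab0 := congr1 (@sc _ _ _) ab.
rewrite scD scN /= in e0; rewrite scM /= in ab0.
have [a0 b0] : sc a = 0 /\ sc b = 0.
  by move/eqP: ab0; rewrite mulf_eq0 => /orP[]/eqP; split; lra.
exists (el a), (el b); split; split.
- exact: elP.
- exact: elP.
- exact: pos_el.
- exact: pos_el.
- exact: (congr1 (@el _ _ _) e).
- by have := congr1 (@el _ _ _) ab; rewrite elM a0 b0 !scale0r !add0r.
- rewrite (Zr_comm (elP b) (elP a)).
  by have := congr1 (@el _ _ _) ab; rewrite elM a0 b0 !scale0r !add0r.
Qed.

Lemma cpos_cut h c : cpos h -> 0 < c -> exists v w,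
  [/\ Zr h v, Zr h w & cpos v] /\ [/\ h = v + w, nrm w <= c & w ** v = c%:C *: v].
Proof.
move=> ph c0; have sh := cpos_sa ph; have Zh := Zr_self h.
have pp : pos (inj Zh) by apply/(pos_inj Zh sh).
have [v [w [pv e v0 bw wv]]] := pos_cut sh pp (erefl _) c0.
have w0 : sc w = 0.
  by have := congr1 (@sc _ _ _) e; rewrite scD v0 add0r.
exists (el v), (el w); split; split.
- exact: elP.
- exact: elP.
- exact: pos_el.
- exact: (congr1 (@el _ _ _) e).
- by apply: (bd_inj_nrm (Zz := elP w)); rewrite -inj_el.
- have := congr1 (@el _ _ _) wv; rewrite !elM v0 w0 /= !scale0r !add0r.
  by rewrite cmul0x addr0.
Qed.

Lemma cpos_expand v b : cpos v -> nrm b <= nrm (b + v ** b).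
Proof.
move=> pv; have sv := cpos_sa pv; have Zv := Zr_self v.
have pp : pos (inj Zv) by apply/(pos_inj Zv sv).
by have := pos_expand b pp; rewrite act_inj.
Qed.

Lemma expr_small (t e : R) : 0 <= t -> t < 1 -> 0 < e -> exists n, t ^+ n < e.
Proof.
move=> t0 t1 e0; have : `|t| < 1 by rewrite ger0_norm.
move=> /cvg_expr/cvgrPdist_lt/(_ e e0)[n _ /(_ n)] /=.
by rewrite sub0r normrN ger0_norm ?exprn_ge0 // => h; exists n; exact: h.
Qed.

(* If y acts on X with norm at most r < s, the part of y^# y above s^2 kills X:
   it expands under powers of y^# y at a rate which X does not allow. *)
Lemma nrm_le_of_action y (X : set A) r : 0 <= r ->
  (forall l, X l -> X (y^# ** y ** l)) ->
  (forall l, X l -> nrm (y ** l) <= r * nrm l) ->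
  (forall v, Zr (y^# ** y) v -> v^# = v -> (forall l, X l -> v ** l = 0) ->
    y ** v = 0) ->
  nrm y <= r.
Proof.
move=> r0 hX; set h := y^# ** y => yX vX.
have sh : h^# = h by rewrite /h cstarM cstarK.
have hl l : X l -> nrm (h ** l) <= r ^+ 2 * nrm l.
  move=> Xl; have [->|/eqP/nrm_gt0 h0] := eqVneq (h ** l) 0.
    by rewrite nrm0 mulr_ge0 ?sqr_ge0 ?nrm_ge0.
  rewrite -(ler_pM2r h0) -expr2 -nrm_starM.
  have -> : (h ** l)^# ** (h ** l) = (y ** l)^# ** (y ** (h ** l)).
    by rewrite (cstarM h) sh (cstarM y) /h !cmulA.
  apply: le_trans (nrmM _ _) _; rewrite nrm_star.
  have := yX _ Xl; have := yX _ (hX _ Xl); rewrite -/h.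
  move=> h1 h2.
  have -> : r ^+ 2 * nrm l * nrm (h ** l) = (r * nrm l) * (r * nrm (h ** l)) by ring.
  by apply: ler_pM => //; exact: nrm_ge0.
apply/ler_addgt0Pr => e e0; set s := r + e.
have s0 : 0 < s by rewrite /s; lra.
have s40 : 0 < s ^+ 4 by rewrite exprn_gt0.
(* The scaling turns a cut of h^2 at level s^4 into a cut of k h^2 at level 1. *)
pose k := (s ^+ 4)^-1; have k0 : 0 <= k by rewrite invr_ge0 ltW.
have pk : cpos (k%:C *: (h ** h)) by apply: cposZ => //; exact: cpos_sqr.
have [v [w [[Zv Zw pv] [ek w1 wv]]]] := cpos_cut pk ltr01.
have Zhk : Zr h (k%:C *: (h ** h)).
  have sZ := Zr_subalgebra h; apply: (rsubZ sZ).
  by apply: (rsubM sZ); exact: Zr_self.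
have Zhv : Zr h v := Zr_sub Zhk Zv.
have hv : h ** v = v ** h := Zr_comm (Zr_self h) Zhv.
have kv : k%:C *: (h ** h) ** v = v + v ** v.
  by rewrite ek cmulDl wv scale1r addrC.
(* From k h^2 v = v + v^2, expansion by 1 + v gives |v l| <= k |v h^2 l|. As h^2 acts on X with norm
   at most r^4, iterating multiplies by t = (r/s)^4 < 1, which forces v l = 0. *)
have vexp l : nrm (v ** l) <= k * nrm (v ** (h ** (h ** l))).
  have := cpos_expand (v ** l) pv; rewrite cmulA -cmulDl -kv.
  rewrite cmulZl -cmulA hv cmulA hv -!cmulA cmulZl.
  by rewrite nrmZp // -!cmulA.
pose t := k * r ^+ 4.
have t0 : 0 <= t by rewrite mulr_ge0 // exprn_ge0.
have t1 : t < 1.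
  rewrite /t /k mulrC ltr_pdivrMr // mul1r ltrXn2r //.
  by rewrite /s ltrDl.
have vit j l : X l -> nrm (v ** l) <= t ^+ j * (nrm v * nrm l).
  elim: j l => [|j IH] l Xl; first by rewrite expr0 mul1r nrmM.
  apply: le_trans (vexp l) _.
  have -> : t ^+ j.+1 * (nrm v * nrm l)
      = k * (t ^+ j * (nrm v * (r ^+ 2 * (r ^+ 2 * nrm l)))).
    by rewrite exprS {1}/t; ring.
  have Xh := hX _ Xl; rewrite ler_wpM2l // (le_trans (IH _ (hX _ Xh))) //.
  rewrite ler_wpM2l ?exprn_ge0 // ler_wpM2l ?nrm_ge0 //.
  by apply: le_trans (hl _ Xh) _; rewrite ler_wpM2l ?sqr_ge0 // hl.
have vX0 l : X l -> v ** l = 0.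
  move=> Xl; apply: nrm_le0; apply/ler_addgt0Pr => d d0; rewrite add0r.
  have m0 : 0 < nrm v * nrm l + 1.
    by have := mulr_ge0 (nrm_ge0 v) (nrm_ge0 l); lra.
  have [n hn] := expr_small t0 t1 (divr_gt0 d0 m0).
  apply: le_trans (vit n l Xl) _; rewrite ltr_pdivlMr // in hn.
  by have := exprn_ge0 n t0; lra.
have yv := vX v Zhv (cpos_sa pv) vX0.
(* y v = 0 gives h v = 0, hence v + v^2 = 0. Then k h^2 is the part w below the cut, of norm at most
   1, and this says |y|^4 <= s^4. *)
have v0 : v = 0.
  apply: nrm_le0; apply: le_trans (cpos_expand v pv) _.
  by rewrite -kv cmulZl -cmulA /h -(cmulA _ y v) yv !cmulx0 scaler0 nrm0.
have : nrm (k%:C *: (h ** h)) <= 1 by rewrite ek v0 add0r.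
rewrite nrmZp // nrm_sa_sqr // nrm_starM /k mulrC ler_pdivrMr // mul1r.
rewrite -exprM ler_pXn2r ?nnegrE ?nrm_ge0 //; exact: ltW.
Qed.

End Positive.

(** * Membership in the Pedersen ideal *)

Section Pedersen.
Variables (R : realType) (A : cstarAlgType R).
Implicit Types (x y z v w h b : A) (r k c : R).
Local Notation K := (@pedersen_ideal R A).

Section IdealTheory.
Variable I : set A.
Hypothesis idI : two_sided_ideal I.
Lemma ideal0 : I 0. Proof. by case: idI. Qed.
Lemma idealD x y : I x -> I y -> I (x + y).
Proof. by case: idI => _ h _ _ Ix Iy; have := h 1 x y Ix Iy; rewrite scale1r. Qed.
Lemma idealZ (a : R[i]) x : I x -> I (a *: x).
Proof. by case: idI => I0 h _ _ Ix; have := h a x 0 Ix I0; rewrite addr0. Qed.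
Lemma idealN x : I x -> I (- x).
Proof. by move=> Ix; rewrite -scaleN1r; exact: idealZ. Qed.
Lemma idealB x y : I x -> I y -> I (x - y).
Proof. by move=> Ix Iy; apply: idealD => //; exact: idealN. Qed.
Lemma idealMl x y : I y -> I (x ** y). Proof. by case: idI => _ _ h _; exact: h. Qed.
Lemma idealMr x y : I x -> I (x ** y). Proof. by case: idI => _ _ _ h; exact: h. Qed.
Lemma ideal_sum_mem (J : Type) (s : seq J) (f : J -> A) :
  (forall j, I (f j)) -> I (\sum_(j <- s) f j).
Proof.
move=> If; elim: s => [|j s IH]; first by rewrite big_nil; exact: ideal0.
by rewrite big_cons; exact: idealD.
Qed.
End IdealTheory.

Lemma closed_ideal_lim (I : set A) x : closed_ideal I ->
  (forall e : R, 0 < e -> exists y, I y /\ nrm (x - y) < e) -> I x.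
Proof. by case=> _ /closedP; exact. Qed.

Lemma closed_ideal_Zr (I : set A) x y : closed_ideal I -> I x -> Zr x y -> I y.
Proof.
move=> [idI cI] Ix; apply => //; split=> // [|r u v Iu Iv|u v Iu Iv].
- exact: ideal0.
- by apply: (idealD idI) => //; exact: (idealZ idI).
- exact: (idealMl idI).
Qed.

Lemma pedersen_two_sided : two_sided_ideal K.
Proof.
split=> [I []/ideal0//|a x y Kx Ky I dI|x y Ky I dI|x y Kx I dI].
- case: (dI) => idI _; apply: (idealD idI); last exact: Ky.
  by apply: (idealZ idI); exact: Kx.
- by case: (dI) => idI _; apply: (idealMl idI); exact: Ky.
- by case: (dI) => idI _; apply: (idealMr idI); exact: Kx.
Qed.

Lemma neumann y : nrm y < 1 / 2 -> exists s, s = y + y ** s.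
Proof.
move=> y2; pose u := fix u n : A := if n is n'.+1 then y + y ** u n' else 0.
have du n : nrm (u n.+1 - u n) <= 1 * 2^-1 ^+ n.
  elim: n => [|n IH].
    by rewrite /= cmulx0 addr0 subr0 expr0 mulr1; lra.
  have -> : u n.+2 - u n.+1 = y ** (u n.+1 - u n).
    by rewrite cmulBr /= opprD addrACA subrr add0r.
  have := nrmM y (u n.+1 - u n); have := nrm_ge0 y.
  have := nrm_ge0 (u n.+1 - u n); rewrite exprS; nra.
have [l hl] := geometric_complete du.
exists l; apply: nrm_small => e e0.
have [N hN] := geometric_small 3 e0.
have := hl N.+1; have := hl N; have := hN N (leqnn _).
have := nrm_tri (u N.+1) l (y + y ** l).
have -> : u N.+1 - (y + y ** l) = - (y ** (l - u N)).
  by rewrite cmulBr /= opprD addrACA subrr add0r opprB.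
have := nrmM y (l - u N); have := nrm_ge0 y; have := nrm_ge0 (l - u N).
have p : 0 <= 2^-1 ^+ N :> R by rewrite exprn_ge0 // invr_ge0.
rewrite nrmN exprS mulr1; nra.
Qed.

(** A dense ideal contains some y close to b. Then x y = x (1 - (b - y)), and 1 - (b - y) is
    inverted by a Neumann series, so x is a right multiple of x y. *)
Lemma pedersen_mem x b : x ** b = x -> K x.
Proof.
move=> xb I [idI /denseP dI].
have [|y [Iy bY]] := dI b (1 / 2); first by rewrite divr_gt0.
have [s es] := neumann bY.
have -> : x = x ** y + (x ** y) ** s.
  have xy : x ** y = x - x ** (b - y) by rewrite cmulBr xb subKr.
  have xs : x ** s = x ** (b - y) + x ** (b - y) ** s.
    by rewrite {1}es cmulDr cmulA.
  by rewrite xy cmulBl xs addrK subrK.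
apply: (idealD idI); first exact: (idealMl idI).
by apply: (idealMr idI); exact: (idealMl idI).
Qed.

End Pedersen.

(** * Local units *)

Section ImaginaryUnit.
Variable R : realType.

Definition iu : R[i] := 0 +i* 1.

Lemma conj_iu : Num.conj iu = - iu.
Proof. by apply/eqP; rewrite eq_complex /= oppr0 !eqxx. Qed.

Lemma iu_sqr : iu * iu = -1.
Proof. by rewrite -expr2 sqr_i. Qed.

Lemma cabs_iu : cabs iu = 1.
Proof. by rewrite /cabs normc_def /= expr0n add0r expr1n sqrtr1. Qed.

End ImaginaryUnit.
Arguments iu {R}.

Section Compactly.
Variables (R : realType) (A : cstarAlgType R).
Implicit Types (x y z v w h b : A) (r k c : R).
Local Notation K := (@pedersen_ideal R A).

(** The analogue of a compactly supported function b, with b' equal to 1 on the support of b; b' is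
    what places b in [K(A)]. *)
Definition local_unit b : Prop := b^# = b /\ exists2 b', b'^# = b' & b ** b' = b.

Lemma local_unit_pedersen b : local_unit b -> K b.
Proof. by move=> [_ [b' _ /pedersen_mem]]. Qed.

Lemma right_fixed_subalgebra b : real_subalgebra [set z | z ** b = z].
Proof.
split=> [/=|r x z /= xy zy|x z /= xy zy|].
- by rewrite cmul0x.
- by rewrite cmulDl cmulZl xy zy.
- by rewrite -cmulA zy.
apply/closedP => x h /=; apply: nrm_small => e e0.
have [d d0 hd] := cmul_near x b (divr_gt0 e0 (ltr0Sn _ 1)).
have [|z /= [zy xz]] := h (Num.min d (e / 2)); first by rewrite lt_min d0 divr_gt0.
move: xz; rewrite lt_min => /andP[xz1 xz2].
apply: le_trans (nrm_tri (z ** b) _ _) _.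
have := hd z b xz1; rewrite subrr nrm0 => /(_ d0).
by rewrite zy (nrmB z); lra.
Qed.

Lemma left_annihilator_subalgebra (X : set A) :
  real_subalgebra [set z | forall l, X l -> z ** l = 0].
Proof.
split=> [l _|r x z xl zl l Xl|x z xl zl l Xl|].
- by rewrite cmul0x.
- by rewrite cmulDl cmulZl xl // zl // scaler0 addr0.
- by rewrite -cmulA zl // cmulx0.
apply/closedP => x h l Xl; apply: nrm_le0; apply/ler_addgt0Pr => e e0.
have [d d0 hd] := cmul_near x l e0.
have [z [zX xz]] := h d d0.
by have := hd z l xz; rewrite subrr nrm0 => /(_ d0); rewrite zX // subr0; lra.
Qed.

(** Cutting twice at c/2 realizes three functions of h: a = (h - c)^+, b = min((h - c/2)^+, c/2) /
    (c/2) and b' = min(h, c/2) / (c/2). Each is 1 where the preceding one is nonzero. *)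
Lemma cpos_local_unit h c : cpos h -> 0 < c -> exists a b,
  [/\ Zr h a, cpos a, nrm (h - a) <= c, local_unit b & a ** b = a].
Proof.
move=> ph c0; have c20 : 0 < c / 2 by rewrite divr_gt0.
have ic : (c / 2)^-1 * (c / 2) = 1 by rewrite mulVf ?gt_eqF.
have [v1 [w1 [[Zv1 Zw1 pv1] [e1 n1 wv1]]]] := cpos_cut ph c20.
have [v2 [w2 [[Zv2 Zw2 pv2] [e2 n2 wv2]]]] := cpos_cut pv1 c20.
have sw w : Zr h w -> w^# = w by apply: Zr_sa; exact: cpos_sa.
have Zhv2 : Zr h v2 := Zr_sub Zv1 Zv2.
have Zhw2 : Zr h w2 := Zr_sub Zv1 Zw2.
exists v2, ((c / 2)^-1%:C *: w2); split => //.
- have -> : h - v2 = w1 + w2 by rewrite e1 e2 addrAC [v2 + w2]addrC addrK addrC.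
  by apply: le_trans (nrmD _ _) _; lra.
- split; first by rewrite cstarZr sw.
  exists ((c / 2)^-1%:C *: w1); first by rewrite cstarZr sw.
  rewrite cmulZl; congr (_ *: _).
  apply: (Zw2 _ (right_fixed_subalgebra ((c / 2)^-1%:C *: w1))).
  by rewrite /= cmulZr (Zr_comm Zv1 Zw1) wv1 scalerA -rmorphM ic scale1r.
by rewrite cmulZr (Zr_comm Zv2 Zw2) wv2 scalerA -rmorphM ic scale1r.
Qed.

Lemma sa_parts x : exists y z, [/\ y^# = y, z^# = z & x = y + iu *: z].
Proof.
exists ((2^-1)%:C *: (x + x^#)), ((2^-1)%:C *: (iu *: (x^# - x))); split.
- by rewrite cstarZr cstarD cstarK addrC.
- by rewrite cstarZr cstarZ conj_iu cstarB cstarK scaleNr -scalerN opprB.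
have -> : iu *: ((2^-1)%:C *: (iu *: (x^# - x))) = (2^-1)%:C *: (x - x^#).
  by rewrite !scalerA mulrAC iu_sqr mulN1r scaleNr -scalerN opprB.
rewrite -scalerDr addrACA [x^# - _]addrC addNr.
rewrite addr0 -mulr2n -(scaler_nat 2 x) scalerA.
by rewrite -(rmorph_nat (real_complex R)) -rmorphM /= mulVf ?scale1r.
Qed.

Lemma local_unit_approx x c : 0 < c -> exists a b : 'I_4 -> A,
  (forall i, local_unit (b i) /\ a i ** b i = a i) /\
  exists s : 'I_4 -> R[i], nrm (x - \sum_i s i *: a i) < c.
Proof.
move=> c0; have [y [z [sy sz ->]]] := sa_parts x.
have [y1 [y2 [[_ _ py1 py2] [-> _ _]]]] := cpos_parts sy.
have [z1 [z2 [[_ _ pz1 pz2] [-> _ _]]]] := cpos_parts sz.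
(* Four errors of at most c/5 each stay strictly below c. *)
have d0 : 0 < c / 5 by rewrite divr_gt0.
have [a1 [b1 [_ _ n1 u1 ab1]]] := cpos_local_unit py1 d0.
have [a2 [b2 [_ _ n2 u2 ab2]]] := cpos_local_unit py2 d0.
have [a3 [b3 [_ _ n3 u3 ab3]]] := cpos_local_unit pz1 d0.
have [a4 [b4 [_ _ n4 u4 ab4]]] := cpos_local_unit pz2 d0.
exists (fun i => nth 0 [:: a1; a2; a3; a4] i), (fun i => nth 0 [:: b1; b2; b3; b4] i).
split; first by case=> [[|[|[|[|//]]]]].
exists (fun i => nth 0 [:: 1; -1; iu; - iu] i).
rewrite !big_ord_recl big_ord0 /= addr0 scale1r !scaleNr scale1r scalerBr.
have -> : y1 - y2 + (iu *: z1 - iu *: z2) - (a1 + (- a2 + (iu *: a3 - iu *: a4)))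
    = (y1 - a1) - (y2 - a2) + (iu *: (z1 - a3) - iu *: (z2 - a4)).
  rewrite !scalerBr !opprD !opprK [- a1 + _]addrA addrACA (addrACA y1).
  by rewrite (addrACA (iu *: z1)).
apply: le_lt_trans (nrmD _ _) _.
have := nrmBD (y1 - a1) (y2 - a2).
have := nrmBD (iu *: (z1 - a3)) (iu *: (z2 - a4)).
rewrite !nrmZ cabs_iu !mul1r; lra.
Qed.

Lemma local_unit_span (M : set A) :
  M 0 -> (forall (s : R[i]) x y, M x -> M y -> M (s *: x + y)) -> closed M ->
  (forall a b, local_unit b -> a ** b = a -> M a) -> forall x, M x.
Proof.
move=> M0 ML /closedP cM Ma x; apply: cM => e e0.
have [a [b [ab [s hs]]]] := local_unit_approx x e0.
exists (\sum_i s i *: a i); split=> //.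
elim/big_ind : _ => // [u v Mu Mv|i _].
  by have := ML 1 u v Mu Mv; rewrite scale1r.
have [ub abi] := ab i; have := ML (s i) _ _ (Ma _ _ ub abi) M0.
by rewrite addr0.
Qed.

(** Keeping y in [Zr z] makes it annihilate whatever z annihilates, while y in [K(A)] can be moved
    through a centralizer; [bounded_gen_ideal] needs both. *)
Lemma sa_pedersen_approx z c : z^# = z -> 0 < c ->
  exists y, [/\ Zr z y, K y & nrm (z - y) <= c].
Proof.
move=> sz c0; have [z1 [z2 [[Z1 Z2 p1 p2] [e _ _]]]] := cpos_parts sz.
have d0 : 0 < c / 2 by rewrite divr_gt0.
have [a1 [b1 [Za1 _ n1 u1 ab1]]] := cpos_local_unit p1 d0.
have [a2 [b2 [Za2 _ n2 u2 ab2]]] := cpos_local_unit p2 d0.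
exists (a1 - a2); split.
- by apply: (rsubB (Zr_subalgebra z)); [exact: Zr_sub Za1 | exact: Zr_sub Za2].
- by apply: (idealB (pedersen_two_sided A)); [exact: pedersen_mem ab1 | exact: pedersen_mem ab2].
rewrite {1}e; have -> : z1 - z2 - (a1 - a2) = (z1 - a1) - (z2 - a2).
  by rewrite !opprD !opprK addrACA.
by apply: le_trans (nrmBD _ _) _; lra.
Qed.

End Compactly.

(** * Minimal projections *)

Section MinimalProjection.
Variables (R : realType) (A : cstarAlgType R).
Implicit Types (x y z u v w h b : A) (r k c : R) (a : R[i]).
Local Notation K := (@pedersen_ideal R A).

Definition minproj (q : A) : Prop :=
  [/\ q^# = q, q ** q = q, q <> 0 & forall x, exists a, q ** x ** q = a *: q].

(** For u = y + i z the sum is 2 (y^2 + z^2). It decides the sign in [ip_self], where positivity of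
    [u^# ** u] is not yet known. *)
Lemma cpos_starM_sum u : cpos (u^# ** u + u ** u^#).
Proof.
have [y [z [sy sz ->]]] := sa_parts u.
have us : (y + iu *: z)^# = y - iu *: z by rewrite cstarD cstarZ conj_iu sy sz scaleNr.
have ii t : - (iu *: (iu *: t)) = t :> A by rewrite scalerA iu_sqr scaleN1r opprK.
pose t := iu *: (y ** z) - iu *: (z ** y).
have -> : (y + iu *: z)^# ** (y + iu *: z) = (y ** y + z ** z) + t.
  rewrite us cmulBl !cmulDr !(cmulZl, cmulZr) opprD ii /t.
  by rewrite [- _ + z ** z]addrC addrACA.
have -> : (y + iu *: z) ** (y + iu *: z)^# = (y ** y + z ** z) - t.
  rewrite us cmulBr !cmulDl !(cmulZl, cmulZr) opprD ii /t opprB.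
  by rewrite [- _ + z ** z]addrC addrACA [X in _ + X]addrC.
rewrite addrACA subrr addr0; apply: cposD; apply: cposD; exact: cpos_sqr.
Qed.

Section Fixed.
Variable q : A.
Hypothesis mq : minproj q.

Let sq : q^# = q. Proof. by case: mq. Qed.
Let qq : q ** q = q. Proof. by case: mq. Qed.
Let q0 : q <> 0. Proof. by case: mq. Qed.

(** For a projection q this is the left ideal A q; for a local unit b, [Aq b] is the Banach space of
    all x with x b = x. *)
Definition Aq : set A := [set u | u ** q = u].

Lemma Aq0 : Aq 0. Proof. exact: cmul0x. Qed.
Lemma Aq_lin a u v : Aq u -> Aq v -> Aq (a *: u + v).
Proof. by rewrite /Aq /= cmulDl cmulZl => -> ->. Qed.
Lemma AqM x u : Aq u -> Aq (x ** u). Proof. by rewrite /Aq /= -cmulA => ->. Qed.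
Lemma Aq_q : Aq q. Proof. exact: qq. Qed.
Lemma Aq_self x : Aq (x ** q). Proof. exact: AqM Aq_q. Qed.
Lemma AqB u v : Aq u -> Aq v -> Aq (u - v).
Proof. by rewrite /Aq /= cmulBl => -> ->. Qed.
Lemma AqZ a u : Aq u -> Aq (a *: u).
Proof. by rewrite /Aq /= cmulZl => ->. Qed.
Lemma AqD u v : Aq u -> Aq v -> Aq (u + v).
Proof. by rewrite /Aq /= cmulDl => -> ->. Qed.

Lemma Aq_star u : Aq u -> q ** u^# = u^#.
Proof. by rewrite /Aq /= => e; rewrite -{1}sq -cstarM e. Qed.

Lemma Aq_pedersen u : Aq u -> K u.
Proof. exact: pedersen_mem. Qed.

Lemma closed_Aq : closed Aq.
Proof. by case: (right_fixed_subalgebra q). Qed.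

Lemma nrm_q : nrm q = 1.
Proof.
have := nrm_sa_sqr sq; rewrite qq expr2 => e.
have q1 := nrm_gt0 q0; apply: (mulIf (lt0r_neq0 q1)); by rewrite mul1r -e.
Qed.

Lemma scale_q_inj a a' : a *: q = a' *: q -> a = a'.
Proof.
move=> /eqP; rewrite -subr_eq0 -scalerBl scaler_eq0 => /orP[/eqP/subr0_eq//|/eqP//].
Qed.

(* For [u], [v] in [Aq] this is the inner product of [u] and [v]. *)
Definition ip u v : R[i] := xget 0 [set a | q ** (v^# ** u) ** q = a *: q].

Lemma ipE u v : Aq u -> Aq v -> v^# ** u = ip u v *: q.
Proof.
move=> Au Av; have [_ _ _ /(_ (v^# ** u))[a ea]] := mq.
rewrite /ip; case: xgetP => [_ -> /= <-|/(_ a)/(_ ea)//].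
by rewrite cmulA (Aq_star Av) -cmulA Au.
Qed.

Lemma ip_eq u v a : Aq u -> Aq v -> v^# ** u = a *: q -> ip u v = a.
Proof. by move=> Au Av e; apply: scale_q_inj; rewrite -ipE. Qed.

Lemma ip_lin a u v w : Aq u -> Aq v -> Aq w -> ip (a *: u + v) w = a * ip u w + ip v w.
Proof.
move=> Au Av Aw; apply: ip_eq => //; first exact: Aq_lin.
by rewrite cmulDr cmulZr !ipE // scalerA -scalerDl.
Qed.

Lemma ip_conj u v : Aq u -> Aq v -> ip v u = Num.conj (ip u v).
Proof.
move=> Au Av; apply: ip_eq => //.
by rewrite -[u^# ** v]cstarK cstarM cstarK ipE // cstarZ sq.
Qed.

Lemma ip_mul u v x : Aq u -> Aq v -> ip (x ** u) v = ip u (x^# ** v).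
Proof.
move=> Au Av; apply: ip_eq => //; first exact: AqM.
by rewrite -ipE //; [rewrite cstarM cstarK cmulA | exact: AqM].
Qed.

Lemma ip_self u : Aq u -> ip u u = (nrm u ^+ 2)%:C.
Proof.
move=> Au; have e := ipE Au Au.
have rI : complex.Im (ip u u) = 0.
  have := ip_conj Au Au; case: (ip u u) => s t; rewrite /= => -[] /eqP.
  by rewrite -subr_eq0 opprK -mulr2n mulrn_eq0 => /eqP.
have {rI}[s es] : exists s : R, ip u u = s%:C.
  by exists (complex.Re (ip u u)); move: rI; case: (ip u u) => s t /= ->.
rewrite es in e *; congr _%:C.
have : nrm (u^# ** u) = `|s| by rewrite e nrmZr nrm_q mulr1.
rewrite nrm_starM => ns.
have [s0|s0] := leP 0 s; first by rewrite ns ger0_norm.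
(* For s < 0 the element u u^# is both positive and negative. *)
have : u ** u^# = 0.
  apply: cpos_antisym.
    have -> : u ** u^# = (u^# ** u + u ** u^#) + (- s)%:C *: (q ** q).
      by rewrite qq e rmorphN scaleNr addrAC subrr add0r.
    apply: cposD; first exact: cpos_starM_sum.
    by apply: cposZ; [rewrite oppr_ge0 ltW | exact: cpos_sqr].
  have -> : - (u ** u^#) = (- s^-1)%:C *: ((u ** u^#) ** (u ** u^#)).
    rewrite -cmulA (cmulA u^#) e cmulZl (Aq_star Au) cmulZr scalerA -rmorphM.
    by rewrite mulNr mulVf ?lt_eqF // rmorphN1 scaleN1r.
  apply: cposZ; first by rewrite oppr_ge0 invr_le0 ltW.
  by apply: cpos_sqr; rewrite cstarM cstarK.
move=> /Mstar_eq0 u0; move: ns; rewrite u0 nrm0 expr0n /= => /esym/eqP.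
by rewrite normr_eq0 lt_eqF.
Qed.

Definition ortho (s : seq A) : Prop := forall i j, (i < size s)%N -> (j < size s)%N ->
  (s`_i)^# ** s`_j = if i == j then q else 0.

(** For orthonormal s, left multiplication by this element is the orthogonal projection of [Aq] onto
    the span of s. *)
Definition sproj (s : seq A) : A := \sum_(v <- s) v ** v^#.

Lemma sproj_nth s j : ortho s -> (forall v, v \in s -> Aq v) -> (j < size s)%N ->
  sproj s ** s`_j = s`_j.
Proof.
move=> os As js; rewrite /sproj cmul_suml (big_nth 0) (bigD1_seq j) /= ?iota_uniq //;
  last by rewrite mem_index_iota.
rewrite -cmulA os // eqxx As ?mem_nth // big_seq_cond big1 ?addr0 // => i.
rewrite mem_index_iota /= => /andP[si ij].
by rewrite -cmulA os // (negPf ij) cmulx0.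
Qed.

Lemma sproj_sa s : (sproj s)^# = sproj s.
Proof.
rewrite /sproj cstar_sum; apply: eq_bigr => v _.
by rewrite cstarM cstarK.
Qed.

Lemma normalize w : Aq w -> w <> 0 -> exists a, (a *: w)^# ** (a *: w) = q.
Proof.
move=> Aw w0; have n0 := nrm_gt0 w0.
exists ((nrm w)^-1%:C); rewrite cstarZr cmulZl cmulZr ipE // ip_self // !scalerA.
rewrite -!rmorphM /= (_ : _ * _ = 1) ?scale1r //.
by field; rewrite gt_eqF.
Qed.

Lemma ortho_basis_or_seq (V : set A) : (forall u, V u -> Aq u) ->
  (forall a u v, V u -> V v -> V (a *: u + v)) -> V 0 ->
  (exists s : seq A, [/\ forall v, v \in s -> V v, ortho s & forall u, V u -> sproj s ** u = u]) \/
  (exists v : nat -> A, (forall n, V (v n)) /\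
     forall i j, (v i)^# ** v j = if i == j then q else 0).
Proof.
move=> VA VL V0.
pose good (s : seq A) := (forall v, v \in s -> V v) /\ ortho s.
pose next (s : seq A) w := [/\ V w, w^# ** w = q & forall v, v \in s -> v^# ** w = 0].
(* If some orthonormal list s has no extension, the residual sproj s u - u must vanish, since
   otherwise it could be normalized and appended. If all lists extend, choice builds the
   sequence. *)
have [h|h] := pselect (forall s, good s -> exists w, next s w); last first.
  left; have /existsNP[s /not_implyP[[sV os] nw]] := h.
  exists s; split=> // u Vu; apply/subr0_eq; apply: contrapT => d0.
  apply: nw; set d := sproj s ** u - u in d0.
  have Vs : V (sproj s ** u).
    rewrite /sproj cmul_suml big_seq; elim/big_ind : _ => // [x y Vx Vy|v vs].
      by have := VL 1 x y Vx Vy; rewrite scale1r.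
    have Av := VA _ (sV _ vs); rewrite -cmulA ipE //; last exact: VA.
    rewrite cmulZr Av; have := VL (ip u v) v 0 (sV _ vs) V0.
    by rewrite addr0.
  have Vd : V d by have := VL (-1) u _ Vu Vs; rewrite scaleN1r addrC.
  have [a ea] := normalize (VA _ Vd) d0.
  exists (a *: d); split=> // [|v vs]; first by have := VL a d 0 Vd V0; rewrite addr0.
  have Av := VA _ (sV _ vs).
  have : sproj s ** v = v.
    have := sproj_nth (j := index v s) os; rewrite nth_index //; apply.
      by move=> x xs; exact: VA (sV _ xs).
    by rewrite index_mem.
  move=> /(congr1 (@cstar _ _)); rewrite cstarM sproj_sa => e.
  by rewrite cmulZr /d cmulBr cmulA e subrr scaler0.
right; have /choice[f hf] : forall s, exists w, good s -> next s w.
  move=> s; have [gs|ngs] := pselect (good s); last by exists 0.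
  by have [w nw] := h s gs; exists w.
pose S := fix S n : seq A := if n is n'.+1 then rcons (S n') (f (S n')) else [::].
have gS n : good (S n).
  elim: n => [|n [sV os]]; first by split.
  have [Vw ww ow] := hf _ (conj sV os); split=> [v|i j].
    by rewrite /= mem_rcons inE => /orP[/eqP->//|/sV].
  rewrite /= size_rcons !ltnS !nth_rcons => li lj.
  have sAq v : v \in S n -> v^# ** f (S n) = 0 by apply: ow.
  have [i1|i1] := ltnP i (size (S n)); have [j1|j1] := ltnP j (size (S n)).
  - exact: os.
  - have -> : j = size (S n) by apply/eqP; rewrite eqn_leq lj.
    by rewrite eqxx (ltn_eqF i1) sAq // mem_nth.
  - have -> : i = size (S n) by apply/eqP; rewrite eqn_leq li.
    rewrite eqxx (gtn_eqF j1) -[LHS]cstarK cstarM cstarK sAq ?mem_nth //.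
    exact: cstar0.
  - have -> : i = size (S n) by apply/eqP; rewrite eqn_leq li.
    have -> : j = size (S n) by apply/eqP; rewrite eqn_leq lj.
    by rewrite !eqxx.
have sS n : size (S n) = n by elim: n => // n IH; rewrite /= size_rcons IH.
have nS m n : (n < m)%N -> nth 0 (S m) n = f (S n).
  elim: m => // m IH; rewrite ltnS leq_eqVlt => /orP[/eqP->|nm].
    by rewrite /= nth_rcons sS ltnn eqxx.
  by rewrite /= nth_rcons sS nm IH.
exists (fun n => f (S n)); split=> [n|i j]; first by have [] := hf _ (gS n).
have [_ /(_ i j)] := gS (maxn i j).+1; rewrite sS !ltnS leq_maxl leq_maxr.
by rewrite !nS ?ltnS ?leq_maxl ?leq_maxr // => ->.
Qed.

(* The linear span of the products u v^# with u, v in Aq. *)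
Definition Fin : set A := [set x | forall M : set A, M 0 ->
  (forall a x y, M x -> M y -> M (a *: x + y)) ->
  (forall u v, Aq u -> Aq v -> M (u ** v^#)) -> M x].

Lemma Fin_uv u v : Aq u -> Aq v -> Fin (u ** v^#).
Proof. by move=> Au Av M _ _; exact. Qed.

Lemma Fin_ideal : two_sided_ideal Fin.
Proof.
have F0 : Fin 0 by move=> M.
have FL a x y : Fin x -> Fin y -> Fin (a *: x + y).
  by move=> Fx Fy M M0 ML Muv; apply: (ML); [exact: (Fx M) | exact: (Fy M)].
split=> // x y.
- move=> Fy; apply: (Fy [set y | Fin (x ** y)]) => /= [|a z t Fz Ft|u v Au Av].
  + by rewrite cmulx0.
  + by rewrite cmulDr cmulZr; exact: FL.
  + by rewrite cmulA; apply: Fin_uv => //; exact: AqM.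
- move=> Fx; apply: (Fx [set x | Fin (x ** y)]) => /= [|a z t Fz Ft|u v Au Av].
  + by rewrite cmul0x.
  + by rewrite cmulDl cmulZl; exact: FL.
  + rewrite -cmulA -[y]cstarK -cstarM.
    by apply: Fin_uv => //; exact: AqM.
Qed.

Lemma Fin_sub I : two_sided_ideal I -> I q -> Fin `<=` I.
Proof.
move=> idI Iq x; apply; first exact: ideal0.
  by move=> a y z Iy Iz; apply: (idealD idI) => //; exact: (idealZ idI).
move=> u v Au _; apply: (idealMr idI); rewrite -Au.
exact: (idealMl idI).
Qed.

Lemma Fin_pedersen : Fin `<=` K.
Proof.
by apply: Fin_sub; [exact: pedersen_two_sided | exact: (pedersen_mem qq)].
Qed.

Lemma Fin_Aq u : Aq u -> Fin u.
Proof. by move=> Au; rewrite -Au -sq; apply: Fin_uv => //; exact: Aq_q. Qed.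

Lemma Fin_sproj (s : seq A) : (forall v, v \in s -> Aq v) -> Fin (sproj s).
Proof.
move=> As; rewrite /sproj big_seq; elim/big_ind : _ => [|x y Fx Fy|v vs].
- exact: (ideal0 Fin_ideal).
- exact: (idealD Fin_ideal).
- by have Av := As _ vs; exact: Fin_uv.
Qed.

Definition Jq : set A := closure Fin.

Lemma closure_ideal (I : set A) : two_sided_ideal I -> closed_ideal (closure I).
Proof.
move=> idI; split; last exact: closed_closure.
split.
- by apply: subset_closure; exact: ideal0.
- move=> a x y /closureP Ix /closureP Iy; apply/closureP => e e0.
  have ca := cabs_ge0 a; have c1 : 0 < cabs a + 1 by lra.
  have [x' [Ix' xx]] := Ix (e / 2 / (cabs a + 1)) (divr_gt0 (divr_gt0 e0 (ltr0Sn _ 1)) c1).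
  have [y' [Iy' yy]] := Iy (e / 2) (divr_gt0 e0 (ltr0Sn _ 1)).
  exists (a *: x' + y'); split; first by apply: (idealD idI) => //; exact: (idealZ idI).
  rewrite opprD addrACA -scalerBr; apply: le_lt_trans (nrmD _ _) _; rewrite nrmZ.
  rewrite ltr_pdivlMr // in xx; have := nrm_ge0 (x - x'); nra.
- move=> x y /closureP Iy; apply/closureP => e e0.
  have [d d0 hd] := cmul_near x y e0; have [y' [Iy' yy]] := Iy d d0.
  exists (x ** y'); split; first exact: (idealMl idI).
  by apply: hd => //; rewrite subrr nrm0.
- move=> x y /closureP Ix; apply/closureP => e e0.
  have [d d0 hd] := cmul_near x y e0; have [x' [Ix' xx]] := Ix d d0.
  exists (x' ** y); split; first exact: (idealMr idI).
  by apply: hd => //; rewrite subrr nrm0.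
Qed.

Lemma Jq_ideal : closed_ideal Jq.
Proof. exact: closure_ideal Fin_ideal. Qed.

Lemma Fin_Jq : Fin `<=` Jq. Proof. exact: subset_closure. Qed.

(** The kernel of the action of A on [Aq], and the candidate for the complement of [Jq]. *)
Definition Aq_ann : set A := [set x | forall u, Aq u -> x ** u = 0].

Lemma Aq_ann_ideal : closed_ideal Aq_ann.
Proof.
split; last by case: (left_annihilator_subalgebra Aq).
split=> [u _|a x y xA yA u Au|x y yA u Au|x y xA u Au].
- by rewrite cmul0x.
- by rewrite cmulDl cmulZl xA // yA // scaler0 addr0.
- by rewrite -cmulA yA // cmulx0.
- by rewrite -cmulA xA //; exact: AqM.
Qed.

Lemma Aq_ann_Jq x y w : Aq_ann x -> Jq y -> x ** w ** y = 0.
Proof.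
move=> xA /closureP yJ; apply: nrm_le0; apply/ler_addgt0Pr => e e0; rewrite add0r.
have [d d0 hd] := cmul_near (x ** w) y e0.
have [z [Fz yz]] := yJ d d0.
have := hd (x ** w) z; rewrite subrr nrm0 => /(_ d0 yz).
suff -> : x ** w ** z = 0 by rewrite subr0 => /ltW.
apply: (Fz [set z | x ** w ** z = 0]) => /= [|a s t hs ht|u v Au Av].
- by rewrite cmulx0.
- by rewrite cmulDr cmulZr hs ht scaler0 addr0.
- by rewrite cmulA -(cmulA x) xA ?cmul0x //; exact: AqM.
Qed.

Lemma Jq_faithful x : Jq x -> Aq_ann x -> x = 0.
Proof.
move=> Jx xA; apply: starM_eq0; apply: sa_sqr_eq0; first by rewrite cstarM cstarK.
by rewrite -cmulA (cmulA x) (Aq_ann_Jq _ xA Jx) cmulx0.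
Qed.

(** On a closed ideal acting faithfully on [Aq] the norm is the operator norm: the v in
    [nrm_le_of_action] lies in I, so it is 0 once it kills [Aq]. *)
Lemma nrm_le_Aq (I : set A) x r : closed_ideal I ->
  (forall y, I y -> Aq_ann y -> y = 0) -> I x -> 0 <= r ->
  (forall u, Aq u -> nrm (x ** u) <= r * nrm u) -> nrm x <= r.
Proof.
move=> cI fI Ix r0 h; apply: (@nrm_le_of_action _ _ x Aq) => // [u Au|v Zv sv vA].
  exact: AqM.
rewrite [v]fI ?cmulx0 //; apply: (closed_ideal_Zr cI _ Zv).
by apply: (idealMl cI.1).
Qed.

End Fixed.
End MinimalProjection.

(** * Unbounded centralizers *)

Section LinearExtension.
Variables (F : fieldType) (V : lmodType F).

(** Partial linear functionals are kept as graphs so that unions of chains serve in Zorn's lemma;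
    the last clause is single-valuedness. *)
Definition linear_graph (G : set (V * F)) : Prop :=
  [/\ G (0, 0),
      forall a x y c d, G (x, c) -> G (y, d) -> G (a *: x + y, a * c + d)
    & forall c, G (0, c) -> c = 0].

Lemma linear_graph_fun G x c d : linear_graph G -> G (x, c) -> G (x, d) -> c = d.
Proof.
move=> [_ GL G0] Gc Gd; have := GL (-1) _ _ _ _ Gd Gc.
by rewrite scaleN1r addNr mulN1r addrC => /G0/subr0_eq.
Qed.

Lemma linear_extension G0 : linear_graph G0 -> exists f : V -> F,
  (forall a x y, f (a *: x + y) = a * f x + f y) /\ forall x c, G0 (x, c) -> f x = c.
Proof.
(* Adjoining [G0] inside P, rather than requiring X to contain it, makes P hold for the union of the
   empty chain. *)
move=> lG0; pose P (X : set (V * F)) := linear_graph (X `|` G0).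
have [C CP totC|X [PX maxX]] := @Zorn_bigcup _ P.
  have up p q : ((\bigcup_(X in C) X) `|` G0) p -> ((\bigcup_(X in C) X) `|` G0) q ->
      exists2 G, linear_graph G & [/\ G p, G q & G `<=` (\bigcup_(X in C) X) `|` G0].
    have sub X : C X -> X `|` G0 `<=` (\bigcup_(X in C) X) `|` G0.
      by move=> CX; apply: setSU => z Xz; exists X.
    move=> [[X CX Xp]|Gp] [[Y CY Yq]|Gq].
    - have [XY|YX] := totC _ _ CX CY.
        by exists (Y `|` G0); [exact: CP | split; [left; exact: XY | left | exact: sub]].
      by exists (X `|` G0); [exact: CP | split; [left | left; exact: YX | exact: sub]].
    - by exists (X `|` G0); [exact: CP | split; [left | right | exact: sub]].
    - by exists (Y `|` G0); [exact: CP | split; [right | left | exact: sub]].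
    - by exists G0 => //; split => // z; right.
  case: (lG0) => G00 _ _; split; first by right.
  - move=> a x y c d Gx Gy; have [G [_ GL _] [Gx' Gy' sG]] := up _ _ Gx Gy.
    by apply: sG; exact: GL.
  - by move=> c Gc; have [G [_ _ G0c] [Gc' _ _]] := up _ _ Gc Gc; exact: G0c.
set G := X `|` G0 in PX; case: (PX) => Goo GL G1.
have dom x : exists c, G (x, c).
  apply: contrapT => nx.
  pose G' : set (V * F) := [set p | exists y t, G (y, p.2) /\ p.1 = y + t *: x].
  have GG' : G `<=` G'.
    by move=> [y c] Gy; exists y, 0; rewrite scale0r addr0.
  apply: (maxX G').
    split; first by move=> p Xp; apply: GG'; left.
    move=> sub; apply: nx; exists 0; left; apply: sub.
    by exists 0, 1; rewrite add0r scale1r.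
  rewrite /P (_ : G' `|` G0 = G'); last by apply: setUidl => p G0p; apply: GG'; right.
  split; first exact: GG'.
  - move=> a _ _ c d [y [t [/= Gy ->]]] [z [s [/= Gz ->]]].
    exists (a *: y + z), (a * t + s); split; first exact: GL.
    by rewrite /= scalerDr scalerDl scalerA addrACA.
  - move=> c [y [t [/= Gy e]]]; have [t0|t0] := eqVneq t 0.
      by move: Gy; rewrite t0 scale0r addr0 in e; rewrite -e; exact: G1.
    exfalso; apply: nx; exists ((- t^-1) * c + 0).
    have := GL (- t^-1) _ _ _ _ Gy Goo; rewrite addr0.
    have -> // : (- t^-1) *: y = x.
    move/eqP: e; rewrite eq_sym addr_eq0 => /eqP ->.
    by rewrite scaleNr scalerN opprK scalerA mulVf // scale1r.
have /choice[f hf] := dom; exists f; split.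
- move=> a x y; apply: (linear_graph_fun PX (hf _)).
  exact: (GL _ _ _ _ _ (hf x) (hf y)).
- by move=> x c Gx; apply: (linear_graph_fun PX (hf _)); right.
Qed.

End LinearExtension.

Section UnboundedCentralizer.
Variables (R : realType) (A : cstarAlgType R) (q : A).
Implicit Types (x y z u w b : A) (r k c : R) (a : R[i]).
Hypothesis mq : minproj q.
Local Notation K := (@pedersen_ideal R A).
Let qq : q ** q = q. Proof. by case: mq. Qed.

Lemma unbounded_functional (v : nat -> A) : (forall n, Aq q (v n)) ->
  (forall i j, (v i)^# ** v j = if i == j then q else 0) ->
  exists f : A -> R[i], (forall a x y, f (a *: x + y) = a * f x + f y) /\
    forall n, f (v n) = n%:R.
Proof.
move=> Av ov; pose G0 : set (A * R[i]) := [set p | Aq q p.1 /\ exists N, forall n,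
  (N <= n)%N -> p.1 = \sum_(i < n) ip q p.1 (v i) *: v i /\
                p.2 = \sum_(i < n) ip q p.1 (v i) * i%:R].
have ip0 w : Aq q w -> ip q 0 w = 0.
  move=> Aw; apply: (ip_eq mq) => //; first exact: Aq0.
  by rewrite cmulx0 scale0r.
have lG : linear_graph G0.
  split.
  - split; first exact: Aq0.
    exists 0%N => n _; split; rewrite big1 // => i _; rewrite ip0 ?scale0r ?mul0r //.
  - move=> a x y c d [/= Ax [N hN]] [/= Ay [M hM]]; split; first exact: Aq_lin.
    exists (maxn N M) => n; rewrite geq_max => /andP[Nn Mn].
    have [ex ec] := hN n Nn; have [ey ed] := hM n Mn; split => /=.
      rewrite {1}ex {1}ey scaler_sumr -big_split /=; apply: eq_bigr => i _.
      by rewrite ip_lin // scalerDl scalerA.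
    rewrite {1}ec {1}ed mulr_sumr -big_split /=; apply: eq_bigr => i _.
    by rewrite ip_lin // mulrDl mulrA.
  - move=> c [/= A0 [N /(_ N (leqnn N))[_ ->]]].
    by rewrite big1 // => i _; rewrite ip0 // mul0r.
have [f [fL fG]] := linear_extension lG; exists f; split=> // n; apply: fG.
have ipv i : ip q (v n) (v i) = (i == n)%:R.
  apply: (ip_eq mq) => //; rewrite ov; case: eqP => _; by rewrite ?scale1r ?scale0r.
split; first exact: Av.
exists n.+1 => m nm; split=> /=.
  rewrite (bigD1 (Ordinal nm)) //= ipv eqxx scale1r big1 ?addr0 // => i.
  by rewrite -val_eqE /= => /negPf h; rewrite ipv h scale0r.
rewrite (bigD1 (Ordinal nm)) //= ipv eqxx mul1r big1 ?addr0 // => i.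
by rewrite -val_eqE /= => /negPf h; rewrite ipv h mul0r.
Qed.

Variables (I I0 : set A).
Hypotheses (cI : closed_ideal I) (cI0 : closed_ideal I0) (Iq : I q).
Hypotheses (I0I : I0 `&` I = [set 0]) (IJ : I `<=` Jq q).
Hypothesis dec : forall x, exists x0 x1 : A, [/\ I0 x0, I x1 & x = x0 + x1].

Lemma summand_ann x u : I0 x -> I u -> x ** u = 0.
Proof.
move=> I0x Iu; have : (I0 `&` I) (x ** u).
  by split; [exact: (idealMr cI0.1) | exact: (idealMl cI.1)].
by rewrite I0I.
Qed.

Lemma Aq_I u : Aq q u -> I u.
Proof. by move=> <-; exact: (idealMl cI.1). Qed.

Lemma pedersen_split x : K x -> exists x0 y, [/\ I0 x0, Fin q y & x = x0 + y].
Proof.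
have idF := Fin_ideal q.
move=> Kx; apply: (Kx [set x | exists x0 y, [/\ I0 x0, Fin q y & x = x0 + y]]).
split; first split.
- by exists 0, 0; split; [exact: (ideal0 cI0.1) | exact: (ideal0 idF) | rewrite addr0].
- move=> a y z [y0 [y1 [h1 h2 ->]]] [z0 [z1 [h3 h4 ->]]].
  exists (a *: y0 + z0), (a *: y1 + z1); split; last by rewrite scalerDr addrACA.
    by apply: (idealD cI0.1) => //; exact: (idealZ cI0.1).
  by apply: (idealD idF) => //; exact: (idealZ idF).
- move=> y z [z0 [z1 [h1 h2 ->]]]; exists (y ** z0), (y ** z1).
  by split; [exact: (idealMl cI0.1) | exact: (idealMl idF) | rewrite cmulDr].
- move=> y z [z0 [z1 [h1 h2 ->]]]; exists (z0 ** z), (z1 ** z).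
  by split; [exact: (idealMr cI0.1) | exact: (idealMr idF) | rewrite cmulDl].
apply/denseP => y e e0; have [y0 [y1 [h1 h2 ->]]] := dec y.
have /closureP/(_ e e0)[z [Fz yz]] := IJ h2.
exists (y0 + z); split; first by exists y0, z.
by rewrite opprD addrACA subrr add0r.
Qed.

Lemma unbounded_centralizer (f : A -> R[i]) :
  (forall a x y, f (a *: x + y) = a * f x + f y) ->
  (forall M : R, exists2 u, Aq q u & M * nrm u < cabs (f u)) ->
  exists T, left_centralizer K T /\ ~ locally_bounded T.
Proof.
move=> fL fU; have idF := Fin_ideal q.
have f0 : f 0 = 0.
  have := fL 1 0 0; rewrite scaler0 addr0 mul1r => /eqP.
  by rewrite addrC -subr_eq subrr eq_sym => /eqP.
have fZ a x : f (a *: x) = a * f x by have := fL a x 0; rewrite !addr0 f0 addr0.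
pose img x t := Fin q t /\ forall u, Aq q u -> t ** u = f (x ** u) *: q.
have img_ex x : K x -> exists t, img x t.
  move=> /pedersen_split[x0 [y [h0 Fy ex]]].
  have {}ex u : Aq q u -> x ** u = y ** u.
    by move=> Au; rewrite ex cmulDl (summand_ann h0 (Aq_I Au)) add0r.
  suff [t [Ft ht]] : exists t, img y t.
    by exists t; split => // u Au; rewrite ht // ex.
  apply: (Fy [set y | exists t, img y t]) => /= [|a z w [t [Ft ht]] [s [Fs hs]]|u v Au Av].
  - exists 0; split=> [|u Au]; first exact: (ideal0 idF).
    by rewrite !cmul0x f0 scale0r.
  - exists (a *: t + s); split=> [|u Au].
      by apply: (idealD idF) => //; exact: (idealZ idF).
    by rewrite !cmulDl !cmulZl fL scalerDl ht // hs // scalerA.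
  - exists (f u *: (q ** v^#)); split=> [|w Aw].
      by apply: (idealZ idF); apply: Fin_uv => //; exact: (Aq_q mq).
    rewrite -cmulA cmulZl -!cmulA (ipE mq) // !cmulZr qq Au fZ scalerA.
    by rewrite mulrC.
have img_uniq x t s : img x t -> img x s -> t = s.
  move=> [Ft ht] [Fs hs]; apply/subr0_eq; apply: (@Jq_faithful _ _ q).
    by apply: Fin_Jq; exact: (idealB idF).
  by move=> u Au; rewrite cmulBl ht // hs // subrr.
pose T x := xget 0 (img x).
have TP x : K x -> img x (T x).
  by move=> /img_ex[t it]; rewrite /T; case: xgetP => [_ -> //|/(_ t)].
have idK := pedersen_two_sided A.
exists T; split.
  split=> [x /TP[Fx _]|a x y Kx Ky|x b Kx Kb].
  - exact: (Fin_pedersen mq).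
  - have [Ft ht] := TP _ Kx; have [Fs hs] := TP _ Ky.
    have Kxy : K (a *: x + y) by apply: (idealD idK) => //; exact: (idealZ idK).
    apply: (img_uniq _ _ _ (TP _ Kxy)); split=> [|u Au].
      by apply: (idealD idF) => //; exact: (idealZ idF).
    by rewrite !cmulDl !cmulZl fL scalerDl ht // hs // scalerA.
  - have [Ft ht] := TP _ Kx.
    apply: (img_uniq _ _ _ (TP _ (idealMr idK _ Kx))); split=> [|u Au].
      exact: (idealMr idF).
    by rewrite -cmulA ht ?cmulA //; exact: AqM.
move=> [J [Ij [cIj dIj bIj]]].
have [j Ijq] : exists j, Ij j q.
  apply: contrapT => nj.
  have Iq0 j x : Ij j x -> x ** q = 0.
    move=> Ix; apply: contrapT => xq0; apply: nj; exists j.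
    have Axq := Aq_self mq x; have idj := (cIj j).1.
    have : Ij j ((x ** q)^# ** (x ** q)).
      by apply: (idealMl idj); exact: (idealMr idj).
    rewrite (ipE mq) // (ip_self mq) // => /(idealZ idj ((nrm (x ** q) ^- 2)%:C)).
    rewrite scalerA -rmorphM /= mulVf ?scale1r // expf_neq0 //.
    by rewrite gt_eqF // nrm_gt0.
  have : Aq_ann q q.
    have [] := left_annihilator_subalgebra [set q].
    move=> _ _ _ /closedP cl; move=> u Au; rewrite -Au.
    suff qq0 : q ** q = 0 by case: mq => _ _; rewrite -qq qq0.
    apply: (cl q _ q) => // e e0.
    have /closureP/(_ e e0)[y [[s [g [gj ->]]] qy]] : closure (ideal_sum Ij) q by rewrite dIj.
    exists (\sum_(j <- s) g j); split=> // l ->.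
    by rewrite cmul_suml big1 // => i _; exact: Iq0 (gj i).
  by move=> /(_ q qq); rewrite qq; case: mq.
have [M hM] := bIj j.
have [u Au fu] := fU M.
have Ku : K u := Aq_pedersen Au.
have [FT hT] := TP _ Ku.
have : nrm (T u) <= M * nrm u.
  have := hM u; rewrite -nrm_le rmorphM /= -nrmE; apply; split=> //.
  by rewrite -Au; exact: (idealMl (cIj j).1).
have := nrmM (T u) q; rewrite hT // (nrm_q mq) mulr1 nrmZ (nrm_q mq) mulr1 Au.
lra.
Qed.

Lemma ortho_seq_centralizer (v : nat -> A) : (forall n, Aq q (v n)) ->
  (forall i j, (v i)^# ** v j = if i == j then q else 0) ->
  exists T, left_centralizer K T /\ ~ locally_bounded T.
Proof.
move=> Av ov; have [f [fL fv]] := unbounded_functional Av ov.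
apply: (unbounded_centralizer fL) => M.
exists (v (Num.trunc `|M|).+1) => //.
have -> : nrm (v (Num.trunc `|M|).+1) = 1.
  apply/eqP; rewrite -(@eqrXn2 _ 2) ?nrm_ge0 // expr1n -nrm_starM ov eqxx.
  by rewrite (nrm_q mq).
rewrite mulr1 fv /cabs normr_nat raddfMn /=.
by apply: le_lt_trans (ler_norm _) (truncnS_gt _).
Qed.

End UnboundedCentralizer.

(** * Compact operators on Hilbert spaces *)

Section TotallyBounded.
Variables (R : realType) (V : completeNormedModType R[i]).
Implicit Types (M N : set V) (x y u : V).

Definition tb M : Prop := forall e : R, 0 < e ->
  exists s : seq V, forall x, M x -> exists2 y, y \in s & nrm (x - y) < e.

Lemma precompact_tb M : precompact M -> tb M.
Proof.
rewrite precompactE compact_cover => cM e e0.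
have [||D _ Dc] := cM V (closure M) (fun y => [set x | nrm (y - x) < e]).
- move=> y _; rewrite [X in open X](_ : _ = ball y e%:C).
    exact: ball_open.
  by apply/seteqP; split => x /nrm_ball.
- by move=> x Mx; exists x => //=; rewrite subrr nrm0.
exists (finmap.enum_fset D) => x Mx; have [y Dy /= yx] := Dc x (subset_closure Mx).
by exists y => //; rewrite nrmB.
Qed.

Lemma tb_precompact M : tb M -> precompact M.
Proof.
move=> tM; rewrite precompactE compact_ultra => F UF FM.
have cF : cauchy F.
  apply/cauchyP => c /pos_complexP[e e0 ->].
  have [s hs] := tM (e / 2) (divr_gt0 e0 (ltr0Sn _ 1)).
  have : F [set x | exists2 y, y \in s & nrm (x - y) < e].
    apply: filterS FM => x /closureP/(_ (e / 2) (divr_gt0 e0 (ltr0Sn _ 1)))[z [Mz xz]].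
    have [y ys zy] := hs z Mz; exists y => //.
    by apply: le_lt_trans (nrm_tri z _ _) _; lra.
  elim: s {hs} => [|y s IH] Fs.
    have : F set0 by apply: filterS Fs => x [].
    by move=> /filter_ex[].
  have [Fy|Fy] := in_ultra_setVsetC [set x | nrm (y - x) < e] UF.
    by exists y; apply: filterS Fy => x /nrm_ball.
  apply: IH; apply: filterS (filterI Fs Fy) => x [[z zs xz] nx].
  move: zs; rewrite inE => /orP[/eqP ez|zs]; last by exists z.
  by exfalso; apply: nx; rewrite /= nrmB -ez.
have /cauchy_cvgP/cvg_ex[/= p Fp] := cF.
exists p; split => //; apply: closed_closure => B /Fp FB.
have FMB : F (closure M `&` B) by apply: filterI.
by have /filter_ex[x [/= Mx Bx]] := FMB; exists x.
Qed.

Lemma tb_approx M : (forall e : R, 0 < e -> exists2 N, tb N &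
  forall x, M x -> exists2 y, N y & nrm (x - y) < e) -> tb M.
Proof.
move=> h e e0; have e20 : 0 < e / 2 by rewrite divr_gt0.
have [N tN MN] := h _ e20; have [s hs] := tN _ e20.
exists s => x /MN[y /hs[z zs yz] xy]; exists z => //.
by apply: le_lt_trans (nrm_tri y _ _) _; lra.
Qed.

Lemma tb_lin (a : R[i]) M N : tb M -> tb N ->
  tb [set z | exists x y, [/\ M x, N y & z = a *: x + y]].
Proof.
move=> tM tN e e0; have c0 := cabs_ge0 a; have c1 : 0 < cabs a + 1 by lra.
have e20 : 0 < e / 2 by rewrite divr_gt0.
have [s hs] := tM (e / 2 / (cabs a + 1)) (divr_gt0 e20 c1).
have [t ht] := tN (e / 2) e20.
exists [seq a *: x + y | x <- s, y <- t] => _ [x [y [Mx Ny ->]]].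
have [x' x's xx] := hs x Mx; have [y' y't yy] := ht y Ny.
exists (a *: x' + y'); first by apply/allpairsP; exists (x', y').
rewrite opprD addrACA -scalerBr; apply: le_lt_trans (nrmD _ _) _; rewrite nrmZ.
rewrite ltr_pdivlMr // in xx; have := nrm_ge0 (x - x'); nra.
Qed.

Lemma tb_sub M N : M `<=` N -> tb N -> tb M.
Proof. by move=> MN tN e /tN[s hs]; exists s => x /MN /hs. Qed.

Lemma real_net (C e : R) : 0 < e ->
  exists s : seq R, forall a, `|a| <= C -> exists2 b, b \in s & `|a - b| <= e.
Proof.
move=> e0; pose n := (Num.trunc (2 * C / e)).+1.
exists [seq k%:R * e - C | k <- iota 0 n] => a; rewrite ler_norml => /andP[a1 a2].
have ac : 0 <= (a + C) / e by rewrite divr_ge0 ?(ltW e0) //; lra.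
exists ((Num.trunc ((a + C) / e))%:R * e - C).
  apply/mapP; exists (Num.trunc ((a + C) / e)) => //.
  rewrite mem_iota /= add0n ltnS; apply: le_truncn.
  by rewrite ler_pM2r ?invr_gt0 //; lra.
have /andP[] := truncn_itv ac; move: (Num.trunc _) => k.
rewrite ler_pdivlMr // ltr_pdivrMr // -natr1 mulrDl mul1r => h1 h2.
by rewrite ler_norml; apply/andP; split; lra.
Qed.

Lemma cabs_Re (c : R[i]) : `|complex.Re c| <= cabs c.
Proof.
rewrite /cabs normc_def /= -sqrtr_sqr ler_wsqrtr // lerDl.
exact: sqr_ge0.
Qed.

Lemma cabs_Im (c : R[i]) : `|complex.Im c| <= cabs c.
Proof.
rewrite /cabs normc_def /= -sqrtr_sqr ler_wsqrtr // lerDr.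
exact: sqr_ge0.
Qed.

Lemma tb_line (C : R) u : tb [set x | exists2 c : R[i], cabs c <= C & x = c *: u].
Proof.
move=> e e0; have u0 := nrm_ge0 u; have u1 : 0 < 2 * nrm u + 1 by lra.
have [s hs] := real_net C (divr_gt0 e0 u1).
exists [seq (a%:C + iu * b%:C) *: u | a <- s, b <- s] => _ [c cC ->].
have [a' as' ha] := hs _ (le_trans (cabs_Re c) cC).
have [b' bs' hb] := hs _ (le_trans (cabs_Im c) cC).
exists ((a'%:C + iu * b'%:C) *: u); first by apply/allpairsP; exists (a', b').
rewrite -scalerBl (complexE c).
have -> : (complex.Re c)%:C + 'i%C * (complex.Im c)%:C - (a'%:C + iu * b'%:C)
    = (complex.Re c - a')%:C + iu * (complex.Im c - b')%:C :> R[i].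
  by rewrite opprD addrACA -mulrBr !rmorphB.
rewrite scalerDl -scalerA; apply: le_lt_trans (nrmD _ _) _.
rewrite (nrmZ iu) cabs_iu mul1r !nrmZr.
rewrite ler_pdivlMr // in ha; rewrite ler_pdivlMr // in hb.
have := normr_ge0 (complex.Re c - a'); have := normr_ge0 (complex.Im c - b').
nra.
Qed.

End TotallyBounded.

Section Hilbert.
Variables (R : realType) (H : hilbertType R).
Implicit Types (u v w x y : H) (a c : R[i]).
Local Notation inn := (@inner R H).

Lemma innPl a u v w : inn (a *: u + v) w = a * inn u w + inn v w.
Proof. by rewrite linearPl. Qed.
Lemma innDl u v w : inn (u + v) w = inn u w + inn v w.
Proof. by rewrite linearDl. Qed.
Lemma innBl u v w : inn (u - v) w = inn u w - inn v w.
Proof. by rewrite linearBl. Qed.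
Lemma innZl a u w : inn (a *: u) w = a * inn u w.
Proof. by rewrite linearZl_LR. Qed.
Lemma innC u v : inn u v = Num.conj (inn v u).
Proof. by rewrite hermC /= expr0 mul1r. Qed.
Lemma inn0l v : inn 0 v = 0. Proof. exact: linear0l. Qed.
Lemma innDr u v w : inn w (u + v) = inn w u + inn w v.
Proof. by rewrite innC innDl rmorphD /= (innC w u) (innC w v). Qed.
Lemma innBr u v w : inn w (u - v) = inn w u - inn w v.
Proof. by rewrite innC innBl rmorphB /= (innC w u) (innC w v). Qed.
Lemma innZr a u w : inn w (a *: u) = Num.conj a * inn w u.
Proof. by rewrite innC innZl rmorphM /= (innC w u). Qed.
Lemma inn_suml (I : Type) (s : seq I) (f : I -> H) w :
  inn (\sum_(i <- s) f i) w = \sum_(i <- s) inn (f i) w.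
Proof.
elim: s => [|i s IH]; first by rewrite !big_nil inn0l.
by rewrite !big_cons innDl IH.
Qed.

Lemma inn_self u : inn u u = (nrm u ^+ 2)%:C.
Proof. by rewrite inner_norm nrmE rmorphXn. Qed.

Lemma inn_inj u v : (forall w, inn w u = inn w v) -> u = v.
Proof.
move=> h; apply/subr0_eq/nrm0_eq0/eqP; rewrite -sqrf_eq0; apply/eqP/complexI.
by rewrite -inn_self innBr h subrr.
Qed.

Lemma cabs_sqr c : (cabs c ^+ 2)%:C = c * Num.conj c.
Proof. by rewrite rmorphXn /= -cabsE normCK. Qed.

Lemma nsq_sub_line u v : v <> 0 ->
  nrm (u - (inn u v / (nrm v ^+ 2)%:C) *: v) ^+ 2
    = nrm u ^+ 2 - cabs (inn u v) ^+ 2 / nrm v ^+ 2.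
Proof.
move=> v0; have n0 : nrm v ^+ 2 != 0 by rewrite expf_neq0 // gt_eqF // nrm_gt0.
have nC : (nrm v ^+ 2)%:C != 0 :> R[i] by rewrite -(rmorph0 (real_complex R)) (inj_eq (@complexI R)).
apply: complexI; rewrite -(inn_self (u - _)) rmorphB fmorph_div /= cabs_sqr.
rewrite innBl !innBr !innZl !innZr !inn_self (innC v u).
have -> : Num.conj (inn u v / (nrm v ^+ 2)%:C) = Num.conj (inn u v) / (nrm v ^+ 2)%:C.
  by rewrite [LHS]rmorphM /= fmorphV /= conjR.
by rewrite divfK // subrr subr0; congr (_ - _); rewrite mulrC mulrA.
Qed.

Lemma cauchy_schwarz u v : cabs (inn u v) <= nrm u * nrm v.
Proof.
have [->|/eqP v0] := eqVneq v 0.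
  by rewrite innC inn0l rmorph0 /cabs normr0 nrm0 mulr0.
have n0 := nrm_gt0 v0.
rewrite -(@ler_pXn2r _ 2) ?nnegrE ?mulr_ge0 ?nrm_ge0 ?cabs_ge0 // exprMn.
rewrite -ler_pdivrMr ?exprn_gt0 // -subr_ge0 -nsq_sub_line //.
exact: sqr_ge0.
Qed.

Definition onb (s : seq H) : Prop :=
  uniq s /\ forall v w, v \in s -> w \in s -> inn v w = (v == w)%:R.

Definition hproj (s : seq H) y : H := \sum_(v <- s) inn y v *: v.

Lemma hproj_inn s y w : onb s -> w \in s -> inn (hproj s y) w = inn y w.
Proof.
move=> [us os] ws; rewrite /hproj inn_suml (bigD1_seq w) //= innZl (os w w ws ws) eqxx mulr1.
rewrite big_seq_cond big1 ?addr0 // => v /andP[vs vw].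
by rewrite innZl (os v w vs ws) (negPf vw) mulr0.
Qed.

Lemma hprojB s y z : hproj s (y - z) = hproj s y - hproj s z.
Proof.
rewrite /hproj -sumrB; apply: eq_bigr => v _.
by rewrite innBl scalerBl.
Qed.

Lemma hproj_orth s y z : onb s -> inn (y - hproj s y) (hproj s z) = 0.
Proof.
move=> os; rewrite innC [hproj s z]/hproj inn_suml big_seq big1 ?rmorph0 // => v vs.
by rewrite innZl (innC v) innBl hproj_inn // subrr rmorph0 mulr0.
Qed.

Lemma nrm_sub_hproj s y : onb s -> nrm (y - hproj s y) <= nrm y.
Proof.
move=> os; rewrite -(@ler_pXn2r _ 2) ?nnegrE ?nrm_ge0 // -lecR -!inn_self.
have := hproj_orth y y os; set p := hproj s y => o.
rewrite -{3 4}(subrK p y); move: (y - p) o => w o.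
by rewrite innDl !innDr o (innC p w) o rmorph0 addr0 add0r lerDl inn_self ler0c sqr_ge0.
Qed.

Lemma gram_schmidt (L : seq H) : exists2 s, onb s & forall y, y \in L -> hproj s y = y.
Proof.
elim: L => [|y L [s os hs]]; first by exists [::] => //; split.
have [w0|/eqP w0] := eqVneq (y - hproj s y) 0.
  exists s => // z; rewrite inE => /orP[/eqP->|/hs//].
  by apply/esym/subr0_eq.
set w := y - hproj s y in w0; have n0 := nrm_gt0 w0.
pose v := (nrm w)^-1%:C *: w.
have wv x : x \in s -> inn x v = 0.
  move=> xs; rewrite innZr (_ : inn x w = 0) ?mulr0 //.
  by rewrite innC innBl hproj_inn // subrr rmorph0.
have vv : inn v v = 1.
  rewrite inn_self nrmZp ?invr_ge0 ?nrm_ge0 // mulVf ?gt_eqF //.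
  by rewrite expr1n.
have vs : v \notin s.
  by apply/negP => /wv; rewrite vv => /eqP; rewrite oner_eq0.
have ov : onb (v :: s).
  split=> [|x z]; first by rewrite /= vs os.1.
  rewrite !inE => /orP[/eqP->|xs] /orP[/eqP->|zs].
  - by rewrite eqxx vv.
  - rewrite innC wv // rmorph0; case: eqP => // e.
    by rewrite -e (negPf vs) in zs.
  - rewrite wv //; case: eqP => // e.
    by rewrite e (negPf vs) in xs.
  - exact: os.2.
exists (v :: s) => // z; rewrite inE => /orP[/eqP->|zL].
  have yw : inn y v *: v = w.
    rewrite (_ : inn y v = inn w v); last first.
      rewrite /w innBl [inn (hproj s y) v]inn_suml big_seq big1 ?subr0 // => x xs.
      by rewrite innZl wv // mulr0.
    rewrite /v innZr conjR inn_self scalerA -!rmorphM /=.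
    rewrite (_ : _ * _ = 1) ?scale1r //.
    by field; rewrite gt_eqF.
  by rewrite /hproj big_cons yw -/(hproj s y) subrK.
rewrite /hproj big_cons -/(hproj s z) hs //.
rewrite (_ : inn z v = 0) ?scale0r ?add0r // -(hs z zL) inn_suml big_seq big1 // => x xs.
by rewrite innZl wv // mulr0.
Qed.

Section CompactOperator.
Variable T : H -> H.
Hypothesis cT : compact_operator T.

Lemma compact_lin a u v : T (a *: u + v) = a *: T u + T v. Proof. exact: cT.1. Qed.
Lemma compact0 : T 0 = 0.
Proof. by have := compact_lin (-1) 0 0; rewrite scaleN1r addNr scaleN1r addNr. Qed.
Lemma compactZ a u : T (a *: u) = a *: T u.
Proof. by have := compact_lin a u 0; rewrite !addr0 compact0 addr0. Qed.

Lemma nrm_scale_ball (f : H -> H) C : (forall a u, f (a *: u) = a *: f u) ->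
  (forall u, nrm u <= 1 -> nrm (f u) <= C) -> forall u, nrm (f u) <= C * nrm u.
Proof.
move=> fZ h u; have [->|/eqP u0] := eqVneq u 0.
  by have := fZ 0 0; rewrite !scale0r => ->; rewrite nrm0 mulr0.
have n0 := nrm_gt0 u0.
have := h ((nrm u)^-1%:C *: u); rewrite fZ !nrmZp ?invr_ge0 ?nrm_ge0 //.
by rewrite mulVf ?gt_eqF // => /(_ (lexx _)); rewrite mulrC ler_pdivrMr.
Qed.

Lemma compact_net e : 0 < e -> exists L : seq H,
  forall u, nrm u <= 1 -> exists2 y, y \in L & nrm (T u - y) < e.
Proof.
move=> e0; have [L hL] := precompact_tb cT.2 e0.
exists L => u u1; apply: hL; exists u => //=.
by rewrite nrm_le.
Qed.

Lemma compact_approx e : 0 < e -> exists2 s, onb s &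
  forall u, nrm (T u - hproj s (T u)) <= e * nrm u.
Proof.
move=> e0; have [L hL] := compact_net e0.
have [s os hs] := gram_schmidt L; exists s => //.
apply: nrm_scale_ball => [a u|u u1].
  rewrite compactZ scalerBr; congr (_ - _).
  by rewrite /hproj scaler_sumr; apply: eq_bigr => v _; rewrite innZl scalerA.
have [y yL Ty] := hL u u1.
have -> : T u - hproj s (T u) = (T u - y) - hproj s (T u - y).
  by rewrite hprojB (hs y yL) opprB addrA subrK.
exact: le_trans (nrm_sub_hproj _ os) (ltW Ty).
Qed.

Lemma compact_bounded : exists C, forall u, nrm (T u) <= C * nrm u.
Proof.
have [L hL] := compact_net ltr01.
exists (1 + \sum_(y <- L) nrm y); apply: nrm_scale_ball; first exact: compactZ.
move=> u u1; have [y yL Ty] := hL u u1.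
have := nrmDr (T u - y) y.
have : nrm y <= \sum_(z <- L) nrm z.
  rewrite (big_rem y) //= lerDl sumr_ge0 // => z _; exact: nrm_ge0.
have := nrmD (T u - y) y; rewrite subrK; lra.
Qed.

End CompactOperator.

Lemma rank_one_compact u v : compact_operator (fun w => inn w v *: u).
Proof.
split=> [a x y|]; first by rewrite innPl scalerDl scalerA.
apply: tb_precompact; apply: tb_sub (tb_line (nrm v) u) => _ [w /= w1 <-].
exists (inn w v) => //; apply: le_trans (cauchy_schwarz _ _) _.
by rewrite ler_piMl ?nrm_ge0 // -nrm_le.
Qed.

Lemma parallelogram u v :
  nrm (u - v) ^+ 2 = 2 * nrm u ^+ 2 + 2 * nrm v ^+ 2 - nrm (u + v) ^+ 2.
Proof.
apply: complexI; rewrite rmorphB rmorphD /= (rmorphM _ 2) (rmorphM _ 2 (nrm v ^+ 2)) /=.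
rewrite -!inn_self rmorph_nat innBl !innBr innDl !innDr; ring.
Qed.

Lemma riesz (f : H -> R[i]) (C : R) : (forall a u v, f (a *: u + v) = a * f u + f v) ->
  (forall u, cabs (f u) <= C * nrm u) -> exists w, forall u, f u = inn u w.
Proof.
move=> fL fC.
have f0 : f 0 = 0.
  by have := fL (-1) 0 0; rewrite scaleN1r addNr mulN1r addNr.
have fZ a u : f (a *: u) = a * f u by have := fL a u 0; rewrite !addr0 f0 addr0.
have fB u v : f (u - v) = f u - f v.
  by have := fL (-1) v u; rewrite scaleN1r mulN1r addrC => ->; rewrite addrC.
have [fz|/existsNP[u0 /eqP fu0]] := pselect (forall u, f u = 0).
  by exists 0 => u; rewrite fz innC inn0l rmorph0.
pose E : set R := [set nrm u ^+ 2 | u in [set u | f u = 1]].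
have E0 : E !=set0.
  exists (nrm ((f u0)^-1 *: u0) ^+ 2), ((f u0)^-1 *: u0) => //=.
  by rewrite fZ mulVf.
have lE : lbound E 0 by move=> _ [u _ <-]; exact: sqr_ge0.
have hE : has_inf E by split => //; exists 0.
pose d := inf E.
have dE u : f u = 1 -> d <= nrm u ^+ 2.
  by move=> fu; apply: ge_inf; [exists 0 | exists u].
have d0 : 0 <= d by apply: lb_le_inf.
have /choice[g hg] : forall n : nat, exists u, f u = 1 /\ nrm u ^+ 2 < d + 2^-1 ^+ n.
  move=> n; have [|_ [u fu <-] hu] := @inf_adherent _ E (2^-1 ^+ n) _ hE.
    by rewrite exprn_gt0 // invr_gt0.
  by exists u.
have gap u v (p : R) : f u = 1 -> f v = 1 -> nrm u ^+ 2 <= d + p ->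
    nrm v ^+ 2 <= d + p -> nrm (u - v) ^+ 2 <= 4 * p.
  move=> fu fv up vp; have h2 : (2^-1)%:C + (2^-1)%:C = 1 :> R[i].
    by rewrite -rmorphD /= (_ : 2^-1 + 2^-1 = 1) //; field.
  have := dE ((2^-1)%:C *: (u + v)).
  rewrite fZ -[u]scale1r fL fu fv mul1r mulrDr mulr1 h2 => /(_ erefl).
  rewrite scale1r nrmZp ?invr_ge0 // exprMn parallelogram.
  have -> : (2^-1 : R) ^+ 2 = 4^-1 by field.
  move=> h; have : d <= 4^-1 * nrm (u + v) ^+ 2 by [].
  lra.
have mono m n : (m <= n)%N -> (2^-1 : R) ^+ n <= 2^-1 ^+ m.
  by move=> mn; rewrite ler_wiXn2l // ?invr_ge0 // invf_le1 // ler1n.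
have [e e0|l hl] := nrm_complete (u := g).
  have [N hN] := geometric_small 4 (exprn_gt0 2 e0).
  exists N => m n Nm Nn; rewrite -(@ltr_pXn2r _ 2) ?nnegrE ?nrm_ge0 ?(ltW e0) //.
  apply: le_lt_trans (hN N (leqnn _)); apply: gap; rewrite ?(hg _).1 //.
    by apply: le_trans (ltW (hg m).2) _; rewrite lerD2l mono.
  by apply: le_trans (ltW (hg n).2) _; rewrite lerD2l mono.
have C1 : 0 < `|C| + 1 by have := normr_ge0 C; lra.
have fl : f l = 1.
  apply/subr0_eq/normr0_eq0; rewrite cabsE; congr _%:C.
  apply/le_anti; rewrite cabs_ge0 andbT; apply/ler_addgt0Pr => e e0; rewrite add0r.
  have [N hN] := hl (e / (`|C| + 1)) (divr_gt0 e0 C1).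
  have := hN N (leqnn _); rewrite ltr_pdivlMr // => h.
  have := fC (l - g N); rewrite fB (hg N).1; have := ler_norm C.
  have := nrm_ge0 (l - g N); nra.
have ld : nrm l ^+ 2 <= d.
  have nl := nrm_ge0 l.
  apply/ler_addgt0Pr => e e0.
  have e1 : 0 < Num.min 1 (e / (4 * nrm l + 4)).
    by rewrite lt_min ltr01 divr_gt0 //; lra.
  have [N hN] := hl _ e1.
  have [N' hN'] := geometric_small 1 (divr_gt0 e0 (ltr0Sn _ 1)).
  have := hN (maxn N N') (leq_maxl _ _); have := hN' (maxn N N') (leq_maxr _ _).
  set m := maxn N N'; rewrite mul1r lt_min => hm /andP[hm1].
  rewrite ltr_pdivlMr; last by lra.
  move=> hm2; have := (hg m).2; have := nrm_tri (g m) l 0; rewrite !subr0 => h1 h2.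
  have := nrm_ge0 (g m); have := nrm_ge0 (l - g m).
  move: (nrm l) (nrm (g m)) (nrm (l - g m)) nl h1 h2 hm2 => a b t a0 ab bd ta t0 b0.
  have [al|al] := leP t a; last by nra.
  have : (a - t) ^+ 2 <= b ^+ 2 by rewrite ler_pXn2r ?nnegrE //; lra.
  nra.
have l0 : l <> 0 by move=> l0; move: fl; rewrite l0 f0 => /esym/eqP; rewrite oner_eq0.
have orth v : f v = 0 -> inn v l = 0.
  move=> fv; have [->|/eqP v0] := eqVneq v 0; first exact: inn0l.
  have := nsq_sub_line l v0; set t := inn l v / _ => e.
  have := dE (l - t *: v); rewrite fB fZ fv mulr0 subr0 => /(_ fl); rewrite e => h.
  have nv : 0 < nrm v ^+ 2 by rewrite exprn_gt0 // nrm_gt0.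
  have : cabs (inn l v) ^+ 2 / nrm v ^+ 2 <= 0 by lra.
  rewrite ler_pdivrMr // mul0r => h0.
  have : cabs (inn l v) = 0 by apply/eqP; rewrite -sqrf_eq0; apply/eqP/le_anti; rewrite h0 sqr_ge0.
  move=> c0; rewrite innC (_ : inn l v = 0) ?rmorph0 //.
  by apply: normr0_eq0; rewrite cabsE c0.
have nl : 0 < nrm l ^+ 2 by rewrite exprn_gt0 // nrm_gt0.
exists ((nrm l ^+ 2)^-1%:C *: l) => u.
have : inn (u - f u *: l) l = 0 by apply: orth; rewrite fB fZ fl mulr1 subrr.
rewrite innBl innZl inn_self => /subr0_eq e.
by rewrite innZr conjR e mulrCA -rmorphM /= mulVf ?gt_eqF // mulr1.
Qed.

End Hilbert.

(** * Infinite-dimensional elementary summands *)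

Section ElementarySummand.
Variables (R : realType) (A : cstarAlgType R).
Implicit Types (x y z : A) (a c : R[i]).

Lemma summand_star (I I0 : set A) : closed_ideal I -> closed_ideal I0 ->
  I0 `&` I = [set 0] ->
  (forall x, exists x0 x1 : A, [/\ I0 x0, I x1 & x = x0 + x1]) ->
  forall x, I x -> I x^#.
Proof.
move=> [idI _] [id0 _] I0I dec x Ix.
have ann y z : I0 y -> I z -> y ** z = 0.
  move=> I0y Iz; have : (I0 `&` I) (y ** z).
    by split; [exact: (idealMr id0) | exact: (idealMl idI)].
  by rewrite I0I.
have [y [z [I0y Iz e]]] := dec x^#.
suff y0 : y = 0 by rewrite e y0 add0r.
apply: Mstar_eq0.
have yy : y ** y^# = - (z ** y^#).
  apply/eqP; rewrite -addr_eq0 -cmulDl -e -cstarM ann // cstar0 //.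
have : (I0 `&` I) (y ** y^#).
  split; first exact: (idealMr id0).
  by rewrite yy; apply: (idealN idI); exact: (idealMr idI).
by rewrite I0I.
Qed.

Section Iso.
Variables (I : set A) (H : hilbertType R) (phi : A -> H -> H).
Implicit Types (u v w : H).
Hypothesis cI : closed_ideal I.
Hypothesis starI : forall x, I x -> I x^#.
Hypothesis phi_bij : set_bij I [set T : H -> H | compact_operator T] phi.
Hypothesis phi_lin : forall a x y, I x -> I y ->
  forall u, phi (a *: x + y) u = a *: phi x u + phi y u.
Hypothesis phi_mul : forall x y, I x -> I y -> forall u, phi (cmul x y) u = phi x (phi y u).
Hypothesis phi_adj : forall x, I x ->
  forall u v, inner (phi x u) v = inner u (phi (cstar x) v).

Let idI := cI.1.

Lemma phi_compact x : I x -> compact_operator (phi x).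
Proof. by case: phi_bij => f _ _ Ix; exact: f. Qed.

Lemma phi_inj x y : I x -> I y -> (forall u, phi x u = phi y u) -> x = y.
Proof.
case: phi_bij => _ inj _ Ix Iy h; apply: inj; rewrite ?inE //.
by apply/funext.
Qed.

Lemma phi_surj (T : H -> H) : compact_operator T -> exists2 x, I x & phi x = T.
Proof. by case: phi_bij => _ _ surj cT; have [x Ix <-] := surj T cT; exists x. Qed.

Lemma phi0 u : phi 0 u = 0.
Proof.
have I0 := ideal0 idI; have := phi_lin (-1) I0 I0 u.
by rewrite scaler0 addr0 scaleN1r addNr.
Qed.

Lemma phiZ a x u : I x -> phi (a *: x) u = a *: phi x u.
Proof. by move=> Ix; have := phi_lin a Ix (ideal0 idI) u; rewrite !addr0 phi0 addr0. Qed.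

Lemma phiB x y u : I x -> I y -> phi (x - y) u = phi x u - phi y u.
Proof.
by move=> Ix Iy; rewrite addrC -scaleN1r phi_lin // scaleN1r addrC.
Qed.

Lemma phi_sum (J : Type) (s : seq J) (f : J -> A) u : (forall j, I (f j)) ->
  phi (\sum_(j <- s) f j) u = \sum_(j <- s) phi (f j) u.
Proof.
move=> If; elim: s => [|j s IH]; first by rewrite !big_nil phi0.
rewrite !big_cons -{1}[f j]scale1r phi_lin ?scale1r ?IH //.
by apply: (ideal_sum_mem idI).
Qed.

Lemma rank_one_ex u v : exists x, I x /\ forall w, phi x w = inner w v *: u.
Proof.
have [x Ix e] := phi_surj (rank_one_compact u v).
by exists x; split=> // w; rewrite e.
Qed.

Lemma rank_one_minproj v q : nrm v = 1 -> I q ->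
  (forall w, phi q w = inner w v *: v) -> minproj q.
Proof.
move=> v1 Iq hq; have vv : inner v v = 1 by rewrite inn_self v1 expr1n.
have Isq := starI Iq; split.
- apply: phi_inj => // u; apply: inn_inj => w.
  by rewrite -phi_adj // !hq innZl innZr mulrC (innC v u).
- by apply: phi_inj => // [|u]; [exact: (idealMl idI) | rewrite phi_mul // !hq innZl vv mulr1].
- move=> q0; have := hq v; rewrite q0 phi0 vv scale1r => v0.
  by move: v1; rewrite -v0 nrm0 => /esym/eqP; rewrite oner_eq0.
move=> x; exists (inner (phi (q ** x ** q) v) v).
have Iqx : I (q ** x) by exact: (idealMr idI).
have Iy : I (q ** x ** q) by exact: (idealMr idI).
apply: phi_inj => // [|u]; first exact: (idealZ idI).
rewrite phiZ // !(phi_mul Iqx Iq) !hq vv scale1r.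
set p := phi (q ** x) v.
have -> : phi (q ** x) (inner u v *: v) = inner u v *: p.
  exact: (compactZ (phi_compact Iqx)).
have -> : p = inner p v *: v.
  have e : q ** (q ** x) = q ** x.
    rewrite cmulA; congr (_ ** _).
    by apply: phi_inj => // [|w]; [exact: (idealMl idI) | rewrite phi_mul // !hq innZl vv mulr1].
  by rewrite /p -{1}e phi_mul // hq -/p.
by rewrite innZl vv mulr1 !scalerA mulrC.
Qed.

Section WithUnit.
Variables (v : H) (q : A).
Hypotheses (v1 : nrm v = 1) (Iq : I q) (hq : forall w, phi q w = inner w v *: v).
Let mq : minproj q := rank_one_minproj v1 Iq hq.
Let vv : inner v v = 1. Proof. by rewrite inn_self v1 expr1n. Qed.

Lemma Aq_mem_I x : Aq q x -> I x.
Proof. by move=> <-; exact: (idealMl idI). Qed.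

Lemma nrm_phi_Aq x : Aq q x -> nrm (phi x v) = nrm x.
Proof.
move=> Ax; have Ix := Aq_mem_I Ax; have Isx := starI Ix.
apply/eqP; rewrite -(@eqrXn2 _ 2) ?nrm_ge0 //; apply/eqP/complexI.
rewrite -inn_self -(ip_self mq Ax) phi_adj // -phi_mul // (ipE mq Ax Ax).
by rewrite phiZ // hq vv scale1r innZr vv mulr1 (ip_self mq Ax) conjR.
Qed.

Lemma Aq_rank_one u : exists x, [/\ Aq q x, phi x v = u & forall w, phi x w = inner w v *: u].
Proof.
have [x [Ix hx]] := rank_one_ex u v.
exists x; split=> //; last by rewrite hx vv scale1r.
apply: phi_inj => // [|w]; first exact: (idealMl idI).
by rewrite phi_mul // hq !hx innZl vv mulr1.
Qed.

Lemma phi_faithful x : I x -> Aq_ann q x -> x = 0.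
Proof.
move=> Ix xA; apply: phi_inj => // [|u]; first exact: (ideal0 idI).
have [y [Ay <- _]] := Aq_rank_one u.
have Iy := Aq_mem_I Ay.
by rewrite -phi_mul // xA // !phi0.
Qed.

Lemma elementary_Jq : I `<=` Jq q.
Proof.
move=> x Ix; apply/closureP => e e0; have idF := Fin_ideal q.
have e20 : 0 < e / 2 by rewrite divr_gt0.
have [s os hs] := compact_approx (phi_compact Ix) e20.
have /choice[f hf] := Aq_rank_one.
pose p := \sum_(u <- s) f u ** (f u)^#.
have Ap u : Aq q (f u) by case: (hf u).
have If u : I (f u) := Aq_mem_I (Ap u).
have Ifs u : I (f u ** (f u)^#) by exact: (idealMr idI).
have Fp : Fin q p.
  by rewrite /p; apply: (ideal_sum_mem idF) => u; exact: Fin_uv.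
have Ip : I p by exact: (ideal_sum_mem idI).
have php w : phi p w = hproj s w.
  rewrite /p phi_sum // /hproj; apply: eq_bigr => u _.
  have [_ fv fw] := hf u; have Isu := starI (If u).
  by rewrite phi_mul // fw phi_adj // cstarK fv.
exists (p ** x); split; first exact: (idealMr idF).
apply: le_lt_trans (_ : e / 2 < e); last by lra.
have Ipx : I (p ** x) by exact: (idealMl idI).
apply: (@nrm_le_Aq _ _ q _ _ _ cI) => [y|||y Ay]; [exact: phi_faithful | exact: (idealB idI) | exact: ltW |].
have Iy := Aq_mem_I Ay.
rewrite -!nrm_phi_Aq //; last exact: AqM.
rewrite phi_mul //; last exact: (idealB idI).
by rewrite phiB // phi_mul // php; exact: hs.
Qed.

Lemma elementary_ortho_seq : ~ finite_dimensional I ->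
  exists w : nat -> A, (forall n, Aq q (w n)) /\
     forall i j, (w i)^# ** w j = if i == j then q else 0.
Proof.
move=> nfd; have [[s [sA os hs]]|//] := @ortho_basis_or_seq _ _ q mq (Aq q) (fun _ h => h)
  (fun a x y => @Aq_lin _ _ q a x y) (Aq0 q).
exfalso; apply: nfd.
have Ip : I (sproj s).
  by apply: (Fin_sub idI Iq); exact: Fin_sproj.
have left_unit x : I x -> x = sproj s ** x.
  move=> Ix; apply/subr0_eq/phi_faithful.
    by apply: (idealB idI) => //; exact: (idealMl idI).
  by move=> u Au; rewrite cmulBl -cmulA hs ?subrr //; exact: AqM.
have right_unit x : I x -> x = x ** sproj s.
  move=> /starI/left_unit/(congr1 (@cstar _ _)).
  by rewrite cstarM !cstarK sproj_sa.
pose L := [seq (y, z) | y <- s, z <- s].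
exists (size L), (fun i => (nth (0, 0) L i).1 ** (nth (0, 0) L i).2^#); split=> [i|x Ix].
  have /allpairsP[[u w] [/= us ws ->]] : nth (0, 0) L i \in L by rewrite mem_nth.
  by apply: (idealMr idI); apply: Aq_mem_I; exact: sA.
exists (fun i => ip q (x ** (nth (0, 0) L i).2) (nth (0, 0) L i).1).
pose F (p : A * A) := ip q (x ** p.2) p.1 *: (p.1 ** p.2^#).
rewrite -(big_mkord xpredT (fun i => F (nth (0, 0) L i))) -(big_nth (0, 0) xpredT F).
rewrite big_allpairs {1}(left_unit x Ix) {1}(right_unit x Ix).
rewrite {1}/sproj cmul_suml !big_seq; apply: eq_bigr => u us.
rewrite /sproj !cmul_sumr !big_seq; apply: eq_bigr => w ws.
have [Au Aw] := (sA _ us, sA _ ws); rewrite /F /=.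
have -> : u ** u^# ** (x ** (w ** w^#)) = u ** (u^# ** (x ** w)) ** w^#.
  by rewrite !cmulA.
by rewrite (ipE mq) ?cmulZr ?Au ?cmulZl //; exact: AqM.
Qed.

End WithUnit.
End Iso.

Lemma elementary_minproj (I : set A) : direct_summand I -> elementary I ->
  ~ finite_dimensional I -> exists T,
    left_centralizer (@pedersen_ideal R A) T /\ ~ locally_bounded T.
Proof.
move=> [cI [I0 [cI0 I0I dec]]] [H [phi [bij lin mul adj]]] nfd.
have starI := summand_star cI cI0 I0I dec.
have [u u0] : exists u : H, u <> 0.
  apply: contrapT => nu; apply: nfd; exists 0%N, (fun _ => 0); split=> [[]//|x Ix].
  exists (fun _ => 0); rewrite big_ord0; apply: (phi_inj bij) => // [|u].
    exact: (ideal0 cI.1).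
  have z w : w = 0 :> H by apply: contrapT => w0; apply: nu; exists w.
  by rewrite [LHS]z [RHS]z.
pose v := (nrm u)^-1%:C *: u.
have v1 : nrm v = 1.
  by rewrite nrmZp ?invr_ge0 ?nrm_ge0 // mulVf // gt_eqF // nrm_gt0.
have [q [Iq hq]] := rank_one_ex bij v v.
have mq := rank_one_minproj cI starI bij lin mul adj v1 Iq hq.
have [w [Aw ow]] := elementary_ortho_seq cI starI bij lin mul adj v1 Iq hq nfd.
exact: (ortho_seq_centralizer mq cI cI0 Iq I0I
  (elementary_Jq cI starI bij lin mul adj v1 Iq hq) dec Aw ow).
Qed.

End ElementarySummand.

(** * Gliding humps *)

Section ExistsMinproj.
Variables (R : realType) (A : cstarAlgType R).
Implicit Types (x y z d e k : A) (r t : R).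

Lemma cpos_multiples_eq0 z k : cpos k -> (forall n : nat, cpos (z - n%:R%:C *: k)) -> k = 0.
Proof.
move=> pk h; apply: cpos_antisym => //; apply: cpos_lim => e e0.
have z1 : 0 < nrm z + 1 by have := nrm_ge0 z; lra.
pose n := (Num.trunc ((nrm z + 1) / e)).+1.
have n0 : (0 : R) < n%:R by [].
exists ((n%:R^-1)%:C *: (z - n%:R%:C *: k)); split.
  by apply: cposZ => //; rewrite invr_ge0 ltW.
rewrite scalerBr scalerA -rmorphM /= mulVf ?gt_eqF // scale1r opprB addKr.
rewrite nrmN nrmZp ?invr_ge0 ?(ltW n0) // mulrC ltr_pdivrMr //.
have : (nrm z + 1) / e < n%:R by exact: truncnS_gt.
rewrite ltr_pdivrMr //; lra.
Qed.

Lemma cpos_comparable_line k0 k : cpos k0 -> k0 <> 0 ->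
  (forall t, cpos (k - t%:C *: k0) \/ cpos (- (k - t%:C *: k0))) ->
  exists t, k = t%:C *: k0.
Proof.
move=> p0 k00 cmp; pose E : set R := [set t | cpos (k - t%:C *: k0)].
have down t t' : t' <= t -> E t -> E t'.
  rewrite /E /= => tt' h; have -> : k - t'%:C *: k0 = (k - t%:C *: k0) + (t - t')%:C *: k0.
    by rewrite rmorphB scalerBl addrA subrK.
  by apply: cposD => //; apply: cposZ => //; rewrite subr_ge0.
have E0 : E !=set0.
  apply: contrapT => nE; apply: k00; apply: (@cpos_multiples_eq0 (- k)) => // n.
  have [h|] := cmp (- n%:R); first by exfalso; apply: nE; exists (- n%:R).
  by rewrite rmorphN scaleNr opprK opprD.
have [u nu] : exists u, ~ E u.
  apply: contrapT => nE; apply: k00; apply: (@cpos_multiples_eq0 k) => // n.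
  by apply: contrapT => h; apply: nE; exists n%:R.
have ubE : ubound E u.
  move=> t Et; have [//|ut] := leP t u; exfalso; apply: nu.
  exact: down (ltW ut) Et.
have hE : has_sup E by split => //; exists u.
exists (sup E); apply/subr0_eq.
have n1 : 0 < nrm k0 + 1 by have := nrm_ge0 k0; lra.
have near t (e : R) : `|sup E - t| < e / (nrm k0 + 1) ->
    nrm ((k - (sup E)%:C *: k0) - (k - t%:C *: k0)) < e.
  rewrite ltr_pdivlMr // => h.
  rewrite opprB addrC addrA subrK -opprB nrmN -scalerBl -rmorphB nrmZr.
  by have := nrm_ge0 k0; have := normr_ge0 (sup E - t); nra.
apply: cpos_antisym; apply: cpos_lim => e e0.
  have e1 : 0 < e / (nrm k0 + 1) by exact: divr_gt0.
  have [t Et lt] := sup_adherent e1 hE.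
  exists (k - t%:C *: k0); split => //; apply: near.
  have ts : t <= sup E by apply: ub_le_sup => //; exists u.
  by rewrite ger0_norm ?subr_ge0 // ltrBlDr addrC -ltrBlDr.
have e1 : 0 < e / (nrm k0 + 1) / 2 by rewrite !divr_gt0.
pose t := sup E + e / (nrm k0 + 1) / 2.
exists (- (k - t%:C *: k0)); split.
  have [h|//] := cmp t; exfalso.
  have : t <= sup E by apply: ub_le_sup => //; exists u.
  by rewrite /t gerDl leNgt e1.
rewrite -opprD nrmN; apply: near.
by rewrite /t opprD addrA subrr add0r normrN ger0_norm ?(ltW e1) //; lra.
Qed.

Lemma sa_comparable e k : e^# = e ->
  (forall x y, let f := e ** x ** e in let g := e ** y ** e in
     f^# = f -> g^# = g -> f ** g = 0 -> f = 0 \/ g = 0) ->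
  k^# = k -> (exists x, k = e ** x ** e) -> cpos k \/ cpos (- k).
Proof.
move=> se orth sk [x ek]; have [a [b [[Za Zb pa pb] [eab ab ba]]]] := cpos_parts sk.
have [sa sb] := (cpos_sa pa, cpos_sa pb).
have ka : k ** a ** k = a ** a ** a.
  rewrite eab cmulBl ba subr0 cmulBr -(cmulA a a b) ab cmulx0 subr0 //.
have kb : k ** b ** k = b ** b ** b.
  rewrite eab cmulBl ab sub0r cmulNx cmulBr -(cmulA b b a) ba cmulx0 sub0r opprK //.
have eka z : k ** z ** k = e ** (x ** e ** z ** e ** x) ** e.
  by rewrite ek !cmulA.
have := orth (x ** e ** a ** e ** x) (x ** e ** b ** e ** x).
rewrite /= -!eka ka kb => h.
have [|||a0|b0] := h.
- by rewrite !cstarM sa cmulA.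
- by rewrite !cstarM sb cmulA.
- by rewrite -cmulA (cmulA a (b ** b)) (cmulA a b) ab !cmul0x !cmulx0.
- by right; rewrite eab (sa_cube_eq0 sa a0) sub0r opprK.
- by left; rewrite eab (sa_cube_eq0 sb b0) subr0.
Qed.

Lemma exists_minproj (D : set A) : (forall d x e, D d -> D e -> D (d ** x ** e)) ->
  (exists d, [/\ D d, d^# = d & d <> 0]) ->
  ~ (exists d : nat -> A, (forall n, [/\ D (d n), (d n)^# = d n & d n <> 0]) /\
       forall i j, i != j -> d i ** d j = 0) ->
  exists q, D q /\ minproj q.
Proof.
move=> hD [d0 gd0] noseq; pose good d := [/\ D d, d^# = d & d <> 0].
pose split_ e f g := [/\ (exists x, f = e ** x ** e) /\ (exists x, g = e ** x ** e),
  f^# = f /\ g^# = g, f <> 0 /\ g <> 0 & f ** g = 0].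
have [e [[De se e0] he]] : exists e, good e /\ forall f g, ~ split_ e f g.
  apply: contrapT => ne; apply: noseq.
  have /choice[F hF] : forall e, exists p : A * A, good e -> split_ e p.1 p.2.
    move=> e; have [ge|nge] := pselect (good e); last by exists (0, 0).
    apply: contrapT => nn; apply: ne; exists e; split => // f g fg.
    by apply: nn; exists (f, g).
  pose E := fix E n := if n is n'.+1 then (F (E n')).2 else d0.
  have gE n : good (E n).
    elim: n => [//|n IH]; have [[_ [x ex]] [_ sg] [_ g0] _] := hF _ IH.
    by case: (IH) => DE _ _; split=> //=; rewrite ex; exact: hD.
  have sF n := hF _ (gE n).
  have dE i n : (F (E i)).1 ** E (i.+1 + n)%N = 0.
    elim: n => [|n IH]; first by rewrite addn0; case: (sF i).
    rewrite addnS /=; have [[_ [x ->]] _ _ _] := sF (i.+1 + n)%N.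
    by rewrite !cmulA IH !cmul0x.
  have dd i j : (i < j)%N -> (F (E i)).1 ** (F (E j)).1 = 0.
    move=> ij; have [[[x ->] _] _ _ _] := sF j.
    by have := dE i (j - i.+1)%N; rewrite subnKC // !cmulA => ->; rewrite !cmul0x.
  exists (fun n => (F (E n)).1); split=> [n|i j].
    have [[[x ex] _] [sf _] [f0 _] _] := sF n; split=> //.
    by rewrite ex; apply: hD; case: (gE n).
  rewrite neq_ltn => /orP[/dd//|/dd ji].
  have [_ [si _] _ _] := sF i; have [_ [sj _] _ _] := sF j.
  by rewrite -si -sj -cstarM ji cstar0.
pose k0 := e ** (e ** e) ** e.
have k0e : k0 = (e ** e) ** (e ** e) by rewrite /k0 !cmulA.
have see : (e ** e)^# = e ** e by rewrite cstarM se.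
have pk0 : cpos k0 by rewrite k0e; exact: cpos_sqr.
have sk0 := cpos_sa pk0.
have k00 : k0 <> 0.
  by rewrite k0e => /(sa_sqr_eq0 see) /(sa_sqr_eq0 se).
have orth x y : let f := e ** x ** e in let g := e ** y ** e in
     f^# = f -> g^# = g -> f ** g = 0 -> f = 0 \/ g = 0.
  move=> f g sf sg fg; apply: contrapT => /not_orP[f0 g0]; apply: (he f g).
  by split=> //; split; [exists x | exists y].
have line x : (e ** x ** e)^# = e ** x ** e -> exists t, e ** x ** e = t%:C *: k0.
  move=> sx; apply: cpos_comparable_line => // t.
  apply: (sa_comparable se orth); first by rewrite cstarB cstarZr sx sk0.
  exists (x - t%:C *: (e ** e)).
  by rewrite cmulBr cmulBl cmulZr cmulZl.
have [l el] : exists l, k0 ** k0 = l%:C *: k0.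
  have -> : k0 ** k0 = e ** (e ** e ** e ** (e ** e ** e)) ** e by rewrite /k0 !cmulA.
  apply: line; rewrite !cstarM !se !cmulA //.
have l0 : l != 0.
  by apply/eqP => l0; apply: k00; apply: (sa_sqr_eq0 sk0); rewrite el l0 scale0r.
have qe : l^-1%:C *: k0 = e ** (l^-1%:C *: (e ** e)) ** e by rewrite cmulZr cmulZl.
have sq : (l^-1%:C *: k0)^# = l^-1%:C *: k0 by rewrite cstarZr sk0.
exists (l^-1%:C *: k0); split; first by rewrite qe; exact: hD.
split=> // [||x].
- by rewrite cmulZl cmulZr el !scalerA -!rmorphM /= -mulrA mulVf // mulr1.
- move=> /(congr1 (fun z => l%:C *: z)); rewrite scalerA -rmorphM /= mulfV //.
  by rewrite scale1r scaler0.
set q := l^-1%:C *: k0 in qe sq *.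
have qline y : y^# = y -> exists t : R, q ** y ** q = t%:C *: q.
  move=> sy; have [t et] : exists t, q ** y ** q = t%:C *: k0.
    have e1 : q ** y ** q = e ** ((l^-1%:C *: (e ** e)) ** e ** y ** e ** (l^-1%:C *: (e ** e))) ** e.
      by rewrite qe !cmulA.
    by rewrite e1; apply: line; rewrite -e1 !cstarM sq sy cmulA.
  exists (t * l); rewrite et /q scalerA -rmorphM /= mulfK //.
have [y [z [sy sz ->]]] := sa_parts x.
have [t et] := qline y sy; have [u eu] := qline z sz.
exists (t%:C + iu * u%:C).
move: q qe sq qline et eu => q' _ _ _ et eu.
by rewrite cmulDr cmulDl cmulZr cmulZl et eu scalerA scalerDl.
Qed.

End ExistsMinproj.

Section GlidingHump.
Variables (R : realType) (A : cstarAlgType R).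
Implicit Types (x y z d e l n : A) (a : R[i]) (r t M : R).
Local Notation K := (@pedersen_ideal R A).
Variables (T : A -> A) (b : A).
Hypothesis cT : left_centralizer K T.
Hypothesis ub : local_unit b.

Let idK := pedersen_two_sided A.
Let sb : b^# = b. Proof. exact: ub.1. Qed.
Let Kb : K b. Proof. exact: local_unit_pedersen. Qed.

Lemma cent_lin a x y : K x -> K y -> T (a *: x + y) = a *: T x + T y.
Proof. by case: cT => _ h _; exact: h. Qed.
Lemma cent0 : T 0 = 0.
Proof.
have := cent_lin (-1) (ideal0 idK) (ideal0 idK).
by rewrite scaler0 addr0 scaleN1r addNr.
Qed.
Lemma centZ a x : K x -> T (a *: x) = a *: T x.
Proof. by move=> Kx; have := cent_lin a Kx (ideal0 idK); rewrite !addr0 cent0 addr0. Qed.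
Lemma centD x y : K x -> K y -> T (x + y) = T x + T y.
Proof. by move=> Kx Ky; have := cent_lin 1 Kx Ky; rewrite !scale1r. Qed.
Lemma centM x y : K x -> K y -> T (x ** y) = T x ** y.
Proof. by case: cT => _ _ h; exact: h. Qed.

Local Notation L := (Aq b).
Definition corner : set A := [set y | y ** b = y /\ b ** y = y].
Definition bounded_mul y : Prop :=
  exists2 M : R, 0 <= M & forall x, L x -> nrm (T x ** y) <= M * nrm x.

Lemma L_pedersen x : L x -> K x. Proof. exact: pedersen_mem. Qed.
Lemma cent_L x : L x -> L (T x).
Proof. by move=> Lx; rewrite /Aq /= -{2}Lx centM //; exact: L_pedersen. Qed.
Lemma corner_L y : corner y -> L y. Proof. by case. Qed.
Lemma corner_subalgebra : real_subalgebra corner.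
Proof.
have s1 := right_fixed_subalgebra b.
have [_ _ _ /closedP cl] := s1.
split=> [|r x y [x1 x2] [y1 y2]|x y [x1 x2] [y1 y2]|].
- by split; rewrite ?cmul0x ?cmulx0.
- by split; rewrite ?cmulDl ?cmulDr ?cmulZl ?cmulZr ?x1 ?x2 ?y1 ?y2.
- by split; rewrite -?cmulA ?y1 ?cmulA ?x2.
apply/closedP => x h; split.
  by apply: cl => e /h[y [[y1 _] xy]]; exists y.
rewrite -[RHS]cstarK -[LHS]cstarK; congr cstar; rewrite cstarM sb.
apply: cl => e /h[y [[_ y2] xy]]; exists y^#; split.
  by rewrite /= -{1}sb -cstarM y2.
by rewrite -cstarB nrm_star.
Qed.

Lemma no_orthogonal_sequence (d : nat -> A) :
  (forall n : nat, corner (d n) /\ ~ bounded_mul (d n ** d n)) ->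
  (forall i j : nat, i != j -> d i ** d j = 0) -> False.
Proof.
move=> hd od.
have d0 (n : nat) : 0 < nrm (d n).
  apply: nrm_gt0 => dn0; apply: (hd n).2; exists 0 => // x _.
  by rewrite dn0 !cmulx0 nrm0 mul0r.
have Ld (n : nat) : L (d n) := corner_L (hd n).1.
have /choice[y hy] : forall n : nat, exists y, [/\ L y, nrm (y ** d n) <= 2^-1 ^+ n &
    n%:R * nrm (d n) < nrm (T y ** (d n ** d n))].
  move=> n; have p0 : (0 : R) < 2 ^+ n by rewrite exprn_gt0.
  have [x /not_implyP[Lx]] : exists x, ~ (L x ->
      nrm (T x ** (d n ** d n)) <= n%:R * 2 ^+ n * nrm (d n) ^+ 2 * nrm x).
    apply/existsNP => h; apply: (hd n).2; exists (n%:R * 2 ^+ n * nrm (d n) ^+ 2) => //.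
    by rewrite !mulr_ge0 ?sqr_ge0 // ltW.
  move=> /negP; rewrite -ltNge => hx.
  have x0 : 0 < nrm x.
    apply: nrm_gt0 => x0; move: hx; rewrite x0 cent0 cmul0x nrm0 mulr0.
    by rewrite ltxx.
  pose c : R := (2 ^+ n * nrm x * nrm (d n))^-1.
  have c0 : 0 < c by rewrite invr_gt0 !mulr_gt0.
  exists (c%:C *: x); split.
  - exact: AqZ.
  - rewrite cmulZl nrmZp ?(ltW c0) // /c mulrC ler_pdivrMr ?mulr_gt0 //.
    by rewrite exprVn mulrA mulrA mulVf ?gt_eqF // mul1r nrmM.
  - rewrite centZ ?cmulZl ?nrmZp ?(ltW c0) //; last exact: L_pedersen.
    rewrite /c [X in _ < X]mulrC ltr_pdivlMr ?mulr_gt0 //.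
    by apply: le_lt_trans hx; rewrite expr2 le_eqVlt; apply/orP; left; apply/eqP; ring.
pose S k := \sum_(i < k) y i ** d i.
have LS k : L (S k).
  rewrite /S; elim/big_ind : _ => [||i _]; [exact: Aq0 | exact: AqD | exact: AqM].
have dS k : nrm (S k.+1 - S k) <= 1 * 2^-1 ^+ k.
  by rewrite /S big_ord_recr /= addrAC subrr add0r mul1r; case: (hy k).
have [l hl] := geometric_complete dS.
have Ll : L l.
  have [_ _ _ /closedP cl] := right_fixed_subalgebra b; apply: cl => e e0.
  have [N hN] := geometric_small 2 e0.
  by exists (S N); split; [exact: LS | apply: le_lt_trans (hl N) _; rewrite mulr1 hN].
have ld m : l ** d m = y m ** (d m ** d m).
  apply: nrm_small => e e0.
  have [N hN] := geometric_small (2 * nrm (d m)) e0.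
  pose k := maxn N m.+1.
  have Sd : S k ** d m = y m ** (d m ** d m).
    have mk : (m < k)%N by rewrite /k leq_max leqnn orbT.
    rewrite /S cmul_suml (bigD1 (Ordinal mk)) //= big1 ?addr0 ?cmulA // => i.
    by rewrite -val_eqE /= => im; rewrite -cmulA od ?cmulx0.
  rewrite -Sd -cmulBl; apply: le_trans (nrmM _ _) _.
  apply: ltW; apply: le_lt_trans (hN k (leq_maxl _ _)).
  by have := hl k; rewrite mulr1 => h; rewrite mulrAC ler_wpM2r ?nrm_ge0.
pose m := (Num.trunc (nrm (T l))).+1.
have Tl : nrm (T l) < m%:R by exact: truncnS_gt.
have [Ly _ hm] := hy m.
have : nrm (T l ** d m) <= m%:R * nrm (d m).
  by apply: le_trans (nrmM _ _) _; rewrite ler_wpM2r ?nrm_ge0 // ltW.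
rewrite -centM; [|exact: L_pedersen|exact: L_pedersen].
rewrite ld centM; [|exact: L_pedersen|by apply: (idealMl idK); exact: L_pedersen].
by rewrite leNgt hm.
Qed.

Definition Nb : set A := [set y | corner y /\ bounded_mul y].
Definition Db : set A := [set y | corner y /\
  forall n, Nb n -> y ** n = 0 /\ y^# ** n = 0].

Lemma Nb_mull y n : corner y -> Nb n -> Nb (y ** n).
Proof.
move=> By [Bn [M M0 hM]]; split; first exact: (rsubM corner_subalgebra).
exists (M * nrm y) => [|x Lx]; first by rewrite mulr_ge0 ?nrm_ge0.
have Ky : K y by apply: L_pedersen; exact: corner_L.
have Lxy : L (x ** y) by apply: AqM; exact: corner_L.
rewrite cmulA -centM //; last exact: L_pedersen.
apply: le_trans (hM _ Lxy) _.
by rewrite -mulrA ler_wpM2l // mulrC nrmM.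
Qed.

Lemma Nb_scale r n : Nb n -> Nb (r%:C *: n).
Proof.
move=> [Bn [M M0 hM]]; split; first exact: (rsubZ corner_subalgebra).
exists (`|r| * M) => [|x Lx]; first by rewrite mulr_ge0.
by rewrite cmulZr nrmZr -mulrA ler_wpM2l // hM.
Qed.

Lemma Db_hereditary d x e : Db d -> Db e -> Db (d ** x ** e).
Proof.
move=> [[d1 d2] dN] [[e1 e2] eN]; split=> [|n Nn].
  by split; [rewrite -cmulA e1 | rewrite !cmulA d2].
have [dn dsn] := dN n Nn; have [en esn] := eN n Nn; split.
  by rewrite -cmulA en cmulx0.
by rewrite !cstarM -!cmulA dsn !cmulx0.
Qed.

Lemma nrm_cent_le r x : (forall d, Db d -> d^# = d -> d = 0) -> L x -> 0 <= r ->
  (forall n, Nb n -> nrm (T x ** n) <= r * nrm n) -> nrm (T x) <= r.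
Proof.
move=> D0 Lx r0 h; have LT := cent_L Lx.
have BT : corner ((T x)^# ** T x).
  split; first by rewrite -cmulA LT.
  by rewrite cmulA; congr (_ ** _); rewrite -{1}sb -cstarM LT.
apply: (@nrm_le_of_action _ _ (T x) Nb) => // [n Nn|v Zv sv vN].
  exact: Nb_mull.
rewrite (D0 v) ?cmulx0 //; split.
  exact: (rsub_Zr corner_subalgebra BT Zv).
by move=> n Nn; rewrite sv vN.
Qed.

Lemma uniformly_bounded : (forall d, Db d -> d^# = d -> d = 0) ->
  exists M, forall x, L x -> nrm (T x) <= M * nrm x.
Proof.
move=> D0; apply: contrapT => nb.
pose step (j : nat) (s : A) (W : R) (p : A * (A * R)) := let: (x, (n, M)) := p in
  [/\ L x, nrm x * (W + 1) <= 2^-1 ^+ j, Nb n /\ nrm n <= 1,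
      0 <= M /\ forall z, L z -> nrm (T z ** n) <= M * nrm z
    & j%:R + 1 + nrm (T s) < nrm (T x ** n)].
have /choice[f hf] : forall q : nat * (A * R), exists p, 0 <= q.2.2 ->
    step q.1 q.2.1 q.2.2 p.
  move=> [j [s W]] /=; have [W0|W0] := leP 0 W; last first.
    by exists (0, (0, 0)).
  have W1 : 0 < W + 1 by lra.
  pose r : R := j%:R + 1 + nrm (T s).
  have r0 : 0 <= r by rewrite /r !addr_ge0 ?nrm_ge0.
  pose C := (r + 1) * 2 ^+ j * (W + 1).
  have p2 : (0 : R) < 2 ^+ j by rewrite exprn_gt0.
  have [x0 /not_implyP[Lx0]] : exists x, ~ (L x -> nrm (T x) <= C * nrm x).
    by apply/existsNP => h; apply: nb; exists C.
  move=> /negP; rewrite -ltNge => hx0.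
  have nx0 : 0 < nrm x0.
    by apply: nrm_gt0 => e; move: hx0; rewrite e cent0 nrm0 mulr0 ltxx.
  pose c : R := (2 ^+ j * (W + 1) * nrm x0)^-1.
  have c0 : 0 < c by rewrite invr_gt0 !mulr_gt0.
  pose x := c%:C *: x0.
  have Lx : L x by exact: AqZ.
  have Tx : r < nrm (T x).
    rewrite /x centZ ?nrmZp ?(ltW c0) //; last exact: L_pedersen.
    rewrite /c mulrC ltr_pdivlMr ?mulr_gt0 //.
    apply: le_lt_trans hx0; rewrite /C.
    have -> : (r + 1) * 2 ^+ j * (W + 1) * nrm x0 = (r + 1) * (2 ^+ j * (W + 1) * nrm x0) by ring.
    by rewrite ler_wpM2r ?mulr_ge0 ?(ltW p2) ?(ltW W1) ?(ltW nx0) // lerDl.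
  have [n0 /not_implyP[Nn0]] : exists n, ~ (Nb n -> nrm (T x ** n) <= r * nrm n).
    apply/existsNP => h; have := nrm_cent_le D0 Lx r0 h.
    by rewrite leNgt Tx.
  move=> /negP; rewrite -ltNge => hn0.
  have nn0 : 0 < nrm n0.
    by apply: nrm_gt0 => e; move: hn0; rewrite e cmulx0 nrm0 mulr0 ltxx.
  pose n := (nrm n0)^-1%:C *: n0.
  have Nn : Nb n by exact: Nb_scale.
  have [_ [M M0 hM]] := Nn.
  exists (x, (n, M)) => _; split=> //.
  - rewrite /x nrmZp ?(ltW c0) // /c exprVn.
    have -> : (2 ^+ j * (W + 1) * nrm x0)^-1 * nrm x0 * (W + 1) = (2 ^+ j)^-1 => //.
    by field; rewrite !gt_eqF.
  - split=> //; rewrite /n nrmZp ?invr_ge0 ?nrm_ge0 // mulVf ?gt_eqF //.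
  - rewrite /n cmulZr nrmZp ?invr_ge0 ?nrm_ge0 // mulrC ltr_pdivlMr //.
pose st := fix st j : A * R := if j is j'.+1 then
  let: (s, W) := st j' in let p := f (j', (s, W)) in (s + p.1, W + p.2.2) else (0, 0).
pose s j := (st j).1; pose W j := (st j).2; pose p j := f (j, (s j, W j)).
have sS j : s j.+1 = s j + (p j).1 by rewrite /s /p /= /s /W; case: (st j).
have WS j : W j.+1 = W j + (p j).2.2 by rewrite /W /p /= /s /W; case: (st j).
have W0 j : 0 <= W j.
  elim: j => [|j IH]; first exact: lexx.
  rewrite WS; have := hf (j, (s j, W j)) IH; rewrite -/(p j) /step.
  by case: (p j) => x [n M] /= [_ _ _ [M0 _] _]; exact: addr_ge0.
have hp j : step j (s j) (W j) (p j) := hf (j, (s j, W j)) (W0 j).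
have Wm j k : W j <= W (j + k)%N.
  elim: k => [|k IH]; first by rewrite addn0.
  rewrite addnS WS; apply: le_trans IH _; rewrite lerDl.
  by have := hp (j + k)%N; rewrite /step; case: (p _) => x [n M] /= [_ _ _ []].
have xj j : L (p j).1 /\ nrm (p j).1 * (W j + 1) <= 2^-1 ^+ j.
  by have := hp j; rewrite /step; case: (p _) => x [n M] /= [].
have Ls j : L (s j).
  elim: j => [|j IH]; first exact: Aq0.
  by rewrite sS; apply: AqD => //; case: (xj j).
have p2 (j : nat) : 0 <= (2^-1 : R) ^+ j by rewrite exprn_ge0 // invr_ge0.
have ds j : nrm (s j.+1 - s j) <= 1 * 2^-1 ^+ j.
  rewrite sS addrAC subrr add0r mul1r; have [_] := xj j.
  by have := W0 j; have := nrm_ge0 (p j).1; nra.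
have [l hl] := geometric_complete ds.
have Ll : L l.
  have [_ _ _ /closedP cl] := right_fixed_subalgebra b; apply: cl => e e0.
  have [N hN] := geometric_small 2 e0.
  by exists (s N); split; [exact: Ls | apply: le_lt_trans (hl N) _; rewrite mulr1 hN].
have tail j k : (W j + 1) * nrm (s (j + k)%N - s j) <= 2 * 2^-1 ^+ j - 2 * 2^-1 ^+ (j + k).
  elim: k => [|k IH]; first by rewrite addn0 !subrr nrm0 mulr0.
  rewrite addnS; have h1 := nrm_tri (s (j + k)%N) (s (j + k).+1) (s j).
  have [_ h2] := xj (j + k)%N; have h3 := Wm j k; have h0 := W0 j.
  have es : s (j + k).+1 - s (j + k)%N = (p (j + k)%N).1.
    by rewrite sS addrAC subrr add0r.
  rewrite es sS in h1; rewrite exprS sS.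
  have := nrm_ge0 (p (j + k)%N).1.
  move: (nrm (p (j + k)%N).1) (nrm (s (j + k)%N - s j)) h1 h2 IH => u v h1 h2 IH u0.
  have : (W j + 1) * nrm (s (j + k)%N + (p (j + k)%N).1 - s j) <= (W j + 1) * (u + v).
    by rewrite ler_wpM2l //; lra.
  have : u * (W j + 1) <= u * (W (j + k)%N + 1) by rewrite ler_wpM2l //; lra.
  lra.
have taill j : (W j + 1) * nrm (l - s j) <= 2 * 2^-1 ^+ j.
  apply/ler_addgt0Pr => e e0.
  have [N hN] := geometric_small (2 * (W j + 1)) e0.
  have h1 := hl (j + N)%N; have h2 := tail j N; have h3 := hN (j + N)%N (leq_addl _ _).
  have h4 := nrm_tri (s (j + N)%N) l (s j); have h0 := W0 j.
  have : (W j + 1) * nrm (l - s j) <=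
      (W j + 1) * (nrm (l - s (j + N)%N) + nrm (s (j + N)%N - s j)).
    by rewrite ler_wpM2l //; lra.
  have : (W j + 1) * nrm (l - s (j + N)%N) <= (W j + 1) * (2 * 2^-1 ^+ (j + N)).
    by rewrite ler_wpM2l //; lra.
  by have := p2 (j + N)%N; lra.
pose j := (Num.trunc (nrm (T l))).+1.
have Tl : nrm (T l) < j%:R by exact: truncnS_gt.
have h1 := taill j.+1; rewrite WS sS in h1.
have := hp j; rewrite /step; case: (p j) h1 => x [n M] /= h1.
move=> [Lx _ [Nn n1] [M0 hM] h2].
have Lr : L (l - (s j + x)) by apply: AqB => //; exact: AqD.
have e : T l ** n = T (s j) ** n + T x ** n + T (l - (s j + x)) ** n.
  rewrite -!cmulDl -centD; [|exact: L_pedersen|exact: L_pedersen].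
  rewrite -centD; [|by apply: L_pedersen; exact: AqD|exact: L_pedersen].
  by rewrite addrC subrK.
have h3 := hM _ Lr.
have h4 : nrm (T l ** n) <= nrm (T l).
  by apply: le_trans (nrmM _ _) _; rewrite ler_piMr ?nrm_ge0.
have h5 : nrm (T (s j) ** n) <= nrm (T (s j)).
  by apply: le_trans (nrmM _ _) _; rewrite ler_piMr ?nrm_ge0.
have h6 : nrm (T x ** n) <= nrm (T l ** n) + nrm (T (s j) ** n) + nrm (T (l - (s j + x)) ** n).
  have -> : T x ** n = T l ** n - T (s j) ** n - T (l - (s j + x)) ** n.
    by rewrite e addrAC addrK addrAC subrr add0r.
  by apply: le_trans (nrmBD _ _) _; rewrite lerD2r nrmBD.
have h7 : M * nrm (l - (s j + x)) <= 1.
  have h8 : 2 * 2^-1 ^+ j.+1 <= (1 : R).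
    rewrite exprS mulrA mulfV ?mul1r //.
    by rewrite -[leRHS](expr1n _ j) ler_pXn2r ?nnegrE ?invr_ge0 // invf_le1 // ler1n.
  by have := W0 j; have := nrm_ge0 (l - (s j + x)); nra.
have j1 : (0 : R) <= j%:R by [].
lra.
Qed.

Lemma unbounded_minproj : ~ (exists M, forall x, L x -> nrm (T x) <= M * nrm x) ->
  exists q, minproj q /\ ~ (exists M, forall x, Aq q x -> nrm (T x) <= M * nrm x).
Proof.
move=> nb.
have sq d : Db d -> d^# = d -> d <> 0 -> ~ bounded_mul (d ** d).
  move=> [Bd dN] sd d0 bd; apply: d0; apply: (sa_cube_eq0 sd).
  have [|h _] := dN (d ** d); last by rewrite -cmulA.
  by split=> //; exact: (rsubM corner_subalgebra).
have [q [Dq mq]] : exists q, Db q /\ minproj q.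
  apply: (exists_minproj Db_hereditary).
    apply: contrapT => nd; apply: nb; apply: uniformly_bounded => d Dd sd.
    by apply: contrapT => d0; apply: nd; exists d.
  move=> [d [hd od]]; apply: (@no_orthogonal_sequence d) => // n.
  have [Dd sd d0] := hd n; split; first by case: Dd.
  exact: sq.
exists q; split=> // -[M hM].
have [sqq qq q0 _] := mq; apply: (sq q Dq sqq q0); rewrite qq.
have Kq : K q := pedersen_mem qq.
exists `|M| => // x Lx; rewrite -centM //; last exact: L_pedersen.
have Aqx : Aq q (x ** q) by exact: (Aq_self mq).
apply: le_trans (hM _ Aqx) _.
apply: le_trans (ler_wpM2r (nrm_ge0 _) (ler_norm M)) _.
rewrite ler_wpM2l // (le_trans (nrmM _ _)) // (nrm_q mq) mulr1 //.
Qed.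

End GlidingHump.

(** * The ideal of a minimal projection is elementary *)

(* Aq q as a Hilbert space, for the inner product v^# u = <u, v> q. *)
Record hilb (R : realType) (A : cstarAlgType R) (q : A) (mq : minproj q) :=
  Hilb { hv : A; hvP : Aq q hv }.

Section HilbertInstance.
Variables (R : realType) (A : cstarAlgType R) (q : A) (mq : minproj q).
Local Notation U := (hilb mq).
Implicit Types (u v w : U) (a : R[i]).

Lemma hv_inj u v : hv u = hv v -> u = v.
Proof.
by case: u v => [x Ax] [y Ay] /= e; move: Ax; rewrite e => Ax;
  congr Hilb; exact: Prop_irrelevance.
Qed.

HB.instance Definition _ := gen_eqMixin U.
HB.instance Definition _ := gen_choiceMixin U.

Definition hilb0 : U := Hilb mq (Aq0 q).
Fact hilb_oppP u : Aq q (- hv u).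
Proof. by rewrite -scaleN1r; apply: AqZ; exact: hvP. Qed.
Definition hilb_opp u : U := Hilb mq (hilb_oppP u).
Definition hilb_add u v : U := Hilb mq (AqD (hvP u) (hvP v)).
Definition hilb_scale a u : U := Hilb mq (AqZ a (hvP u)).

Fact hilb_addA : associative hilb_add.
Proof. by move=> u v w; apply: hv_inj; rewrite /= addrA. Qed.
Fact hilb_addC : commutative hilb_add.
Proof. by move=> u v; apply: hv_inj; rewrite /= addrC. Qed.
Fact hilb_add0 : left_id hilb0 hilb_add.
Proof. by move=> u; apply: hv_inj; rewrite /= add0r. Qed.
Fact hilb_addN : left_inverse hilb0 hilb_opp hilb_add.
Proof. by move=> u; apply: hv_inj; rewrite /= addNr. Qed.
HB.instance Definition _ :=
  GRing.isZmodule.Build U hilb_addA hilb_addC hilb_add0 hilb_addN.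

Fact hilb_scaleA a b u : hilb_scale a (hilb_scale b u) = hilb_scale (a * b) u.
Proof. by apply: hv_inj; rewrite /= scalerA. Qed.
Fact hilb_scale1 : left_id 1 hilb_scale.
Proof. by move=> u; apply: hv_inj; rewrite /= scale1r. Qed.
Fact hilb_scaleDr : right_distributive hilb_scale +%R.
Proof. by move=> a u v; apply: hv_inj; rewrite /= scalerDr. Qed.
Fact hilb_scaleDl u : {morph hilb_scale^~ u : a b / a + b}.
Proof. by move=> a b; apply: hv_inj; rewrite /= scalerDl. Qed.
HB.instance Definition _ := GRing.Zmodule_isLmodule.Build R[i] U
  hilb_scaleA hilb_scale1 hilb_scaleDr hilb_scaleDl.

Lemma hvD u v : hv (u + v) = hv u + hv v. Proof. by []. Qed.
Lemma hvZ a u : hv (a *: u) = a *: hv u. Proof. by []. Qed.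

Fact hilb_normD u v : `|hv (u + v)| <= `|hv u| + `|hv v|.
Proof. exact: ler_normD. Qed.
Fact hilb_normZ a u : `|hv (a *: u)| = `|a| * `|hv u|.
Proof. exact: normrZ. Qed.
Fact hilb_norm0 u : `|hv u| = 0 -> u = 0.
Proof. by move=> /normr0_eq0 u0; apply: hv_inj. Qed.
HB.instance Definition _ := Lmodule_isNormed.Build R[i] U
  hilb_normD hilb_normZ hilb_norm0.

Lemma nrm_hv u : nrm u = nrm (hv u).
Proof. by []. Qed.

Fact hilb_complete (F : set_system U) : ProperFilter F -> cauchy F -> cvg F.
Proof.
move=> FF cF.
have cA : cauchy (@hv _ _ _ mq @ F).
  apply/cauchyP => c c0; move/cauchyP: cF => /(_ c c0)[u Fu].
  exists (hv u); move: c0 Fu => /pos_complexP[e e0 ->] Fu.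
  have hF : F [set v | ball (hv u) e%:C (hv v)].
    by apply: filterS Fu => v /nrm_ball uv; apply/nrm_ball; exact: uv.
  exact: hF.
have /cauchy_cvgP/cvg_ex[/= l Fl] := cA.
have Fe (e : R) : 0 < e -> F [set u | nrm (l - hv u) < e].
  move=> e0; have : (@hv _ _ _ mq @ F) [set y | nrm (l - y) < e] => [|//].
  apply: Fl; apply/nbhs_ballP; exists e%:C; first by rewrite /= ltcR.
  by move=> y /nrm_ball.
have Al : Aq q l.
  have /closedP cl := @closed_Aq _ _ q; apply: cl => e /Fe/filter_ex[u lu].
  by exists (hv u); split => //; exact: hvP.
apply/cvg_ex; exists (Hilb mq Al); apply/cvg_ballP => c /pos_complexP[e /Fe Fu ->].
by apply: filterS Fu => u lu; apply/nrm_ball.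
Qed.
HB.instance Definition _ := Uniform_isComplete.Build U hilb_complete.

Definition hilb_inner u v : R[i] := ip q (hv u) (hv v).

Fact hilb_innerPl v : linear_for *%R (hilb_inner^~ v).
Proof. by move=> a u w; rewrite /hilb_inner ip_lin //; exact: hvP. Qed.
Fact hilb_innerC u v : hilb_inner u v = (-1) ^+ false * Num.conj (hilb_inner v u).
Proof. by rewrite expr0 mul1r; apply: ip_conj => //; exact: hvP. Qed.
Fact hilb_innerPr u : linear_for (Num.conj \; *%R) (hilb_inner u).
Proof.
move=> a v w; rewrite /= hilb_innerC [hilb_inner u v]hilb_innerC.
by rewrite [hilb_inner u w]hilb_innerC !expr0 !mul1r hilb_innerPl rmorphD rmorphM.
Qed.
Fact hilb_inner_self u : hilb_inner u u = `|u| ^+ 2.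
Proof. by rewrite /hilb_inner ip_self; [rewrite nrmE rmorphXn | | exact: hvP]. Qed.
Fact hilb_inner_gt0 u : u != 0 -> 0 < hilb_inner u u.
Proof. by move=> u0; rewrite hilb_inner_self exprn_gt0 // normr_gt0. Qed.

HB.instance Definition _ := bilinear_isBilinear.Build R[i] U U R[i]
  *%R (Num.conj \; *%R) hilb_inner (conj hilb_innerPl hilb_innerPr).
HB.instance Definition _ := isHermitianSesquilinear.Build R[i] U false Num.conj
  hilb_inner hilb_innerC.
HB.instance Definition _ := isDotProduct.Build R[i] U hilb_inner hilb_inner_gt0.

HB.instance Definition _ := isHilbert.Build R U
  (inner := (hilb_inner : {dot U for Num.conj})) hilb_inner_self.

End HilbertInstance.

Section JqElementary.
Variables (R : realType) (A : cstarAlgType R) (q : A).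
Hypothesis mq : minproj q.
Local Notation U := (hilb mq).
Implicit Types (x y z : A) (u v w : U) (a : R[i]).

Definition lmul x u : U := Hilb mq (AqM x (hvP u)).

Lemma innerE u v : inner u v = ip q (hv u) (hv v).
Proof. by []. Qed.

Lemma lmul_linear x : linear (lmul x).
Proof. by move=> a u v; apply: hv_inj; rewrite /= cmulDr cmulZr. Qed.

Let ball1 : set U := [set u | `|u| <= 1].

Lemma Fin_tb x : Fin q x -> tb (lmul x @` ball1).
Proof.
move=> Fx; apply: (Fx [set x | tb (lmul x @` ball1)]) => /= [|a y z ty tz|y z Ay Az].
- move=> e e0; exists [:: 0] => _ [u _ <-]; exists 0; rewrite ?inE //.
  rewrite (_ : lmul 0 u = 0) ?subrr ?nrm0 //.
  by apply: hv_inj; rewrite /= cmul0x.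
- apply: tb_sub (tb_lin a ty tz) => _ [u u1 <-].
  exists (lmul y u), (lmul z u); split; [by exists u | by exists u |].
  by apply: hv_inj; rewrite /= cmulDl cmulZl.
- pose v : U := Hilb mq Ay; pose w : U := Hilb mq Az.
  apply: tb_sub (tb_line (nrm w) v) => _ [u u1 <-].
  exists (inner u w).
    apply: le_trans (cauchy_schwarz u w) _.
    by rewrite ler_piMl ?nrm_ge0 // -nrm_le.
  apply: hv_inj; rewrite /= -cmulA (ipE mq) //; last exact: hvP.
  by rewrite cmulZr Ay.
Qed.

Lemma lmul_compact x : Jq q x -> compact_operator (lmul x).
Proof.
move=> /closureP Jx; split; first exact: lmul_linear.
apply: tb_precompact; apply: tb_approx => e e0.
have [y [Fy xy]] := Jx e e0; exists (lmul y @` ball1); first exact: Fin_tb.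
move=> _ [u u1 <-]; exists (lmul y u); first by exists u.
apply: le_lt_trans xy; rewrite nrm_hv /= -cmulBl.
apply: le_trans (nrmM _ _) _; rewrite ler_piMr ?nrm_ge0 //.
by rewrite -nrm_le.
Qed.

Lemma lmul_surj (S : U -> U) : compact_operator S -> exists2 x, Jq q x & lmul x = S.
Proof.
move=> cS; have [C hC] := compact_bounded cS.
have p0 (n : nat) : (0 : R) < 2^-1 ^+ n by rewrite exprn_gt0 // invr_gt0.
have /choice[y hy] : forall n : nat, exists y, Fin q y /\
    forall u, nrm (lmul y u - S u) <= 2^-1 ^+ n * nrm u.
  move=> n; have [s os hs] := compact_approx cS (p0 n).
  have /choice[g hg] : forall v, exists w, forall u, inner (S u) v = inner u w.
    move=> v; apply: (@riesz _ _ (fun u => inner (S u) v) (`|C| * nrm v)) => [a u w|u].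
      by rewrite (compact_lin cS) innPl.
    apply: le_trans (cauchy_schwarz _ _) _; rewrite mulrAC ler_wpM2r ?nrm_ge0 //.
    by apply: le_trans (hC u) _; rewrite ler_wpM2r ?nrm_ge0 // ler_norm.
  exists (\sum_(v <- s) hv v ** (hv (g v))^#); split.
    by apply: (ideal_sum_mem (Fin_ideal q)) => v; apply: Fin_uv; exact: hvP.
  move=> u; have -> : lmul (\sum_(v <- s) hv v ** (hv (g v))^#) u = hproj s (S u).
    apply: hv_inj; rewrite /= cmul_suml /hproj.
    elim: s {os hs} => [|v s IH]; first by rewrite !big_nil.
    rewrite !big_cons hvD hvZ -IH; congr (_ + _).
    rewrite -cmulA (ipE mq); [|exact: hvP|exact: hvP].
    by rewrite cmulZr (hvP v) -innerE -hg.
  by rewrite nrmB; exact: hs.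
have cJ := Jq_ideal q.
have dy n : nrm (y n.+1 - y n) <= 2 * 2^-1 ^+ n.
  have idF := Fin_ideal q.
  apply: (@nrm_le_Aq _ _ q _ _ _ cJ) => [z||| z Az].
  - exact: Jq_faithful.
  - by apply: Fin_Jq; apply: (idealB idF); case: (hy n.+1); case: (hy n).
  - by rewrite mulr_ge0 // ltW.
  pose u : U := Hilb mq Az.
  have -> : nrm ((y n.+1 - y n) ** z) = nrm (lmul (y n.+1) u - lmul (y n) u).
    by rewrite nrm_hv /= cmulBl.
  have := (hy n.+1).2 u; have := (hy n).2 u; have := nrm_tri (S u) (lmul (y n.+1) u) (lmul (y n) u).
  rewrite (nrmB (S u)) exprS (_ : nrm u = nrm z) //.
  by have := mulr_ge0 (ltW (p0 n)) (nrm_ge0 z); lra.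
have [l hl] := geometric_complete dy.
exists l.
  apply: (closed_ideal_lim cJ) => e e0.
  have [N hN] := geometric_small (2 * 2) e0.
  exists (y N); split; first by apply: Fin_Jq; case: (hy N).
  exact: le_lt_trans (hl N) (hN N (leqnn N)).
apply/funext => u; apply: nrm_small => e e0.
have [N hN] := geometric_small (5 * nrm u) e0.
apply: le_trans (nrm_tri (lmul (y N) u) _ _) _.
have := (hy N).2 u; have := hN N (leqnn N).
have : nrm (lmul l u - lmul (y N) u) <= 2 * 2 * 2^-1 ^+ N * nrm u.
  rewrite nrm_hv /= -cmulBl; apply: le_trans (nrmM _ _) _.
  by rewrite ler_wpM2r ?nrm_ge0.
lra.
Qed.

Lemma Jq_elementary : elementary (Jq q).
Proof.
exists U, lmul; split.
- split.
  + by move=> x Jx; exact: lmul_compact.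
  + move=> x y; rewrite !inE => Jx Jy e; apply/subr0_eq/(@Jq_faithful _ _ q).
      exact: (idealB (Jq_ideal q).1).
    move=> z Az; have := congr1 (fun f => hv (f (Hilb mq Az))) e.
    by rewrite /= cmulBl => ->; rewrite subrr.
  + by move=> S /lmul_surj[x Jx <-]; exists x.
- by move=> a x y _ _ u; apply: hv_inj; rewrite /= cmulDl cmulZl.
- by move=> x y _ _ u; apply: hv_inj; rewrite /= cmulA.
- by move=> x _ u v; rewrite !innerE /= (ip_mul mq) //; exact: hvP.
Qed.

End JqElementary.

(** * Proof of the theorem *)

Section Obstruction.
Variables (R : realType) (A : cstarAlgType R) (T : A -> A) (q : A).
Implicit Types (x y z u v : A) (a : R[i]).
Local Notation K := (@pedersen_ideal R A).
Hypothesis cT : left_centralizer K T.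
Hypothesis mq : minproj q.
Hypothesis unb : ~ (exists M, forall x, Aq q x -> nrm (T x) <= M * nrm x).

Let qq : q ** q = q. Proof. by case: mq. Qed.
Let q0 : q <> 0. Proof. by case: mq. Qed.

Lemma Jq_infinite_dimensional : ~ finite_dimensional (Jq q).
Proof.
move=> [n [e [eJ fd]]].
have [[s [sA os hs]]|[v [Av ov]]] := @ortho_basis_or_seq _ _ q mq (Aq q) (fun _ h => h)
  (fun a x y => @Aq_lin _ _ q a x y) (Aq0 q).
  apply: unb; exists (nrm (T (sproj s))) => x Ax; rewrite -{1}(hs x Ax).
  rewrite (centM cT) ?nrmM //; last exact: Aq_pedersen Ax.
  by apply: (Fin_pedersen mq); exact: Fin_sproj.
have /choice[c hc] : forall j : 'I_n.+1, exists c : 'I_n -> R[i],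
    v j = \sum_(i < n) c i *: e i.
  by move=> j; apply: fd; apply: Fin_Jq; apply: (Fin_Aq mq); exact: Av.
pose C := \matrix_(j < n.+1, i < n) c j i.
have kC : kermx C != 0.
  by rewrite -mxrank_eq0 mxrank_ker subn_eq0 -ltnNge ltnS rank_leq_col.
pose r := nz_row (kermx C).
have r0 : r != 0 by rewrite nz_row_eq0.
have rC : r *m C = 0 by apply/sub_kermxP; exact: nz_row_sub.
have sum0 : \sum_(j < n.+1) r ord0 j *: v j = 0.
  transitivity (\sum_(i < n) (r *m C) ord0 i *: e i).
    under eq_bigr do rewrite hc scaler_sumr.
    rewrite exchange_big /=; apply: eq_bigr => i _; rewrite mxE scaler_suml.
    by apply: eq_bigr => j _; rewrite mxE scalerA.
  by rewrite rC big1 // => i _; rewrite mxE scale0r.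
case/eqP: r0; apply/rowP => k; rewrite mxE.
have := congr1 (fun z => (v k)^# ** z) sum0; rewrite /= cmulx0 cmul_sumr.
rewrite (bigD1 k) //= big1 => [|j jk].
  rewrite addr0 cmulZr ov eqxx => /eqP.
  by rewrite scaler_eq0 => /orP[/eqP|/eqP/q0].
rewrite cmulZr ov; case: eqP => [/val_inj kj|_]; last by rewrite scaler0.
by rewrite kj eqxx in jk.
Qed.

Lemma local_unit_basis b : local_unit b -> exists s : seq A,
  (forall v, v \in s -> Aq q v) /\ forall u, Aq q u -> b ** u = u -> sproj s ** u = u.
Proof.
move=> ub; have sb := ub.1; pose V := [set v | Aq q v /\ b ** v = v].
have [||||[v [Vv ov]]] := @ortho_basis_or_seq _ _ q mq V.
- by move=> u [].
- move=> a u v [Au bu] [Av bv]; split; first exact: Aq_lin.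
  by rewrite cmulDr cmulZr bu bv.
- by split; [exact: Aq0 | rewrite cmulx0].
- move=> [s [sV os hs]]; exists s; split=> [v /sV[]//|u Au bu].
  exact: hs.
exfalso; have Av n : Aq q (v n) := (Vv n).1.
have Lv x n : Aq b (x ** (v n)^#).
  by rewrite /Aq /= -cmulA; congr (_ ** _); rewrite -{1}sb -cstarM (Vv n).2.
have vv n : (v n)^# ** v n = q by rewrite ov eqxx.
refine (@no_orthogonal_sequence _ _ T b cT (fun n => v n ** (v n)^#) _ _) => [n|i j ij].
  split; first split; [exact: Lv | by rewrite cmulA (Vv n).2 |].
  rewrite cmulA -(cmulA (v n)) vv (Av n) => -[M M0 hM].
  apply: unb; exists (M * nrm (v n) * nrm (v n)) => x Ax.
  have Kx : K (x ** (v n)^#) by exact: pedersen_mem (Lv x n).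
  have -> : T x = T (x ** (v n)^#) ** (v n ** (v n)^#) ** v n.
    rewrite -!cmulA vv (Av n) -(centM cT) //; last exact: Aq_pedersen (Av n).
    by rewrite -cmulA vv Ax.
  have h2 := nrmM x (v n)^#; rewrite nrm_star in h2.
  apply: le_trans (nrmM _ _) _.
  have -> : M * nrm (v n) * nrm (v n) * nrm x = M * (nrm x * nrm (v n)) * nrm (v n) by ring.
  rewrite ler_wpM2r ?nrm_ge0 // (le_trans (hM _ (Lv x n))) //.
  by rewrite ler_wpM2l.
by rewrite cmulA -(cmulA (v i)) ov (negPf ij) cmulx0 cmul0x.
Qed.

Lemma Jq_ann x y : Jq q x -> Aq_ann q y -> x ** y = 0.
Proof.
move=> Jx yA; apply: (@Jq_faithful _ _ q); first exact: (idealMr (Jq_ideal q).1).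
by move=> u Au; rewrite -cmulA yA ?cmulx0.
Qed.

Lemma Aq_ann_star x : Aq_ann q x -> Aq_ann q x^#.
Proof.
move=> xA u Au; have sq : q^# = q by case: mq.
have Jq1 : Jq q u^#.
  rewrite -(Aq_star mq Au); apply: (idealMr (Jq_ideal q).1).
  by apply: Fin_Jq; apply: (Fin_Aq mq); exact: Aq_q.
by rewrite -[LHS]cstarK cstarM cstarK (Jq_ann Jq1 xA) cstar0.
Qed.

Lemma nrm_Jq_le x0 x1 : Aq_ann q x0 -> Jq q x1 -> nrm x1 <= nrm (x0 + x1).
Proof.
move=> xA Jx; have [->|/eqP/nrm_gt0 n0] := eqVneq x1 0; first by rewrite nrm0 nrm_ge0.
rewrite -(ler_pM2r n0) -expr2 -nrm_Mstar -[in X in _ <= X](nrm_star x1).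
have -> : x1 ** x1^# = (x0 + x1) ** x1^#.
  rewrite cmulDl; have -> : x0 ** x1^# = 0; last by rewrite add0r.
  by rewrite -[LHS]cstarK cstarM cstarK (Jq_ann Jx (Aq_ann_star xA)) cstar0.
exact: nrmM.
Qed.

Lemma Jq_complement x : exists x0 x1, [/\ Aq_ann q x0, Jq q x1 & x = x0 + x1].
Proof.
have [idJ _] := Jq_ideal q; have [idA _] := Aq_ann_ideal q.
apply: (@local_unit_span _ _ [set x | exists x0 x1, [/\ Aq_ann q x0, Jq q x1 & x = x0 + x1]]).
- exists 0, 0; split; [exact: ideal0 | exact: ideal0 | by rewrite addr0].
- move=> a y z [y0 [y1 [h1 h2 ->]]] [z0 [z1 [h3 h4 ->]]].
  exists (a *: y0 + z0), (a *: y1 + z1); split; last by rewrite scalerDr addrACA.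
    by apply: (idealD idA) => //; exact: (idealZ idA).
  by apply: (idealD idJ) => //; exact: (idealZ idJ).
- apply/closedP => y hy; have p0 (n : nat) : (0 : R) < 2^-1 ^+ n by rewrite exprn_gt0 // invr_gt0.
  have /choice[g hg] : forall n : nat, exists p : A * A,
      [/\ Aq_ann q p.1, Jq q p.2 & nrm (y - (p.1 + p.2)) < 2^-1 ^+ n].
    by move=> n; have [_ [[y0 [y1 [h1 h2 ->]]] yn]] := hy _ (p0 n); exists (y0, y1).
  have dg n : nrm ((g n.+1).2 - (g n).2) <= 2 * 2^-1 ^+ n.
    have [h1 h2 h3] := hg n; have [h4 h5 h6] := hg n.+1.
    apply: le_trans (nrm_Jq_le (x0 := (g n.+1).1 - (g n).1) _ _) _.
    - exact: (idealB idA).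
    - exact: (idealB idJ).
    rewrite addrACA -opprD; apply: le_trans (nrm_tri y _ _) _.
    by rewrite (nrmB _ y); rewrite exprS in h6; have := p0 n; lra.
  have [l hl] := geometric_complete dg.
  have small (e C : R) : 0 < e -> exists n, C * 2^-1 ^+ n < e.
    by move=> e0; have [N hN] := geometric_small C e0; exists N; exact: hN.
  exists (y - l), l; split; last by rewrite subrK.
    apply: (closed_ideal_lim (Aq_ann_ideal q)) => e e0; have [n hn] := small e 5 e0.
    have [h1 _ h3] := hg n; exists (g n).1; split => //.
    have -> : y - l - (g n).1 = (y - ((g n).1 + (g n).2)) - (l - (g n).2).
      by rewrite (opprD (g n).1) addrA (opprB l) addrA subrK addrAC.
    by apply: le_lt_trans (nrmBD _ _) _; have := hl n; lra.
  apply: (closed_ideal_lim (Jq_ideal q)) => e e0; have [n hn] := small e (2 * 2) e0.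
  have [_ h2 _] := hg n; exists (g n).2; split => //.
  exact: le_lt_trans (hl n) hn.
move=> y b ub yb; have [s [sA hs]] := local_unit_basis ub.
have Fs : Fin q (sproj s) by exact: Fin_sproj.
exists (y - y ** sproj s), (y ** sproj s); split; last by rewrite subrK.
  rewrite -[_ - _]cstarK; apply: Aq_ann_star => u Au.
  rewrite cstarB cstarM sproj_sa cmulBl -cmulA hs ?subrr //; first exact: AqM.
  by rewrite cmulA; congr (_ ** _); rewrite -{1}ub.1 -cstarM yb.
by apply: Fin_Jq; exact: (idealMl (Fin_ideal q)).
Qed.

Lemma Jq_summand : direct_summand (Jq q).
Proof.
split; first exact: Jq_ideal.
exists (Aq_ann q); split; [exact: Aq_ann_ideal | | exact: Jq_complement].
apply/seteqP; split=> [x [xA Jx]|x ->]; first exact: (@Jq_faithful _ _ q).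
by split; [exact: (ideal0 (Aq_ann_ideal q).1) | exact: (ideal0 (Jq_ideal q).1)].
Qed.

End Obstruction.

Section LocallyBounded.
Variables (R : realType) (A : cstarAlgType R) (T : A -> A) (b : A).
Implicit Types (x y z u v : A).
Local Notation K := (@pedersen_ideal R A).
Hypothesis cT : left_centralizer K T.
Hypothesis ub : local_unit b.

Definition gen_ideal : set A :=
  [set x | forall I, closed_ideal I -> Aq b `<=` I -> I x].

Lemma gen_ideal_closed : closed_ideal gen_ideal.
Proof.
split; first split.
- by move=> I [/ideal0].
- move=> a x y Ix Iy I cI AI; apply: (idealD cI.1); last exact: Iy.
  by apply: (idealZ cI.1); exact: Ix.
- by move=> x y Iy I cI AI; apply: (idealMl cI.1); exact: Iy.
- by move=> x y Ix I cI AI; apply: (idealMr cI.1); exact: Ix.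
apply/closedP => x h I cI AI; apply: (closed_ideal_lim cI) => e /h[y [Iy xy]].
by exists y; split => //; exact: Iy.
Qed.

Lemma gen_ideal_ann v x : v^# = v -> (forall l, Aq b l -> v ** l = 0) ->
  gen_ideal x -> x ** v = 0.
Proof.
move=> sv vL Ix; have : v ** x^# ** x = 0.
  have : [set x | forall y, v ** y ** x = 0] x; last exact.
  apply: Ix => [|l Ll y]; last by rewrite -cmulA vL //; exact: AqM.
  split=> [|]; first split.
  - by move=> y; rewrite cmulx0.
  - by move=> a z t hz ht y; rewrite cmulDr cmulZr hz ht scaler0 addr0.
  - by move=> z t ht y; rewrite cmulA -(cmulA v) ht.
  - by move=> z t hz y; rewrite cmulA hz cmul0x.
  apply/closedP => z h y; apply: nrm_le0; apply/ler_addgt0Pr => e e0; rewrite add0r.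
  have [d d0 hd] := cmul_near (v ** y) z e0; have [t [ht zt]] := h d d0.
  by have := hd (v ** y) t; rewrite subrr nrm0 ht subr0 => /(_ d0 zt)/ltW.
move=> h; apply: starM_eq0; rewrite cstarM sv.
by rewrite -cmulA (cmulA x^#) [LHS]cmulA cmulA h cmul0x.
Qed.

Lemma bounded_gen_ideal (M : R) : (forall x, Aq b x -> nrm (T x) <= M * nrm x) ->
  bounded_on (K `&` gen_ideal) T.
Proof.
move=> hM; exists `|M| => x [Kx Ix]; rewrite nrmE (nrmE x) -rmorphM lecR.
apply: (@nrm_le_of_action _ _ (T x) (Aq b)).
- by rewrite mulr_ge0 ?nrm_ge0.
- by move=> l Ll; exact: AqM.
- move=> l Ll; rewrite -(centM cT) //; last exact: pedersen_mem Ll.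
  apply: le_trans (hM _ (AqM x Ll)) _.
  apply: le_trans (ler_wpM2r (nrm_ge0 _) (ler_norm M)) _.
  by rewrite -mulrA ler_wpM2l // nrmM.
move=> v Zv sv vL; apply: nrm_le0; apply/ler_addgt0Pr => e e0; rewrite add0r.
have n0 : 0 < nrm (T x) + 1 by have := nrm_ge0 (T x); lra.
have [y [Zy Ky vy]] := sa_pedersen_approx sv (divr_gt0 e0 n0).
have yL : forall l, Aq b l -> y ** l = 0.
  exact: (rsub_Zr (left_annihilator_subalgebra (Aq b)) vL Zy).
have Ty : T x ** y = 0.
  rewrite -(centM cT) // (gen_ideal_ann (Zr_sa sv Zy) yL Ix).
  exact: (cent0 cT).
have -> : T x ** v = T x ** (v - y) by rewrite cmulBr Ty subr0.
apply: le_trans (nrmM _ _) _; rewrite ler_pdivlMr // in vy.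
by have := nrm_ge0 (v - y); nra.
Qed.

End LocallyBounded.

Theorem corollary4p7 (R : realType) (A : cstarAlgType R) :
  (forall T : A -> A,
     left_centralizer (@pedersen_ideal R A) T -> locally_bounded T) <->
  ~ (exists I : set A,
       [/\ direct_summand I, elementary I & ~ finite_dimensional I]).
Proof.
split=> [lb [I [sI eI fI]]|noI T cT].
  by have [T [cT]] := elementary_minproj sI eI fI; apply; exact: lb.
have bL b : local_unit b -> exists M, forall x, Aq b x -> nrm (T x) <= M * nrm x.
  move=> ub; apply: contrapT => /(unbounded_minproj cT ub)[q [mq unb]].
  apply: noI; exists (Jq q); split.
  - exact: Jq_summand cT mq unb.
  - exact: Jq_elementary.
  - exact: Jq_infinite_dimensional cT mq unb.
(* The tag in 'I_4 lets one family take four members of the same ideal. *)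
pose J := {p : A * 'I_4 | local_unit p.1}.
exists J, (fun j => gen_ideal (sval j).1); split=> [j||[[b i] /= ub]].
- exact: gen_ideal_closed.
- apply/seteqP; split=> // x _; apply/closureP => e e0.
  have [a [b [ab [s xs]]]] := local_unit_approx x e0.
  exists (\sum_i s i *: a i); split => //.
  pose j i : J := exist _ (b i, i) (ab i).1.
  exists [seq j i | i <- index_enum 'I_4],
    (fun p : J => if `[< (sval p).1 = b (sval p).2 >]
                  then s (sval p).2 *: a (sval p).2 else 0); split.
    move=> [[c i] uc] /=; case: asboolP => [cb|_] I cI AI; last exact: (ideal0 cI.1).
    by apply: (idealZ cI.1); apply: AI; rewrite /Aq /= cb; exact: (ab i).2.
  rewrite big_map; apply: eq_bigr => i _ /=.
  by rewrite asboolT.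
- have [M hM] := bL b ub; exact: (bounded_gen_ideal cT hM).
Qed.
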